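(* Let $(A,\delta)$ be a coaction of a locally compact group $G$, and let $(A\rtimes_\delta G,j_A,j_G)$ be its usual crossed product (universal for nondegenerate covariant homomorphisms). Then $(j_A,j_G)$ is also universal among degenerate covariant homomorphisms. More precisely: for any degenerate covariant homomorphism $(\pi,\mu)$ of $(A,\delta)$ to a $C^*$-algebra $B$, there is a unique homomorphism $\pi\times\mu:A\rtimes_\delta G\to M(B)$ satisfying $$(\pi\times\mu)\bigl(j_A(a)j_G(f)\bigr)=\pi(a)\mu(f)\quad\text{for all }a\in A,\ f\in C_0(G).$$
   Context: $\otimes$ is the minimal tensor product and homomorphisms are $*$-homomorphisms. For $C^*$-algebras $A,C$ put $\widetilde M(A\otimes C)=\{m\in M(A\otimes C): m(1\otimes C)\cup(1\otimes C)m\subset A\otimes C\}$. A (possibly degenerate) homomorphism $\pi:A\to M(B)$ induces $\overline{\pi\otimes\mathrm{id}}:\widetilde M(A\otimes C)\to M(B\otimes C)$, determined by $\overline{\pi\otimes\mathrm{id}}(m)(1\otimes c)=(\pi\otimes\mathrm{id})(m(1\otimes c))$ for $c\in C$. Let $\delta_G:C^*(G)\to M(C^*(G)\otimes C^*(G))$ be the comultiplication, $\delta_G(s)=s\otimes s$ for $s\in G$. A coaction $(A,\delta)$ of $G$ is a $C^*$-algebra $A$ with an injective nondegenerate homomorphism $\delta:A\to \widetilde M(A\otimes C^*(G))\subset M(A\otimes C^*(G))$ such that $(\delta\otimes\mathrm{id})\circ\delta=(\mathrm{id}\otimes\delta_G)\circ\delta$ and $\overline{\mathrm{span}}\,\delta(A)(1\otimes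 C^*(G))=A\otimes C^*(G)$. Let $w_G\in M(C_0(G)\otimes C^*(G))=C_b(G,M^\beta(C^*(G)))$ ($\beta$ = strict topology) be the unitary $w_G(s)=s$. A degenerate covariant homomorphism of $(A,\delta)$ to a $C^*$-algebra $B$ is a pair $(\pi,\mu)$ of homomorphisms $\pi:A\to M(B)$ and $\mu:C_0(G)\to M(B)$ such that $\mu$ is nondegenerate ($\pi$ is allowed, but not required, to be degenerate) and $$\overline{\pi\otimes\mathrm{id}}(\delta(a))=\mathrm{Ad}\,\bigl((\mu\otimes\mathrm{id})(w_G)\bigr)(\pi(a)\otimes1)\quad\text{for all }a\in A.$$ It is a nondegenerate covariant homomorphism if moreover $\pi$ is nondegenerate. The usual crossed product $(A\rtimes_\delta G,j_A,j_G)$ consists of a $C^*$-algebra and a nondegenerate covariant homomorphism $(j_A,j_G)$ of $(A,\delta)$ to $A\rtimes_\delta G$ (with $A\rtimes_\delta G=\overline{\mathrm{span}}\,j_A(A)j_G(C_0(G))$) such that for every nondegenerate covariant homomorphism $(\pi,\mu)$ of $(A,\delta)$ to a $C^*$-algebra $B$ there is a unique homomorphism $\pi\times\mu:A\rtimes_\delta G\to M(B)$ with $(\pi\times\mu)(j_A(a)j_G(f))=\pi(a)\mu(f)$ for all $a\in A,f\in C_0(G)$. *)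

(* Defs.v *)
From HB Require Import structures.
From mathcomp Require Import all_boot all_order all_algebra.
From mathcomp Require Import complex.
From mathcomp Require Import all_classical all_reals all_analysis.
From mathcomp Require Import ring.
Set Implicit Arguments. Unset Strict Implicit. Unset Printing Implicit Defensive.
Import Order.TTheory GRing.Theory Num.Theory.
Import numFieldNormedType.Exports.
Local Open Scope classical_set_scope.
Local Open Scope ring_scope.
Local Open Scope complex_scope.


HB.mixin Record isTopGroup G & Topological G & Group G := {
  mulg_continuous : continuous (fun p : G * G => (p.1 * p.2)%g) ;
  invg_continuous : continuous (fun s : G => s^-1%g) }.

#[short(type="topGroupType")]
HB.structure Definition TopGroup := {G of isTopGroup G & Topological G & Group G}.

Reserved Notation "x ** y" (at level 40, left associativity).

HB.mixin Record isStarAlgebra (R : realType) A & GRing.Lmodule R[i] A := {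
  amul : A -> A -> A ;
  star : A -> A ;
  amulA : associative amul ;
  amulDl : left_distributive amul +%R ;
  amulDr : right_distributive amul +%R ;
  amulZl : forall (k : R[i]) (x y : A), amul (k *: x) y = k *: amul x y ;
  amulZr : forall (k : R[i]) (x y : A), amul x (k *: y) = k *: amul x y ;
  starK : involutive star ;
  starD : forall x y : A, star (x + y) = star x + star y ;
  starZ : forall (k : R[i]) (x : A), star (k *: x) = k^* *: star x ;
  starM : forall x y : A, star (amul x y) = amul (star y) (star x) }.

#[short(type="starAlgType")]
HB.structure Definition StarAlgebra (R : realType) :=
  {A of isStarAlgebra R A & GRing.Lmodule R[i] A}.

Notation "x ** y" := (amul x y) : ring_scope.

HB.mixin Record isCstarAlgebra (R : realType) A
    & CompleteNormedModule R[i] A & StarAlgebra R A := {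
  norm_amul : forall x y : A, `|x ** y| <= `|x| * `|y| ;
  norm_starM : forall x : A, `|star x ** x| = `|x| ^+ 2 }.

#[short(type="cstarAlgType")]
HB.structure Definition CstarAlgebra (R : realType) :=
  {A of isCstarAlgebra R A & CompleteNormedModule R[i] A & StarAlgebra R A}.

(* Double centralizers in the sense of Busby: linearity, boundedness and
   L (x y) = L x y, R (x y) = x R y follow from mult_centralizer when A is a
   C*-algebra. *)
Record mult (R : realType) (A : cstarAlgType R) := Mult {
  lmult : A -> A ;
  rmult : A -> A ;
  mult_centralizer : forall x y : A, x ** lmult y = rmult x ** y }.

Section MultiplierAlgebra.
Local Obligation Tactic := idtac.
Variables (R : realType) (A : cstarAlgType R).
Implicit Types (m n p : mult A) (x y z : A).

Lemma amul0l x : 0 ** x = 0.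
Proof. by rewrite -(scale0r 0) amulZl !scale0r. Qed.

Lemma amul0r x : x ** 0 = 0.
Proof. by rewrite -(scale0r 0) amulZr !scale0r. Qed.

Lemma amulNl x y : (- x) ** y = - (x ** y).
Proof. by rewrite -scaleN1r amulZl scaleN1r. Qed.

Lemma amulNr x y : x ** (- y) = - (x ** y).
Proof. by rewrite -scaleN1r amulZr scaleN1r. Qed.

Lemma star_amul_eq0 x : star x ** x = 0 -> x = 0.
Proof.
move=> x0; apply/eqP; rewrite -normr_eq0 -sqrf_eq0 -norm_starM x0.
by rewrite normr0.
Qed.

Lemma amul_injl x y : (forall z, z ** x = z ** y) -> x = y.
Proof.
move=> h; apply/eqP; rewrite -subr_eq0; apply/eqP/star_amul_eq0.
by rewrite amulDr amulNr h subrr.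
Qed.

Lemma amul_injr x y : (forall z, x ** z = y ** z) -> x = y.
Proof.
move=> h; rewrite -(starK x) -(starK y); congr star.
by apply: amul_injl => z; rewrite -(starK z) -!starM h.
Qed.

Lemma mult_eq m n : lmult m =1 lmult n -> rmult m =1 rmult n -> m = n.
Proof.
case: m n => [l r e] [l' r' e'] /= /funext ll /funext rr.
rewrite {}ll {}rr in e *.
by rewrite (Prop_irrelevance e e').
Qed.

Lemma lmultD m : {morph lmult m : x y / x + y}.
Proof.
by move=> x y; apply: amul_injl => z; rewrite amulDr !mult_centralizer amulDr.
Qed.

Lemma lmultZ m k : {morph lmult m : x / k *: x}.
Proof.
by move=> x; apply: amul_injl => z; rewrite amulZr !mult_centralizer amulZr.
Qed.

Lemma rmultD m : {morph rmult m : x y / x + y}.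
Proof.
by move=> x y; apply: amul_injr => z; rewrite amulDl -!mult_centralizer amulDl.
Qed.

Lemma rmultZ m k : {morph rmult m : x / k *: x}.
Proof.
by move=> x; apply: amul_injr => z; rewrite amulZl -!mult_centralizer amulZl.
Qed.

Program Definition mult0 : mult A := @Mult R A (fun=> 0) (fun=> 0) _.
Next Obligation. by move=> x y; rewrite amul0l amul0r. Qed.

Program Definition mult1 : mult A := @Mult R A id id _.
Next Obligation. by []. Qed.

Program Definition multD m n : mult A :=
  @Mult R A (fun x => lmult m x + lmult n x) (fun x => rmult m x + rmult n x) _.
Next Obligation.
by move=> m n x y; rewrite amulDl amulDr !mult_centralizer.
Qed.

Program Definition multZ (k : R[i]) m : mult A :=
  @Mult R A (fun x => k *: lmult m x) (fun x => k *: rmult m x) _.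
Next Obligation.
by move=> k m x y; rewrite amulZl amulZr mult_centralizer.
Qed.

Program Definition multM m n : mult A :=
  @Mult R A (lmult m \o lmult n) (rmult n \o rmult m) _.
Next Obligation. by move=> m n x y /=; rewrite !mult_centralizer. Qed.

Program Definition mult_star m : mult A :=
  @Mult R A (fun x => star (rmult m (star x))) (fun x => star (lmult m (star x))) _.
Next Obligation.
move=> m x y; rewrite -[x in LHS]starK -[y in RHS]starK -!starM.
by rewrite mult_centralizer.
Qed.

(* The embedding of A in M(A) as left and right multiplications. *)
Program Definition to_mult x : mult A := @Mult R A (fun y => x ** y) (fun y => y ** x) _.
Next Obligation. by move=> x y z /=; rewrite amulA. Qed.

HB.instance Definition _ := gen_eqMixin (mult A).
HB.instance Definition _ := gen_choiceMixin (mult A).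

Lemma multDA : associative multD.
Proof. by move=> m n p; apply: mult_eq => x /=; rewrite addrA. Qed.

Lemma multDC : commutative multD.
Proof. by move=> m n; apply: mult_eq => x /=; rewrite addrC. Qed.

Lemma mult0D : left_id mult0 multD.
Proof. by move=> m; apply: mult_eq => x /=; rewrite add0r. Qed.

Lemma multND : left_inverse mult0 (multZ (-1)) multD.
Proof. by move=> m; apply: mult_eq => x /=; rewrite scaleN1r addNr. Qed.

HB.instance Definition _ := GRing.isZmodule.Build (mult A) multDA multDC mult0D multND.

Lemma multZA a b m : multZ a (multZ b m) = multZ (a * b) m.
Proof. by apply: mult_eq => x /=; rewrite scalerA. Qed.

Lemma multZ1 : left_id 1 multZ.
Proof. by move=> m; apply: mult_eq => x /=; rewrite scale1r. Qed.

Lemma multZDr : right_distributive multZ +%R.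
Proof. by move=> a m n; apply: mult_eq => x /=; rewrite scalerDr. Qed.

Lemma multZDl m : {morph multZ^~ m : a b / a + b}.
Proof. by move=> a b; apply: mult_eq => x /=; rewrite scalerDl. Qed.

HB.instance Definition _ :=
  GRing.Zmodule_isLmodule.Build R[i] (mult A) multZA multZ1 multZDr multZDl.

Lemma multMA : associative multM.
Proof. by move=> m n p; apply: mult_eq. Qed.

Lemma multMDl : left_distributive multM +%R.
Proof. by move=> m n p; apply: mult_eq => x //=; rewrite rmultD. Qed.

Lemma multMDr : right_distributive multM +%R.
Proof. by move=> m n p; apply: mult_eq => x //=; rewrite lmultD. Qed.

Lemma multMZl k m n : multM (k *: m) n = k *: multM m n.
Proof. by apply: mult_eq => x //=; rewrite rmultZ. Qed.

Lemma multMZr k m n : multM m (k *: n) = k *: multM m n.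
Proof. by apply: mult_eq => x //=; rewrite lmultZ. Qed.

Lemma mult_starK : involutive mult_star.
Proof. by move=> m; apply: mult_eq => x /=; rewrite !starK. Qed.

Lemma mult_starD m n : mult_star (m + n) = mult_star m + mult_star n.
Proof. by apply: mult_eq => x /=; rewrite starD. Qed.

Lemma mult_starZ k m : mult_star (k *: m) = k^* *: mult_star m.
Proof. by apply: mult_eq => x /=; rewrite starZ. Qed.

Lemma mult_starM m n : mult_star (multM m n) = multM (mult_star n) (mult_star m).
Proof. by apply: mult_eq => x /=; rewrite starK. Qed.

HB.instance Definition _ := isStarAlgebra.Build R (mult A) multMA multMDl
  multMDr multMZl multMZr mult_starK mult_starD mult_starZ mult_starM.

End MultiplierAlgebra.

Section ComplexComplete.
Variable R : realType.

Lemma normcE_real (z : R[i]) : `|z| = (Normc.normc z)%:C.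
Proof. by []. Qed.

Lemma normc_ge0_real (z : R[i]) : 0 <= Normc.normc z.
Proof. by case: z => a b /=; rewrite sqrtr_ge0. Qed.

Lemma gt0_realc (e : R[i]) : 0 < e -> e = (complex.Re e)%:C /\ 0 < complex.Re e.
Proof. by case: e => a b; rewrite ltcE /= => /andP[/eqP -> ->]. Qed.

Lemma Re_le_normc (z : R[i]) : `|complex.Re z| <= Normc.normc z.
Proof. by have := normc_ge_Re z; rewrite normcE_real lecR. Qed.

Lemma Im_le_normc (z : R[i]) : `|complex.Im z| <= Normc.normc z.
Proof.
case: z => a b /=; rewrite -sqrtr_sqr ler_wsqrtr // lerDr; exact: sqr_ge0.
Qed.

Lemma normc_le_ReIm (z : R[i]) :
  Normc.normc z <= `|complex.Re z| + `|complex.Im z|.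
Proof.
case: z => a b /=.
rewrite -(@ger0_norm _ (`|a| + `|b|)) ?addr_ge0 // -sqrtr_sqr ler_wsqrtr //.
by rewrite sqrrD !real_normK ?num_real // addrAC lerDl mulrn_wge0.
Qed.

Lemma complex_cauchy_cvg (F : set_system R[i]^o) :
  ProperFilter F -> cauchy F -> exists l : R[i]^o, F --> l.
Proof.
move=> FF /cauchyP Fc.
have cvgp (p : R[i] -> R) :
    (forall x y, `|p x - p y| <= Normc.normc (x - y)) ->
    exists l, forall e, 0 < e -> \forall z \near F, `|l - p z| < e.
  move=> pL.
  have : cauchy (p @ F).
    apply/cauchyP => e e0.
    have [|x Fx] := Fc (e%:C); first by rewrite ltcR.
    exists (p x); suff : F (p @^-1` ball (p x) e) by [].
    move: Fx; rewrite -!ball_normE; apply: filterS => z /= zx.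
    apply: le_lt_trans (pL _ _) _.
    by rewrite -ltcR -normcE_real.
  move=> /cauchy_cvg /cvg_ex[l pl]; exists l => e e0.
  by move/cvgrPdist_lt : pl => /(_ _ e0).
have [a Fa] := cvgp (@complex.Re R) (fun x y => ltac:(
  have := Re_le_normc (x - y); by case: x; case: y)).
have [b Fb] := cvgp (@complex.Im R) (fun x y => ltac:(
  have := Im_le_normc (x - y); by case: x; case: y)).
exists (a +i* b); apply/cvgrPdist_lt => e /gt0_realc[-> e0].
have e20 : 0 < complex.Re e / 2 by rewrite divr_gt0.
apply: filterS2 (Fa _ e20) (Fb _ e20) => z za zb.
rewrite normcE_real ltcR; apply: le_lt_trans (normc_le_ReIm _) _.
rewrite (splitr (complex.Re e)).
by case: z za zb => z1 z2 /= za zb; exact: ltrD.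
Qed.

End ComplexComplete.

Section VanishingFunctions.
Variables (R : realType) (G : topGroupType).
Local Notation C := R[i].

Definition c0_pred : {pred G -> C} := fun f =>
  `[< continuous (f : G -> C^o) /\
      forall e : C, 0 < e ->
        exists2 K : set G, compact K & forall s, ~ K s -> `|f s| < e >].

Lemma c0_submod : submod_closed c0_pred.
Proof.
split.
  apply/asboolP; split; first by move=> s; exact: cvg_cst.
  by move=> e e0; exists set0 => [|s _]; [exact: compact0|rewrite normr0].
move=> a f g /asboolP[fc fv] /asboolP[gc gv]; apply/asboolP; split.
  move=> s; apply: (@cvgD C C^o); last exact: gc.
  by apply: (@cvgZr C C^o); exact: fc.
move=> e e0.
have a0 : 0 < `|a| + 1 by rewrite ltr_wpDl.
have [|K1 cK1 K1e] := fv (e / 2 / (`|a| + 1)); first by rewrite !divr_gt0.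
have [|K2 cK2 K2e] := gv (e / 2); first by rewrite divr_gt0.
exists (K1 `|` K2); first exact: compactU.
move=> s Ks; apply: le_lt_trans (ler_normD _ _) _.
rewrite (splitr e) ltrD //; last by apply: K2e => ?; apply: Ks; right.
rewrite normrM.
have /K1e : ~ K1 s by move=> ?; apply: Ks; left.
rewrite ltr_pdivlMr // => h; apply: le_lt_trans h.
by rewrite mulrC ler_wpM2l // lerDl.
Qed.

HB.instance Definition _ := GRing.isSubmodClosed.Build C (G -> C) c0_pred c0_submod.

(* C_0(G): continuous functions that are small outside compact sets. *)
Record c0 := C0 { c0_fun :> G -> C ; c0_funP : c0_fun \in c0_pred }.

HB.instance Definition _ := [isSub for c0_fun].
HB.instance Definition _ := [Choice of c0 by <:].
HB.instance Definition _ := [SubChoice_isSubLmodule of c0 by <:].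

Implicit Types f g : c0.

Lemma c0_eq f g : (forall s, f s = g s) -> f = g.
Proof. by move=> fg; apply: val_inj; apply/funext. Qed.

Lemma c0_continuous f : continuous (f : G -> C^o).
Proof. by have /asboolP[] := c0_funP f. Qed.

Lemma c0_vanish f (e : C) : 0 < e ->
  exists2 K : set G, compact K & forall s, ~ K s -> `|f s| < e.
Proof. by have /asboolP[_] := c0_funP f; exact. Qed.

Definition c0_norm f : C := (sup (range (fun s => Normc.normc (f s))))%:C.

Lemma c0_bounded f : exists M : R, forall s, Normc.normc (f s) <= M.
Proof.
have [K cK K1] := c0_vanish f ltr01.
pose p s : R := Normc.normc (f s).
have pc : continuous p.
  move=> s; apply/cvgrPdist_lt => e e0.
  have := @c0_continuous f s => /cvgrPdist_lt /(_ (e%:C)); rewrite ltcR => /(_ e0).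
  apply: filterS => t /= h; rewrite -ltcR; apply: le_lt_trans h.
  have -> : (`|p s - p t|)%:C = `| `|f s| - `|f t| | :> C.
    rewrite !normcE_real -rmorphB /=; congr (_ %:C).
    by rewrite expr0n /= addr0 sqrtr_sqr.
  exact: ler_dist_dist.
have : compact (p @` K) by apply: continuous_compact => //; exact: continuous_subspaceT.
move=> /compact_bounded[M [_ MP]].
exists (Num.max (M + 1) 1) => s; rewrite le_max; apply/orP.
have [Ks|Ks] := pselect (K s); [left|right].
  have /= := MP (M + 1) _ (p s); rewrite ger0_norm ?normc_ge0_real //; apply.
  - by rewrite ltrDl.
  - by exists s.
by apply: ltW; have := K1 _ Ks; rewrite normcE_real ltcR.
Qed.

Lemma c0_normcP f s : `|f s| <= c0_norm f.
Proof.
rewrite normcE_real lecR; apply: ub_le_sup; last by exists s.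
by have [M fM] := c0_bounded f; exists M => _ [t _ <-].
Qed.

Lemma c0_norm_le f (M : C) : (forall s, `|f s| <= M) -> c0_norm f <= M.
Proof.
move=> fM.
have M0 : 0 <= M by apply: le_trans (fM 1%g).
have MR : M = (complex.Re M)%:C.
  by case: M M0 {fM} => a b; rewrite lecE /= => /andP[/eqP ->].
rewrite MR lecR; apply: ge_sup; first by exists (Normc.normc (f 1%g)); exists 1%g.
by move=> _ [s _ <-]; rewrite -lecR -MR -normcE_real.
Qed.

Lemma c0_normD f g : c0_norm (f + g) <= c0_norm f + c0_norm g.
Proof.
apply: c0_norm_le => s; apply: le_trans (ler_normD _ _) _.
by rewrite lerD ?c0_normcP.
Qed.

Lemma c0_norm_ge0 f : 0 <= c0_norm f.
Proof. exact: le_trans (c0_normcP f 1%g). Qed.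

Lemma c0_normZ (a : C) f : c0_norm (a *: f) = `|a| * c0_norm f.
Proof.
apply: le_anti; apply/andP; split.
  by apply: c0_norm_le => s; rewrite normrM ler_wpM2l ?c0_normcP.
have [->|a0] := eqVneq a 0; first by rewrite normr0 mul0r c0_norm_ge0.
have a1 : 0 < `|a| by rewrite normr_gt0.
rewrite -ler_pdivlMl //; apply: c0_norm_le => s.
rewrite ler_pdivlMl // -normrM; exact: (c0_normcP (a *: f)).
Qed.

Lemma c0_norm0_eq0 f : c0_norm f = 0 -> f = 0.
Proof.
move=> f0; apply: c0_eq => s; apply/eqP; rewrite -normr_le0 -f0; exact: c0_normcP.
Qed.

HB.instance Definition _ :=
  Lmodule_isNormed.Build C c0 c0_normD c0_normZ c0_norm0_eq0.

Lemma c0_cauchy_cvg (F : set_system c0) : ProperFilter F -> cauchy F -> cvg F.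
Proof.
move=> FF /cauchyP Fc.
have [l Fl] : exists l : G -> C^o, forall s, (fun f : c0 => f s : C^o) @ F --> l s.
  suff h s : exists l : C^o, (fun f : c0 => f s : C^o) @ F --> l.
    by exists (fun s => projT1 (cid (h s))) => s; exact: projT2 (cid (h s)).
  apply: complex_cauchy_cvg; apply/cauchyP => e e0.
  have [f Ff] := Fc e e0; exists (f s).
  suff : F ((fun f : c0 => f s : C^o) @^-1` ball (f s : C^o) e) by [].
  move: Ff; rewrite -!ball_normE; apply: filterS => g /= fg.
  exact: le_lt_trans (c0_normcP (f - g) s) fg.
have unif e : 0 < e -> exists f : c0, (\forall g \near F, `|f - g| < e) /\
    forall s, `|f s - l s| <= e.
  move=> e0; have [f] := Fc e e0; rewrite -ball_normE => Ff; exists f; split => // s.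
  apply/ler_addgt0Pr => d d0.
  have := Fl s; move/cvgrPdist_lt => /(_ _ d0) Fd.
  have [g [/= fg gl]] := filter_ex (filterI Ff Fd).
  rewrite -(subrKA (g s)); apply: le_trans (ler_normD _ _) _.
  rewrite lerD //; last by rewrite distrC ltW.
  exact: le_trans (c0_normcP (f - g) s) (ltW fg).
have l0 : l \in c0_pred.
  apply/asboolP; split.
    move=> s; apply/cvgrPdist_lt => e e0.
    have e3 : 0 < e / 3 by rewrite divr_gt0.
    have [f [_ fl]] := unif _ e3.
    have /cvgrPdist_lt /(_ _ e3) := @c0_continuous f s.
    apply: filterS => t fst.
    have -> : e = e / 3 + e / 3 + e / 3 by field.
    rewrite -(subrKA (f t)) -[l s - _](subrKA (f s)).
    apply: le_lt_trans (ler_normD _ _) _; apply: ltr_leD => //.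
    apply: le_lt_trans (ler_normD _ _) _; apply: ler_ltD => //.
    by rewrite distrC.
  move=> e e0; have e2 : 0 < e / 2 by rewrite divr_gt0.
  have [f [_ fl]] := unif _ e2.
  have [K cK Ke] := c0_vanish f e2; exists K => // s /Ke fs.
  rewrite -(subrK (f s) (l s)) (splitr e).
  apply: le_lt_trans (ler_normD _ _) _; apply: ler_ltD => //.
  by rewrite distrC.
apply/cvg_ex; exists (C0 l0); apply/cvgrPdist_le => e e0.
have e2 : 0 < e / 2 by rewrite divr_gt0.
have [f [Ff fl]] := unif _ e2.
apply: filterS Ff => g fg; apply: c0_norm_le => s.
rewrite -[_ s]/(l s - g s) -(subrKA (f s)) (splitr e).
apply: le_trans (ler_normD _ _) _; rewrite lerD //; first by rewrite distrC.
exact: le_trans (c0_normcP (f - g) s) (ltW fg).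
Qed.

HB.instance Definition _ := Uniform_isComplete.Build c0 c0_cauchy_cvg.

Lemma c0_mul_subproof f g : (fun s => f s * g s) \in c0_pred.
Proof.
apply/asboolP; split.
  by move=> s; apply: (@cvgM C); exact: c0_continuous.
move=> e e0.
have g0 : 0 < c0_norm g + 1 by rewrite ltr_wpDl ?c0_norm_ge0.
have [|K cK Ke] := @c0_vanish f (e / (c0_norm g + 1)); first by rewrite divr_gt0.
exists K => // s /Ke; rewrite ltr_pdivlMr // => h; rewrite normrM.
apply: le_lt_trans h; rewrite ler_wpM2l //.
by apply: le_trans (c0_normcP g s) _; rewrite lerDl.
Qed.

Lemma c0_star_subproof f : (fun s => (f s)^*) \in c0_pred.
Proof.
apply/asboolP; split.
  move=> s; apply/cvgrPdist_lt => e e0.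
  have /cvgrPdist_lt /(_ _ e0) := @c0_continuous f s.
  by apply: filterS => t; rewrite -rmorphB normcJ.
move=> e e0; have [K cK Ke] := @c0_vanish f e e0.
by exists K => // s /Ke; rewrite normcJ.
Qed.

Definition c0_mul f g := C0 (c0_mul_subproof f g).
Definition c0_star f := C0 (c0_star_subproof f).

Lemma c0_mulA : associative c0_mul.
Proof. by move=> f g h; apply: c0_eq => s /=; rewrite mulrA. Qed.

Lemma c0_mulDl : left_distributive c0_mul +%R.
Proof. by move=> f g h; apply: c0_eq => s; rewrite /= [LHS]mulrDl. Qed.

Lemma c0_mulDr : right_distributive c0_mul +%R.
Proof. by move=> f g h; apply: c0_eq => s; rewrite /= [LHS]mulrDr. Qed.

Lemma c0_mulZl (k : C) f g : c0_mul (k *: f) g = k *: c0_mul f g.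
Proof. by apply: c0_eq => s; rewrite /= -[LHS]mulrA. Qed.

Lemma c0_mulZr (k : C) f g : c0_mul f (k *: g) = k *: c0_mul f g.
Proof. by apply: c0_eq => s; rewrite /= [LHS]mulrCA. Qed.

Lemma c0_starK : involutive c0_star.
Proof. by move=> f; apply: c0_eq => s; rewrite /= conjcK. Qed.

Lemma c0_starD f g : c0_star (f + g) = c0_star f + c0_star g.
Proof. by apply: c0_eq => s; rewrite /= [LHS]rmorphD. Qed.

Lemma c0_starZ (k : C) f : c0_star (k *: f) = k^* *: c0_star f.
Proof. by apply: c0_eq => s; rewrite /= [LHS]rmorphM. Qed.

Lemma c0_starM f g : c0_star (c0_mul f g) = c0_mul (c0_star g) (c0_star f).
Proof. by apply: c0_eq => s; rewrite /= [LHS]rmorphM mulrC. Qed.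

HB.instance Definition _ := isStarAlgebra.Build R c0 c0_mulA c0_mulDl c0_mulDr
  c0_mulZl c0_mulZr c0_starK c0_starD c0_starZ c0_starM.

Lemma c0_norm_mul f g : `|f ** g| <= `|f| * `|g|.
Proof.
by apply: c0_norm_le => s; rewrite /= normrM ler_pM // c0_normcP.
Qed.

Lemma c0_norm_starM f : `|star f ** f| = `|f| ^+ 2.
Proof.
apply: le_anti; apply/andP; split.
  apply: c0_norm_le => s; rewrite /= normrM normcJ -expr2.
  by rewrite lerXn2r ?nnegrE ?c0_normcP.
rewrite -[leRHS]sqrtCK lerXn2r ?nnegrE ?sqrtC_ge0 //.
apply: c0_norm_le => s; rewrite -(@ler_pXn2r _ 2) ?nnegrE ?sqrtC_ge0 //.
rewrite sqrtCK; have := c0_normcP (star f ** f) s.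
by rewrite /= normrM normcJ -expr2.
Qed.

HB.instance Definition _ := isCstarAlgebra.Build R c0 c0_norm_mul c0_norm_starM.

End VanishingFunctions.

(* Definite description; d is only a default. It is applied below to
   properties satisfied by exactly one object. *)
Definition the (T : Type) (d : T) (P : T -> Prop) : T :=
  if pselect (exists x, P x) is left e then projT1 (cid e) else d.

Definition lin_span (R : realType) (V : lmodType R[i]) (S : set V) : set V :=
  [set v | exists s : seq (R[i] * V),
    (forall p, p \in s -> S p.2) /\ v = \sum_(p <- s) p.1 *: p.2].

Definition closed_span (R : realType) (V : normedModType R[i]) (S : set V) :
  set V := closure (lin_span S).

(* *-homomorphisms; with B replaced by mult B these are the (possibly
   degenerate) homomorphisms into M(B). *)
Definition star_hom (R : realType) (A B : starAlgType R) (f : A -> B) : Prop :=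
  [/\ linear f, forall x y, f (x ** y) = f x ** f y
    & forall x, f (star x) = star (f x)].

Definition nondegenerate (R : realType) (A B : cstarAlgType R)
    (pi : A -> mult B) : Prop :=
  closed_span [set x | exists a b, x = lmult (pi a) b] = setT.

(* The extension to M(A) of a nondegenerate homomorphism A -> M(B). *)
Definition mext (R : realType) (A B : cstarAlgType R) (phi : A -> mult B)
    (m : mult A) : mult B :=
  the 0 (fun X => forall a, X ** phi a = phi (lmult m a)).

Section Hilbert.
Variable R : realType.
Local Notation C := R[i].

Record hilbert := Hilbert {
  hilbert_sort :> completeNormedModType C ;
  inner : hilbert_sort -> hilbert_sort -> C ;
  innerDl : forall x y z, inner (x + y) z = inner x z + inner y z ;
  innerZl : forall k x y, inner (k *: x) y = k * inner x y ;
  innerC : forall x y, inner y x = (inner x y)^* ;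
  inner_norm : forall x, inner x x = `|x| ^+ 2 }.

Definition representation (A : cstarAlgType R) (H : hilbert) (pi : A -> H -> H) :
    Prop :=
  [/\ forall a, linear (pi a) /\ continuous (pi a),
      forall k a b h, pi (k *: a + b) h = k *: pi a h + pi b h,
      forall a b h, pi (a ** b) h = pi a (pi b h)
    & forall a h k, inner (pi a h) k = inner h (pi (star a) k)].

Definition faithful_rep (A : cstarAlgType R) (H : hilbert) (pi : A -> H -> H) :
    Prop := representation pi /\ injective pi.

(* Bilinearity of t follows from the formula for inner products. *)
Definition is_hilbert_tensor (H K L : hilbert) (t : H -> K -> L) : Prop :=
  (forall h h' k k', inner (t h k) (t h' k') = inner h h' * inner k k') /\
  closed_span [set x | exists h k, x = t h k] = setT.

(* The minimal (spatial) tensor product: the C*-algebra generated by the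
   operators pi a (x) sigma c on H (x) K for faithful pi and sigma, presented
   through a faithful representation rho of it. Bilinearity, multiplicativity
   and *-compatibility of tmk follow. *)
Record min_tensor (A B : cstarAlgType R) := MinTensor {
  tensor_sort :> cstarAlgType R ;
  tmk : A -> B -> tensor_sort ;
  tmk_dense : closed_span [set x | exists a b, x = tmk a b] = setT ;
  tmk_spatial : exists (H K L : hilbert) (t : H -> K -> L)
      (pi : A -> H -> H) (sigma : B -> K -> K) (rho : tensor_sort -> L -> L),
    [/\ is_hilbert_tensor t, faithful_rep pi, faithful_rep sigma,
        faithful_rep rho
      & forall a b h k, rho (tmk a b) (t h k) = t (pi a h) (sigma b k)] }.

End Hilbert.

Section GroupAlgebra.
Variables (R : realType) (G : topGroupType).

(* Strictly continuous homomorphisms of G into the unitary group of M(B). *)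
Definition unitary_hom (B : cstarAlgType R) (v : G -> mult B) : Prop :=
  [/\ forall s t, v (s * t)%g = v s ** v t,
      forall s, star (v s) ** v s = mult1 B /\ v s ** star (v s) = mult1 B
    & forall b, continuous (fun s => lmult (v s) b : B) /\
                continuous (fun s => rmult (v s) b : B)].

(* The full group C*-algebra with its canonical map, by its universal
   property. *)
Record group_cstar := GroupCstar {
  gc_sort :> cstarAlgType R ;
  gc_unit : G -> mult gc_sort ;
  gc_unitary : unitary_hom gc_unit ;
  gc_univ : forall (B : cstarAlgType R) (v : G -> mult B), unitary_hom v ->
    exists! phi : gc_sort -> mult B,
      [/\ star_hom phi, nondegenerate phi & forall s, mext phi (gc_unit s) = v s] }.

End GroupAlgebra.

Section Coactions.
Variables (R : realType) (tens : forall A B : cstarAlgType R, min_tensor A B).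
Local Notation "A (x) B" := (tensor_sort (tens A B)) (at level 40).

(* m (x) n in M(A (x) B) *)
Definition mtens (A B : cstarAlgType R) (m : mult A) (n : mult B) :
    mult (A (x) B) :=
  the 0 (fun X => forall a b,
    lmult X (tmk (tens A B) a b) = tmk (tens A B) (lmult m a) (lmult n b) /\
    rmult X (tmk (tens A B) a b) = tmk (tens A B) (rmult m a) (rmult n b)).

(* pi (x) rho : A (x) B -> M(D (x) E) *)
Definition htens (A B D E : cstarAlgType R) (pi : A -> mult D)
    (rho : B -> mult E) : A (x) B -> mult (D (x) E) :=
  the (fun=> 0) (fun Phi => star_hom Phi /\
    forall a b, Phi (tmk (tens A B) a b) = mtens (pi a) (rho b)).

(* The identification A (x) (B (x) D) = (A (x) B) (x) D. *)
Definition tassoc (A B D : cstarAlgType R) : A (x) (B (x) D) -> (A (x) B) (x) D :=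
  the (fun=> 0) (fun Phi => star_hom Phi /\ forall a b d,
    Phi (tmk (tens A _) a (tmk (tens B D) b d)) =
    tmk (tens _ D) (tmk (tens A B) a b) d).

Variables (G : topGroupType) (CG : group_cstar R G).

(* delta_G, with delta_G(s) = s (x) s *)
Definition comult : CG -> mult (CG (x) CG) :=
  the (fun=> 0) (fun D => [/\ star_hom D, nondegenerate D
    & forall s, mext D (gc_unit CG s) = mtens (gc_unit CG s) (gc_unit CG s)]).

Definition one_tens (A : cstarAlgType R) (c : CG) : mult (A (x) CG) :=
  mtens (mult1 A) (to_mult c).

Definition mtilde (A : cstarAlgType R) : set (mult (A (x) CG)) :=
  [set m | forall c, (exists x, to_mult x = m ** one_tens A c) /\
                     (exists x, to_mult x = one_tens A c ** m)].

(* The map on mtilde A induced by pi (x) id, for possibly degenerate pi. *)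
Definition htens_bar (A B : cstarAlgType R) (pi : A -> mult B)
    (m : mult (A (x) CG)) : mult (B (x) CG) :=
  the 0 (fun X => forall c x, to_mult x = m ** one_tens A c ->
    X ** one_tens B c = htens pi (@to_mult R CG) x).

Record coaction (A : cstarAlgType R) (delta : A -> mult (A (x) CG)) : Prop :=
  Coaction {
  coact_hom : star_hom delta ;
  coact_inj : injective delta ;
  coact_nondeg : nondegenerate delta ;
  coact_mtilde : forall a, mtilde (delta a) ;
  coact_coassoc : forall a,
    mext (htens delta (@to_mult R CG)) (delta a) =
    mext (fun x => to_mult (tassoc x))
      (mext (htens (@to_mult R A) comult) (delta a)) ;
  coact_span : closed_span [set x | exists a c,
    to_mult x = delta a ** one_tens A c] = setT }.

(* ev_s (x) id : C_0(G) (x) C*(G) -> C*(G) *)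
Definition ev_tens (s : G) : c0 R G (x) CG -> CG :=
  the (fun=> 0) (fun E => star_hom E /\
    forall f c, E (tmk (tens (c0 R G) CG) f c) = f s *: c).

(* The multiplier s |-> s of C_0(G) (x) C*(G), evaluated pointwise through
   ev_tens. *)
Definition wG : mult (c0 R G (x) CG) :=
  the 0 (fun w => forall s x,
    ev_tens s (lmult w x) = lmult (gc_unit CG s) (ev_tens s x)).

Section Covariant.
Variables (A : cstarAlgType R) (delta : A -> mult (A (x) CG)).

Record degenerate_covariant (B : cstarAlgType R) (pi : A -> mult B)
    (mu : c0 R G -> mult B) : Prop := DegenerateCovariant {
  cov_pi_hom : star_hom pi ;
  cov_mu_hom : star_hom mu ;
  cov_mu_nondeg : nondegenerate mu ;
  cov_eq : forall a, let W := mext (htens mu (@to_mult R CG)) wG in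
    htens_bar pi (delta a) = W ** mtens (pi a) (mult1 CG) ** star W }.

Definition nondegenerate_covariant (B : cstarAlgType R) (pi : A -> mult B)
    (mu : c0 R G -> mult B) : Prop :=
  degenerate_covariant pi mu /\ nondegenerate pi.

(* h (jA a jG f) = pi a mu f, where jA a jG f is a multiplier lying in P *)
Definition integrates (P B : cstarAlgType R) (jA : A -> mult P)
    (jG : c0 R G -> mult P) (pi : A -> mult B) (mu : c0 R G -> mult B)
    (h : P -> mult B) : Prop :=
  star_hom h /\
  forall a f x, to_mult x = jA a ** jG f -> h x = pi a ** mu f.

Record crossed_product (P : cstarAlgType R) (jA : A -> mult P)
    (jG : c0 R G -> mult P) : Prop := CrossedProduct {
  cp_cov : nondegenerate_covariant jA jG ;
  cp_mem : forall a f, exists x, to_mult x = jA a ** jG f ;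
  cp_span : closed_span [set x | exists a f, to_mult x = jA a ** jG f] = setT ;
  cp_univ : forall (B : cstarAlgType R) (pi : A -> mult B)
      (mu : c0 R G -> mult B), nondegenerate_covariant pi mu ->
    exists! h : P -> mult B, integrates jA jG pi mu h }.

End Covariant.
End Coactions.

(* Main.v *)
Require Import Defs.
From HB Require Import structures.
From mathcomp Require Import all_boot all_order all_algebra.
From mathcomp Require Import complex.
From mathcomp Require Import all_classical all_reals all_analysis.
From mathcomp Require Import ring lra.
Set Implicit Arguments. Unset Strict Implicit. Unset Printing Implicit Defensive.
Import Order.TTheory GRing.Theory Num.Theory.
Import numFieldNormedType.Exports.
Local Open Scope classical_set_scope.
Local Open Scope ring_scope.
Local Open Scope complex_scope.
(* [nondegenerate] also names a notion of [sesquilinear] that would shadow ours. *)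
Import Defs.

(* Let J be the closed span of pi(A)B, a right ideal of B, and let D be the
   hereditary subalgebra of the b with b and b^* in J. On D the homomorphism pi
   is nondegenerate, so that the usual universal property yields P -> M(D)
   as soon as mu(C_0(G)) J is contained in J. By covariance,
   (1 (x) c') W (pi(a)b (x) c) lies in the closed span of J (x) C*(G), where
   W = (mu (x) id)(w_G); slicing it with functionals of C*(G) shows that mu(f) J is
   contained in J for the coefficient functions f of C*(G). These are dense in
   C_0(G): the regular representation, built from a Haar functional obtained
   by Weil's covering argument, has convolutions with approximate units among its
   coefficients. Finally z z^* is in D for z in J, hence
   |y b| <= |x| |b| for all b in B whenever x and y are corresponding linear
   combinations of the j_A(a) j_G(f) and of the pi(a) mu(f), and P -> M(D)
   extends to P -> M(B). *)

(** * Linear identities in modules *)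

(** Three obstacles shape the development. The group algebra is known only through its universal
    property, so functionals on it must be produced from actual unitary representations. Such a
    representation on a Hilbert space is strongly continuous but need not be strictly continuous
    into the multipliers of all bounded operators; the target is therefore cut down to the operators
    on which it acts norm continuously. The objects [mtens], [htens], [htens_bar], [mext], [ev_tens]
    and [wG] are descriptions with default values, so each of them has to be constructed, usually by
    a norm estimate on finite sums. Most of these estimates reduce to one inequality for positive
    functionals, [positive_functional_bound]. Faithful representations are taken from the spatial
    data of [min_tensor], and injectivity is turned into isometry without spectral theory. Finally,
    a homomorphism into [M(D)] does not by itself act on [B]: neither [D] nor [J] need generate [B].
    Information leaves [D] only through products [z (star z')] with [z], [z'] in [J]. *)

Section ModuleExpressions.
Variables (S : pzRingType) (V : lmodType S).

Inductive mexp :=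
  | MVar of nat | MZero | MAdd of mexp & mexp | MOpp of mexp | MScale of S & mexp.

Fixpoint meval (env : seq V) (e : mexp) : V :=
  match e with
  | MVar n => nth 0 env n
  | MZero => 0
  | MAdd a b => meval env a + meval env b
  | MOpp a => - meval env a
  | MScale k a => k *: meval env a
  end.

Fixpoint mcoef (e : mexp) (i : nat) : S :=
  match e with
  | MVar n => if n == i then 1 else 0
  | MZero => 0
  | MAdd a b => mcoef a i + mcoef b i
  | MOpp a => - mcoef a i
  | MScale k a => k * mcoef a i
  end.

Lemma mevalE env e : meval env e = \sum_(i < size env) mcoef e i *: env`_i.
Proof.
elim: e => [n||a iha b ihb|a iha|k a iha] /=; rewrite ?iha ?ihb.
- have [nenv|nenv] := ltnP n (size env); last first.
    rewrite nth_default // big1 // => i _; case: eqP => [ni|]; last by rewrite scale0r.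
    by move: (ltn_ord i); rewrite -ni ltnNge nenv.
  rewrite (bigD1 (Ordinal nenv)) //= eqxx scale1r big1 ?addr0 // => i.
  by rewrite -val_eqE /= eq_sym => /negbTE ->; rewrite scale0r.
- by rewrite big1 // => i _; rewrite scale0r.
- by rewrite -big_split; apply: eq_bigr => i _; rewrite scalerDl.
- by rewrite -sumrN; apply: eq_bigr => i _; rewrite scaleNr.
- by rewrite scaler_sumr; apply: eq_bigr => i _; rewrite scalerA.
Qed.

(** Taking [foldr] over [iota] makes the hypothesis compute to a finite conjunction of scalar
    identities, which [ring] settles one by one. *)
Lemma meval_eq env a b :
  foldr (fun i P => mcoef a i = mcoef b i /\ P) True (iota 0 (size env)) ->
  meval env a = meval env b.
Proof.
move=> h; rewrite !mevalE; apply: eq_bigr => i _; congr (_ *: _).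
have : (i : nat) \in iota 0 (size env) by rewrite mem_iota /=.
elim: (iota _ _) h => //= j s ih [jE sE]; rewrite inE => /orP[/eqP -> //|].
exact: ih.
Qed.

End ModuleExpressions.

(* Atoms are compared up to conversion, since the same operation may be
   reached through different paths of the hierarchy of structures. *)
Ltac mod_same x y :=
  match constr:(tt) with
  | _ => let _ := match goal with _ => constr_eq x y end in constr:(true)
  | _ => let _ := match goal with _ => unify x y end in constr:(true)
  | _ => constr:(false)
  end.
Ltac mod_index x env :=
  lazymatch env with
  | ?y :: ?env' =>
    let b := mod_same x y in
    lazymatch b with
    | true => constr:(0%N)
    | false => let n := mod_index x env' in constr:(n.+1)
    end
  end.
Ltac mod_mem x env :=
  lazymatch env with
  | ?y :: ?env' =>
    let b := mod_same x y in
    lazymatch b with true => constr:(true) | false => mod_mem x env' end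
  | _ => constr:(false)
  end.
Ltac mod_env env t :=
  lazymatch t with
  | 0 => env
  | ?a + ?b => let env' := mod_env env a in mod_env env' b
  | - ?a => mod_env env a
  | _ *: ?a => mod_env env a
  | _ => let b := mod_mem t env in
         lazymatch b with true => env | false => constr:(t :: env) end
  end.
Ltac mod_quote S env t :=
  lazymatch t with
  | 0 => constr:(@MZero S)
  | ?a + ?b => let x := mod_quote S env a in let y := mod_quote S env b in constr:(@MAdd S x y)
  | - ?a => let x := mod_quote S env a in constr:(@MOpp S x)
  | ?k *: ?a => let x := mod_quote S env a in constr:(@MScale S k x)
  | _ => let n := mod_index t env in constr:(@MVar S n)
  end.
(* Decides linear identities in an S-module by comparing coefficients. *)
Ltac lmod_over S :=
  lazymatch goal with
  | |- @eq ?V ?a ?b =>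
    let env0 := constr:(@nil V) in
    let env1 := mod_env env0 a in
    let env := mod_env env1 b in
    let x := mod_quote S env a in
    let y := mod_quote S env b in
    change (meval env x = meval env y);
    apply: meval_eq; rewrite /=; repeat split; try ring
  end.
Ltac lmod := lazymatch goal with R : realType |- _ => lmod_over constr:((R[i])%C : pzRingType) end.

(** * Dense generating families and bounded linear maps *)

Section Approximation.
Variable R : realType.
Local Notation K := R[i].

Lemma exists_invS_lt (e : K) : 0 < e -> exists N : nat, forall n, (N <= n)%N -> n.+1%:R^-1 < e.
Proof.
move=> e0; have [eE r0] := gt0_realc e0.
exists (Num.truncn (complex.Re e)^-1) => n Nn; rewrite eE.
have -> : (n.+1%:R^-1 : K) = ((n.+1%:R^-1 : R)%:C)%C by rewrite fmorphV /= rmorph_nat.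
rewrite ltcR -[ltRHS]invrK ltf_pV2 ?posrE ?invr_gt0 ?ltr0n//.
by apply: (lt_le_trans (truncnS_gt _)); rewrite ler_nat ltnS.
Qed.

Lemma cauchy_seq_lim (V : completeNormedModType K) (u : nat -> V) :
  (forall e : K, 0 < e -> exists N, forall m n, (N <= m)%N -> (N <= n)%N -> `|u m - u n| < e) ->
  exists l, forall e : K, 0 < e -> exists N, forall n, (N <= n)%N -> `|l - u n| < e.
Proof.
move=> uc.
have cu : cauchy (u @ \oo).
  apply/cauchyP => e e0; have [N uN] := uc e e0; exists (u N).
  by exists N => // n /= Nn; rewrite -ball_normE /=; apply: uN.
move/cauchy_cvg : cu => /cvg_ex[l ul].
exists l => e e0; move/cvgrPdist_lt : ul => /(_ e e0)[N _ h].
by exists N => n Nn; apply: h.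
Qed.

(** Formal combinations are kept as lists so that one list can be evaluated in two spaces; maps
    prescribed on generators are compared in this way. *)
Definition comb (V : lmodType K) (I : Type) (g : I -> V) (l : seq (K * I)) : V :=
  \sum_(p <- l) p.1 *: g p.2.

Lemma comb_cat (V : lmodType K) (I : Type) (g : I -> V) l1 l2 :
  comb g (l1 ++ l2) = comb g l1 + comb g l2.
Proof. by rewrite /comb big_cat. Qed.

Lemma comb_scale (V : lmodType K) (I : Type) (g : I -> V) (k : K) l :
  comb g [seq (k * p.1, p.2) | p <- l] = k *: comb g l.
Proof. by rewrite /comb big_map scaler_sumr; apply: eq_bigr => p _; rewrite scalerA. Qed.

Lemma comb1 (V : lmodType K) (I : Type) (g : I -> V) (i : I) : comb g [:: (1, i)] = g i.
Proof. by rewrite /comb big_seq1 scale1r. Qed.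

Lemma closureP (V : normedModType K) (S : set V) x :
  closure S x <-> forall e : K, 0 < e -> exists2 y, S y & `|x - y| < e.
Proof.
split=> [Sx e e0|h].
  have [y [Sy]] := Sx _ (nbhsx_ballx x e e0).
  by rewrite -ball_normE => xy; exists y.
move=> B /nbhs_ballP[e /= e0 eB]; have [y Sy xy] := h e e0.
by exists y; split=> //; apply: eB; rewrite -ball_normE.
Qed.

Lemma lin_span_comb (V : normedModType K) (I : Type) (g : I -> V) (S : set V) :
  (forall x, S x -> exists i, x = g i) -> forall y, lin_span S y -> exists l, y = comb g l.
Proof.
move=> Sg y [s [sS ->]]; elim: s sS => [|p s ih] sS.
  by exists [::]; rewrite /comb !big_nil.
have [i pi] := Sg _ (sS p (mem_head _ _)).
have [|l El] := ih; first by move=> q qs; apply: sS; rewrite inE qs orbT.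
by exists ((p.1, i) :: l); rewrite /comb !big_cons El -pi.
Qed.

Lemma closed_span_comb (V : normedModType K) (I : Type) (g : I -> V) (S : set V) :
  (forall x, S x -> exists i, x = g i) -> closed_span S = setT ->
  forall x (e : K), 0 < e -> exists l, `|x - comb g l| < e.
Proof.
move=> Sg ST x e e0; have : closed_span S x by rewrite ST.
move/closureP => /(_ e e0)[y /(lin_span_comb Sg)[l ->]]; by exists l.
Qed.

Definition blin (V W : normedModType K) (f : V -> W) :=
  linear f /\ exists2 M : K, 0 <= M & forall x, `|f x| <= M * `|x|.

(** The generators may satisfy linear relations: the bound forces [comb f l] to be determined by
    [comb g l]. The extension is obtained from the closure [Q] of the relation between [comb g l]
    and [comb f l]. *)
Lemma blin_ext (V : normedModType K) (W : completeNormedModType K) (I : Type)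
    (g : I -> V) (f : I -> W) (M : K) :
  (forall x (e : K), 0 < e -> exists l, `|x - comb g l| < e) -> 0 <= M ->
  (forall l, `|comb f l| <= M * `|comb g l|) ->
  exists Phi : V -> W, [/\ linear Phi, forall i, Phi (g i) = f i
    & forall x, `|Phi x| <= M * `|x|].
Proof.
move=> gd M0 fM.
have fB l1 l2 : `|comb f l1 - comb f l2| <= M * `|comb g l1 - comb g l2|.
  by have := fM (l1 ++ [seq (-1 * p.1, p.2) | p <- l2]);
     rewrite !comb_cat !comb_scale !scaleN1r.
pose Q x y := forall e : K, 0 < e -> exists l, `|x - comb g l| < e /\ `|y - comb f l| < e.
have exQ x : exists y, Q x y.
  have /choice[l xl] : forall n : nat, exists l, `|x - comb g l| < n.+1%:R^-1.
    by move=> n; apply: gd; rewrite invr_gt0 ltr0n.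
  have M1 : 0 < M + 1 by rewrite ltr_wpDl.
  have [|y uy] := @cauchy_seq_lim W (fun n => comb f (l n)).
    move=> e e0; have [|N hN] := @exists_invS_lt (e / (M + 1) / 2); first by rewrite !divr_gt0.
    exists N => m n Nm Nn; apply: le_lt_trans (fB _ _) _.
    have : `|comb g (l m) - comb g (l n)| < e / (M + 1).
      rewrite -(subrKA x) (splitr (_ / (M + 1))); apply: le_lt_trans (ler_normD _ _) _.
      by rewrite ltrD // ?[`|_ - x|]distrC; apply: lt_trans (xl _) (hN _ _).
    rewrite ltr_pdivlMr // => h; apply: le_lt_trans h.
    by rewrite mulrC ler_wpM2l // lerDl.
  exists y => e e0; have [N1 h1] := exists_invS_lt e0; have [N2 h2] := uy e e0.
  exists (l (maxn N1 N2)); split.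
    by apply: lt_trans (xl _) (h1 _ (leq_maxl _ _)).
  by apply: h2; apply: leq_maxr.
(* Single-valuedness and linearity of [Q] at once. The three approximations within [e / D]
   contribute [1], [M * (|k| + 2)] and [|k| + 1] times [e / D]; these coefficients add up to [D]. *)
have QM x1 y1 x2 y2 (k : K) : Q x1 y1 -> Q x2 y2 -> forall z, Q (k *: x1 + x2) z -> z = k *: y1 + y2.
  move=> q1 q2 z q3; apply/eqP; rewrite -subr_eq0 -normr_le0.
  apply/ler_addgt0Pr => e e0; rewrite add0r.
  pose D : K := (M + 1) * (2 + `|k|).
  have D0 : 0 < D by apply: mulr_gt0; [exact: ltr_wpDl|exact: ltr_wpDr].
  have d0 : 0 < e / D by rewrite divr_gt0.
  have [l1 [a1 b1]] := q1 _ d0; have [l2 [a2 b2]] := q2 _ d0; have [l3 [a3 b3]] := q3 _ d0.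
  have lin_near (U : normedModType K) (u1 u2 v1 v2 : U) : `|u1 - v1| < e / D ->
      `|u2 - v2| < e / D -> `|(k *: u1 + u2) - (k *: v1 + v2)| <= (`|k| + 1) * (e / D).
    move=> uv1 uv2; have -> : (k *: u1 + u2) - (k *: v1 + v2) = k *: (u1 - v1) + (u2 - v2) by lmod.
    apply: le_trans (ler_normD _ _) _; rewrite normrZ mulrDl mul1r lerD ?(ltW uv2) //.
    by rewrite ler_wpM2l // ltW.
  have fB' : `|comb f l3 - (k *: comb f l1 + comb f l2)| <= M * ((`|k| + 2) * (e / D)).
    have := fB l3 ([seq (k * p.1, p.2) | p <- l1] ++ l2).
    rewrite !comb_cat !comb_scale => h; apply: le_trans h _; rewrite ler_wpM2l //.
    rewrite -(subrKA (k *: x1 + x2)); apply: le_trans (ler_normD _ _) _.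
    have -> : (`|k| + 2) * (e / D) = e / D + (`|k| + 1) * (e / D) by ring.
    by rewrite lerD ?lin_near // distrC ltW.
  rewrite -(subrKA (comb f l3)) -[comb f l3 - _](subrKA (k *: comb f l1 + comb f l2)).
  apply: le_trans (ler_normD _ _) _; apply: (le_trans (lerD (lexx _) (ler_normD _ _))).
  have -> : e = e / D + (M * ((`|k| + 2) * (e / D)) + (`|k| + 1) * (e / D)).
    have eD : e = D * (e / D) by rewrite mulrC divfK ?gt_eqF.
    by rewrite {1}eD; move: (e / D) => d; rewrite /D; ring.
  rewrite lerD // ?(ltW b3) // lerD // distrC; exact: lin_near.
have Q0 : Q 0 0 by move=> e e0; exists [::]; rewrite /comb !big_nil !subr0 !normr0.
have /choice[Phi QPhi] := exQ.
exists Phi; split.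
- by move=> k x y; apply: (QM _ _ _ _ _ (QPhi x) (QPhi y)); exact: QPhi.
- move=> i; have Qi : Q (g i) (f i).
    by move=> e e0; exists [:: (1, i)]; rewrite !comb1 !subrr !normr0.
  by have := QM _ _ _ _ 1 Qi Q0 (Phi (g i)); rewrite scale1r !addr0 scale1r; apply; exact: QPhi.
- move=> x; apply/ler_addgt0Pr => e e0.
  have M1 : 0 < M + 1 by rewrite ltr_wpDl.
  have d0 : 0 < e / (M + 1) by rewrite divr_gt0.
  have [l [gl fl]] := QPhi x _ d0.
  rewrite -(subrK (comb f l) (Phi x)); apply: le_trans (ler_normD _ _) _.
  have -> : M * `|x| + e = e / (M + 1) + M * (`|x| + e / (M + 1)) by field; rewrite gt_eqF.
  rewrite lerD // ?(ltW fl) //; apply: le_trans (fM _) _; rewrite ler_wpM2l //.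
  rewrite -(subrK x (comb g l)) addrC; apply: le_trans (ler_normD _ _) _.
  by rewrite lerD // distrC ltW.
Qed.

Section LinearFunctions.
Variables (U V : lmodType K) (f : U -> V).
Hypothesis lf : linear f.

Lemma lin0 : f 0 = 0.
Proof. by have := lf (-1) 0 0; rewrite scaler0 addr0 scaleN1r addNr. Qed.

Lemma linD x y : f (x + y) = f x + f y.
Proof. by have := lf 1 x y; rewrite !scale1r. Qed.

Lemma linZ k x : f (k *: x) = k *: f x.
Proof. by have := lf k x 0; rewrite !addr0 lin0 addr0. Qed.

Lemma linN x : f (- x) = - f x.
Proof. by rewrite -scaleN1r linZ scaleN1r. Qed.

Lemma linB x y : f (x - y) = f x - f y.
Proof. by rewrite linD linN. Qed.

Lemma lin_sum (J : Type) (s : seq J) (g : J -> U) :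
  f (\sum_(i <- s) g i) = \sum_(i <- s) f (g i).
Proof. by elim: s => [|i s ih]; rewrite ?big_nil ?lin0 // !big_cons linD ih. Qed.

Lemma lin_comb (I : Type) (g : I -> U) l : f (comb g l) = comb (f \o g) l.
Proof. by rewrite /comb lin_sum; apply: eq_bigr => p _; rewrite linZ. Qed.

End LinearFunctions.

(** Density arguments run as inductions: a property that cuts out a closed subspace has only to be
    checked on generators, by [dense_ind] or [gen_ind]. *)
Definition csubm (V : normedModType K) (P : set V) :=
  [/\ P 0, forall k x y, P x -> P y -> P (k *: x + y)
    & forall x, (forall e : K, 0 < e -> exists2 y, P y & `|x - y| < e) -> P x].

Lemma csubm_min (V : normedModType K) (S P : set V) :
  csubm P -> S `<=` P -> closed_span S `<=` P.
Proof.
move=> [P0 PD Pc] SP x /closureP Sx; apply: Pc => e e0.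
have [y [s [sS ->]] xy] := Sx e e0; exists (\sum_(p <- s) p.1 *: p.2) => //.
elim: s sS {xy} => [|p s ih] sS; first by rewrite big_nil.
rewrite big_cons; apply: PD; first by apply/SP/sS; rewrite mem_head.
by apply: ih => q qs; apply: sS; rewrite inE qs orbT.
Qed.

Lemma dense_ind (V : normedModType K) (S P : set V) :
  closed_span S = setT -> csubm P -> S `<=` P -> forall x, P x.
Proof. by move=> ST cP SP x; apply: (csubm_min cP SP); rewrite ST. Qed.

Lemma closed_span_incl (V : normedModType K) (S : set V) : S `<=` closed_span S.
Proof.
move=> x Sx; apply: subset_closure; exists [:: (1, x)].
by split=> [p|]; rewrite ?inE ?big_seq1 ?scale1r // => /eqP ->.
Qed.

Lemma csubm_closed_span (V : normedModType K) (S : set V) : csubm (closed_span S).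
Proof.
have S0 : lin_span S 0 by exists [::]; rewrite big_nil.
split; first exact: subset_closure.
- move=> k x y /closureP Sx /closureP Sy; apply/closureP => e e0.
  have e2 : 0 < e / 2 by rewrite divr_gt0.
  have k0 : 0 < `|k| + 1 by rewrite ltr_wpDl.
  have [|x' [s [sS xs]] xx'] := Sx (e / 2 / (`|k| + 1)); first by rewrite divr_gt0.
  have [y' [s' [sS' ys]] yy'] := Sy _ e2.
  exists (k *: x' + y').
    exists ([seq (k * p.1, p.2) | p <- s] ++ s'); split.
      by move=> p; rewrite mem_cat => /orP[/mapP[q qs ->]|]; [exact: (sS q)|exact: sS'].
    rewrite big_cat big_map xs ys scaler_sumr; congr (_ + _).
    by apply: eq_bigr => p _; rewrite scalerA.
  have -> : k *: x + y - (k *: x' + y') = k *: (x - x') + (y - y') by lmod.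
  apply: le_lt_trans (ler_normD _ _) _; rewrite (splitr e) ltrD // normrZ.
  move: xx'; rewrite ltr_pdivlMr // => h; apply: le_lt_trans h.
  by rewrite mulrC ler_wpM2l // lerDl.
- move=> x h; apply/closureP => e e0; have e2 : 0 < e / 2 by rewrite divr_gt0.
  have [y /closureP Sy xy] := h _ e2; have [z Sz yz] := Sy _ e2.
  exists z => //; rewrite -(subrKA y) (splitr e).
  by apply: le_lt_trans (ler_normD _ _) _; rewrite ltrD.
Qed.

Lemma gen_ind (V : normedModType K) (I : Type) (g : I -> V) (P : set V) :
  (forall x (e : K), 0 < e -> exists l, `|x - comb g l| < e) ->
  csubm P -> (forall i, P (g i)) -> forall x, P x.
Proof.
move=> gd [P0 PD Pc] Pg x; apply: Pc => e e0; have [l xl] := gd x e e0.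
exists (comb g l) => //; elim: l {xl} => [|p l ih]; first by rewrite /comb big_nil.
by rewrite /comb big_cons; apply: PD.
Qed.

Section BoundedLinear.
Implicit Types U V W : normedModType K.

Lemma blin_lin V W (f : V -> W) : blin f -> linear f. Proof. by case. Qed.

Lemma blin_id V : blin (@id V).
Proof. by split=> //; exists 1 => // x; rewrite mul1r. Qed.

Lemma blin_comp U V W (f : V -> W) (g : U -> V) : blin f -> blin g -> blin (fun x => f (g x)).
Proof.
move=> [lf [M M0 fM]] [lg [N N0 gN]]; split=> [k x y|]; first by rewrite lg lf.
exists (M * N) => [|x]; first exact: mulr_ge0.
by rewrite -mulrA; apply: le_trans (fM _) _; rewrite ler_wpM2l.
Qed.

Lemma blin_combo V W (k : K) (f g : V -> W) : blin f -> blin g -> blin (fun x => k *: f x + g x).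
Proof.
move=> [lf [M M0 fM]] [lg [N N0 gN]]; split=> [a x y|]; first by rewrite lf lg; lmod.
exists (`|k| * M + N) => [|x]; first by rewrite addr_ge0 ?mulr_ge0.
rewrite mulrDl; apply: le_trans (ler_normD _ _) _; rewrite lerD // normrZ -mulrA.
by rewrite ler_wpM2l.
Qed.

Lemma blinD V W (f g : V -> W) : blin f -> blin g -> blin (fun x => f x + g x).
Proof.
move=> bf bg; have := blin_combo 1 bf bg.
by congr blin; apply/funext => x; rewrite scale1r.
Qed.

Lemma blin0 V W : blin (fun _ : V => 0 : W).
Proof.
split=> [k x y|]; first by rewrite scaler0 addr0.
by exists 0 => // x; rewrite normr0 mul0r.
Qed.

Lemma blinZ V W (k : K) (f : V -> W) : blin f -> blin (fun x => k *: f x).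
Proof.
move=> bf; have := blin_combo k bf (blin0 V W).
by congr blin; apply/funext => x; rewrite addr0.
Qed.

Lemma blinB V W (f g : V -> W) : blin f -> blin g -> blin (fun x => f x - g x).
Proof.
move=> bf bg; have := blin_combo (-1) bg bf.
by congr blin; apply/funext => x; rewrite scaleN1r addrC.
Qed.

Lemma blin_sum V W (J : Type) (s : seq J) (f : J -> V -> W) :
  (forall i, blin (f i)) -> blin (fun x => \sum_(i <- s) f i x).
Proof.
move=> bf; elim: s => [|i s ih].
  by have := blin0 V W; congr blin; apply/funext => x; rewrite big_nil.
have := blinD (bf i) ih; by congr blin; apply/funext => x; rewrite big_cons.
Qed.

Lemma csubm_preim V W (f : V -> W) (P : set W) : blin f -> csubm P -> csubm (fun x => P (f x)).
Proof.
move=> [lf [M M0 fM]] [P0 PD Pc]; split; first by rewrite lin0.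
- by move=> k x y Px Py; rewrite lf; apply: PD.
- move=> x h; apply: Pc => e e0.
  have M1 : 0 < M + 1 by rewrite ltr_wpDl.
  have [|y Py xy] := h (e / (M + 1)); first by rewrite divr_gt0.
  exists (f y) => //; rewrite -linB //; apply: le_lt_trans (fM _) _.
  move: xy; rewrite ltr_pdivlMr // => h'; apply: le_lt_trans h'.
  by rewrite mulrC ler_wpM2l // lerDl.
Qed.

Lemma csubm_eq0 V : csubm (fun x : V => x = 0).
Proof.
split=> // [k x y -> ->|x h]; first by rewrite scaler0 addr0.
apply/eqP; rewrite -normr_le0; apply/ler_addgt0Pr => e e0; rewrite add0r.
by have [y -> ] := h e e0; rewrite subr0 => /ltW.
Qed.

Lemma csubm_eq V W (f g : V -> W) : blin f -> blin g -> csubm (fun x => f x = g x).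
Proof.
move=> bf bg; have := csubm_preim (blinB bf bg) (@csubm_eq0 W).
congr csubm; apply/funext => x; apply/propext; split=> [/eqP|->]; last by rewrite subrr.
by rewrite subr_eq0 => /eqP.
Qed.

Lemma csubm_le V (W : normedModType K) (f : V -> W) (M : K) (P : set V) :
  blin f -> (forall x, P x -> `|f x| <= M * `|x|) -> closure P = setT ->
  0 <= M -> forall x, `|f x| <= M * `|x|.
Proof.
move=> [lf [N N0 fN]] fM PT M0 x; apply/ler_addgt0Pr => e e0.
have MN : 0 < M + N + 1 by rewrite ltr_wpDl // addr_ge0.
have Px : closure P x by rewrite PT.
have [|y Py xy] := (closureP P x).1 Px (e / (M + N + 1)); first by rewrite divr_gt0.
rewrite -(subrK y x) linD //.
apply: le_trans (ler_normD _ _) _.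
apply: (@le_trans _ _ (N * (e / (M + N + 1)) + M * (`|x| + e / (M + N + 1)))).
  rewrite lerD //; first by apply: le_trans (fN _) _; rewrite ler_wpM2l // ltW.
  apply: le_trans (fM _ Py) _; rewrite ler_wpM2l // -{1}(subrK x y) addrC.
  by apply: le_trans (ler_normD _ _) _; rewrite lerD // distrC ltW.
rewrite subrK.
have -> : N * (e / (M + N + 1)) + M * (`|x| + e / (M + N + 1)) = M * `|x| + (M + N) * (e / (M + N + 1)) by ring.
rewrite lerD2l mulrA ler_pdivrMr // mulrC ler_wpM2l // ?(ltW e0) //.
by rewrite lerDl.
Qed.

End BoundedLinear.

End Approximation.

(** * C*-algebras and Hilbert space representations *)

Lemma conjc_ge0 (R : realType) (a : R[i]) : 0 <= a -> conjc a = a.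
Proof. by move=> a0; have := ger0_Im a0; case: a {a0} => u v /= ->; rewrite oppr0. Qed.

(* [starZ] is stated with the generic conjugation of closed fields. *)
Lemma conjCE (R : realType) (a : R[i]) : (a^*)%R = conjc a.
Proof. by []. Qed.

Section StarAlgebraTheory.
Variables (R : realType) (A : starAlgType R).
Implicit Types x y z : A.

Lemma samul0l x : 0 ** x = 0.
Proof. by rewrite -(scale0r 0) amulZl !scale0r. Qed.

Lemma samul0r x : x ** 0 = 0.
Proof. by rewrite -(scale0r 0) amulZr !scale0r. Qed.

Lemma samulNl x y : (- x) ** y = - (x ** y).
Proof. by rewrite -scaleN1r amulZl scaleN1r. Qed.

Lemma samulNr x y : x ** (- y) = - (x ** y).
Proof. by rewrite -scaleN1r amulZr scaleN1r. Qed.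

Lemma star0 : star (0 : A) = 0.
Proof. by apply: (addrI (star 0)); rewrite -starD !addr0. Qed.

Lemma starN x : star (- x) = - star x.
Proof. by apply/eqP; rewrite -addr_eq0 -starD addNr star0. Qed.

Lemma starB x y : star (x - y) = star x - star y.
Proof. by rewrite starD starN. Qed.

Lemma star_sum (J : Type) (s : seq J) (g : J -> A) :
  star (\sum_(i <- s) g i) = \sum_(i <- s) star (g i).
Proof. by elim: s => [|i s ih]; rewrite ?big_nil ?star0 // !big_cons starD ih. Qed.

Lemma amul_suml (J : Type) (s : seq J) (g : J -> A) x :
  (\sum_(i <- s) g i) ** x = \sum_(i <- s) g i ** x.
Proof. by elim: s => [|i s ih]; rewrite ?big_nil ?samul0l // !big_cons amulDl ih. Qed.

Lemma amul_sumr (J : Type) (s : seq J) (g : J -> A) x :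
  x ** (\sum_(i <- s) g i) = \sum_(i <- s) x ** g i.
Proof. by elim: s => [|i s ih]; rewrite ?big_nil ?samul0r // !big_cons amulDr ih. Qed.

End StarAlgebraTheory.

Ltac alg := rewrite ?(amulDl, amulDr, samulNl, samulNr, amulZl, amulZr) ?amulA; lmod.

Section CstarBasics.
Variables (R : realType) (A : cstarAlgType R).
Local Notation K := R[i].
Implicit Types x y z : A.

Lemma norm_star x : `|star x| = `|x|.
Proof.
suff le y : `|y| <= `|star y| by apply/le_anti; rewrite le !andbT -{2}(starK x) le.
have [->|y0] := eqVneq y 0; first by rewrite normr0.
have ny : 0 < `|y| by rewrite normr_gt0.
by rewrite -(ler_pM2r ny) -expr2 -norm_starM norm_amul.
Qed.

Lemma norm_star2 x : `|x ** star x| = `|x| ^+ 2.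
Proof. by rewrite -{1}(starK x) norm_starM norm_star. Qed.

Lemma norm_sa2 x : star x = x -> `|x ** x| = `|x| ^+ 2.
Proof. by move=> {1}<-; rewrite norm_starM. Qed.

Lemma blin_mull x : blin (fun y : A => x ** y).
Proof.
split=> [k y z|]; first by rewrite amulDr amulZr.
by exists `|x| => // y; exact: norm_amul.
Qed.

Lemma blin_mulr x : blin (fun y : A => y ** x).
Proof.
split=> [k y z|]; first by rewrite amulDl amulZl.
by exists `|x| => // y; rewrite mulrC; exact: norm_amul.
Qed.

(* Iterating [y |-> (x + y^2) / 2] on [1] gives a numerical sequence whose
   increments dominate those of the sequence in A. *)
Lemma sqrt_complement x : star x = x -> `|x| <= 1 ->
  exists y, [/\ star y = y, x = 2 *: y - y ** y, `|y| <= 1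
    & forall z, z ** x = x ** z -> z ** y = y ** z].
Proof.
move=> sx x1.
pose y n := iter n (fun y : A => (2^-1 : K) *: (x + y ** y)) 0.
pose t n := iter n (fun t : R => (1 + t ^+ 2) / 2) 0.
have yS n : y n.+1 = (2^-1 : K) *: (x + y n ** y n) by [].
have tS n : t n.+1 = (1 + t n ^+ 2) / 2 by [].
have y0 : y 0 = 0 by [].
have t0 : t 0 = 0 by [].
move: y t yS tS y0 t0 => y t yS tS y0 t0.
have t01 n : 0 <= t n <= 1.
  elim: n => [|n /andP[tn0 tn1]]; first by rewrite t0 lexx ler01.
  by rewrite tS; apply/andP; split; nra.
have tmon n : t n <= t n.+1.
  by rewrite tS; have := sqr_ge0 (t n - 1); nra.
have half0 : 0 <= 2^-1 :> K by rewrite invr_ge0.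
have key n : `|y n| <= (t n)%:C /\ `|y n.+1 - y n| <= (t n.+1 - t n)%:C.
  elim: n => [|n [yn dn]].
    split; first by rewrite y0 t0 normr0.
    rewrite yS y0 samul0l addr0 subr0 normrZ ger0_norm // tS t0 expr0n /= addr0 subr0.
    by rewrite rmorphM fmorphV /= rmorph_nat mul1r ler_piMr.
  have yn1 : `|y n.+1| <= (t n.+1)%:C.
    rewrite yS tS normrZ ger0_norm // rmorphM fmorphV /= rmorph_nat mulrC ler_wpM2r //.
    rewrite rmorphD rmorph1 rmorphXn; apply: le_trans (ler_normD _ _) _.
    by rewrite lerD //; apply: le_trans (norm_amul _ _) _; rewrite expr2 ler_pM.
  split=> //.
  have -> : y n.+2 - y n.+1 =
      (2^-1 : K) *: (y n.+1 ** (y n.+1 - y n) + (y n.+1 - y n) ** y n).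
    by rewrite (yS n.+1) [in X in _ - X](yS n); alg.
  have -> : (t n.+2 - t n.+1)%:C = 2^-1 * ((t n.+1)%:C * (t n.+1 - t n)%:C + (t n.+1 - t n)%:C * (t n)%:C) :> K.
    have -> : t n.+2 - t n.+1 = 2^-1 * (t n.+1 * (t n.+1 - t n) + (t n.+1 - t n) * t n).
      by rewrite (tS n.+1) {2}(tS n); field.
    by rewrite rmorphM fmorphV /= rmorph_nat rmorphD !rmorphM.
  rewrite normrZ ger0_norm // ler_wpM2l //; apply: le_trans (ler_normD _ _) _.
  rewrite lerD //; apply: le_trans (norm_amul _ _) _; exact: ler_pM.
have dist m n : (n <= m)%N -> `|y m - y n| <= (t m - t n)%:C.
  move=> /subnK <-; elim: (m - n)%N => [|k ih]; first by rewrite add0n !subrr normr0.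
  rewrite addSn -(subrKA (y (k + n)%N)) -[t _ - _](subrKA (t (k + n)%N)) rmorphD.
  by apply: le_trans (ler_normD _ _) _; rewrite lerD // (key _).2.
have tle m n : (n <= m)%N -> t n <= t m.
  by move=> /subnK <-; elim: (m - n)%N => // k ih; apply: le_trans ih (tmon _).
have tc : cvgn t.
  apply: nondecreasing_is_cvgn => [n m|]; first exact: tle.
  by exists 1 => _ [n _ <-]; have /andP[] := t01 n.
have [|l ly] := @cauchy_seq_lim R A y.
  move=> e /gt0_realc[-> e0]; move/cvgrPdist_lt : (tc) => /(_ _ e0)[N _ hN]; exists N.
  have main m n : (N <= n)%N -> (n <= m)%N -> `|y m - y n| < (complex.Re e)%:C.
    move=> Nn nm; apply: le_lt_trans (dist _ _ nm) _; rewrite ltcR.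
    apply: le_lt_trans (hN n Nn); rewrite /= ger0_norm ?lerD2r ?subr_ge0 //;
      by apply: nondecreasing_cvgn_le => // ? ? ?; apply: tle.
  move=> m n Nm Nn; have [nm|/ltnW mn] := leqP n m; first exact: main.
  by rewrite distrC; exact: main.
have lim_eq (f g : A -> A) : (exists2 M : K, 0 <= M & forall n, `|(f l - g l) - (f (y n) - g (y n))| <= M * `|l - y n|) ->
    (forall n, f (y n) = g (y n)) -> f l = g l.
  move=> [M M0 fM] fg; apply/eqP; rewrite -subr_eq0 -normr_le0.
  apply/ler_addgt0Pr => e e0; rewrite add0r.
  have M1 : 0 < M + 1 by rewrite ltr_wpDl.
  have [|N hN] := ly (e / (M + 1)); first by rewrite divr_gt0.
  have := fM N; rewrite fg subrr subr0 => h; apply: le_trans h _.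
  have := hN N (leqnn _); rewrite ltr_pdivlMr // => /ltW h; apply: le_trans h.
  by rewrite mulrC ler_wpM2l // lerDl.
have l1 : `|l| <= 1.
  apply/ler_addgt0Pr => e e0; have [N hN] := ly e e0.
  rewrite -(subrK (y N) l) addrC; apply: le_trans (ler_normD _ _) _.
  apply: lerD; last exact/ltW/hN.
  by apply: le_trans (key N).1 _; rewrite lecR; have /andP[] := t01 N.
exists l; split=> //.
- apply: (lim_eq (fun z => star z) (fun z => z)) => [|n].
    have E (u v : A) : star u - u - (star v - v) = star (u - v) - (u - v).
      by rewrite starB; lmod.
    by exists 2 => // n; rewrite E; apply: le_trans (ler_normB _ _) _; rewrite norm_star mulr_natl mulr2n.
  by elim: n => [|n ih]; rewrite ?y0 ?star0 // yS starZ starD sx starM ih fmorphV rmorph_nat.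
- apply/eqP; rewrite -subr_eq0 -normr_le0; apply/ler_addgt0Pr => e e0; rewrite add0r.
  have [|N hN] := ly (e / 4); first by rewrite divr_gt0.
  have -> : x - (2 *: l - l ** l) = 2 *: (y N.+1 - l) + (l ** (l - y N) + (l - y N) ** y N).
    have -> : x = 2 *: y N.+1 - y N ** y N by rewrite yS scalerA mulfV ?pnatr_eq0 // scale1r addrK.
    by alg.
  have -> : e = 2 * (e / 4) + (1 * (e / 4) + e / 4 * 1) by field.
  apply: le_trans (ler_normD _ _) _; rewrite lerD //.
    by rewrite normrZ normr_nat distrC ler_wpM2l // ltW // hN.
  apply: le_trans (ler_normD _ _) _; rewrite lerD //; apply: le_trans (norm_amul _ _) _;
    apply: ler_pM => //; try exact/ltW/hN.
  by apply: le_trans (key N).1 _; rewrite lecR; have /andP[] := t01 N.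
- move=> z zx; apply: (lim_eq (fun y => z ** y) (fun y => y ** z)) => [|n].
    exists (2 * `|z|) => [|n]; first by rewrite mulr_ge0.
    have -> : z ** l - l ** z - (z ** y n - y n ** z) = z ** (l - y n) - (l - y n) ** z by alg.
    apply: le_trans (ler_normB _ _) _; rewrite -mulrA mulr_natl mulr2n lerD //.
      exact: norm_amul.
    by rewrite mulrC; exact: norm_amul.
  elim: n => [|n ih]; first by rewrite y0 samul0l samul0r.
  by rewrite yS amulZr amulZl amulDr amulDl zx !amulA ih -!amulA ih.
Qed.

(* For [0 <= t <= 1], [t] is [2 y - y^2] with [y] self-adjoint and
   [F (1 - y)^2 >= 0]. *)
Lemma positive_functional_bound (F : A -> K) (N : K) :
  (forall k x y, F (k *: x + y) = k * F x + F y) ->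
  (forall z, 0 <= N - F z - F (star z) + F (star z ** z)) ->
  forall x, F (star x ** x) <= N * `|x| ^+ 2.
Proof.
move=> lF Fpos x.
have F0 : F 0 = 0 by have := lF (-1) 0 0; rewrite scaler0 addr0 mulN1r addNr.
have FZ k y : F (k *: y) = k * F y by have := lF k y 0; rewrite !addr0 F0 addr0.
have FD y z : F (y + z) = F y + F z by have := lF 1 y z; rewrite scale1r mul1r.
have [->|x0] := eqVneq x 0; first by rewrite samul0r F0 normr0 expr0n mulr0.
have nx : 0 < `|x| by rewrite normr_gt0.
pose s := `|x| ^- 2 *: (star x ** x).
have [||y [sy sE _ _]] := @sqrt_complement s.
- rewrite /s starZ starM starK; congr (_ *: _).
  by rewrite conjCE conjc_ge0 // invr_ge0 exprn_ge0.
- by rewrite /s normrZ norm_starM normfV normrX normr_id mulVf // expf_eq0 /= gt_eqF.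
have /andP[] : (0 <= N - F s) && true.
  have := Fpos y; rewrite sy => h; rewrite andbT; apply: le_trans h _.
  have -> : F s = 2 * F y - F (y ** y) by rewrite sE -scaleN1r FD !FZ mulN1r.
  by rewrite le_eqVlt; apply/orP; left; apply/eqP; ring.
rewrite subr_ge0 /s FZ => h _; rewrite -ler_pdivrMr ?exprn_gt0 //.
by rewrite mulrC.
Qed.

Lemma ge0_closed (q : K) :
  (forall e : K, 0 < e -> exists2 p, 0 <= p & `|q - p| <= e) -> 0 <= q.
Proof.
move=> h; rewrite lecE /=; apply/andP; split.
  rewrite -normr_eq0 eq_le normr_ge0 andbT; apply/ler_addgt0Pr => e e0; rewrite add0r.
  have [|p p0 qp] := h (e%:C); first by rewrite ltcR.
  rewrite -lecR; apply: le_trans qp; rewrite normcE_real lecR.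
  have := Im_le_normc (q - p); rewrite raddfB /=.
  by move: p0; rewrite lecE /= => /andP[/eqP -> _]; rewrite subr0.
apply/ler_addgt0Pr => e e0.
have [|p p0 qp] := h (e%:C); first by rewrite ltcR.
have pr : 0 <= complex.Re p by move: p0; rewrite lecE => /andP[].
have := Re_le_normc (q - p); rewrite raddfB /= => h'.
have {}qp : `|complex.Re q - complex.Re p| <= e.
  by apply: le_trans h' _; rewrite -lecR -normcE_real.
by move: qp; rewrite ler_norml => /andP[qp _]; lra.
Qed.

(** On a tensor product, positivity is visible only on finite sums of elementary tensors. The
    condition is closed in [z] because [F] is bounded, so it passes from [P] to all of [A]. *)
Lemma positive_functional_dense (F : A -> K^o) (N : K) (P : set A) :
  blin F -> (forall z (e : K), 0 < e -> exists2 y, P y & `|z - y| < e) ->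
  (forall z, P z -> 0 <= N - F z - F (star z) + F (star z ** z)) ->
  forall x, F (star x ** x) <= N * `|x| ^+ 2.
Proof.
move=> [lF [M M0 FM]] Pd FP; apply: positive_functional_bound; first exact: lF.
move=> z; apply: ge0_closed => e e0.
(* Once [|y| <= |z| + 1], the two positive expressions differ by [F] of an element of norm at most
   [(2 |z| + 3) |z - y|]. *)
pose D : K := M * (2 * `|z| + 3).
have D0 : 0 <= D by rewrite mulr_ge0 // addr_ge0 // mulr_ge0.
have De : 0 < D + e by rewrite ltr_wpDl.
have [|y Py zy] := Pd z (e / (D + e)); first by rewrite divr_gt0.
exists (N - F y - F (star y) + F (star y ** y)); first exact: FP.
have zy1 : `|z - y| <= 1.
  by apply/ltW/(lt_le_trans zy); rewrite ler_pdivrMr // mul1r lerDr.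
have y1 : `|y| <= `|z| + 1.
  rewrite -[y](subrK z) addrC; apply: le_trans (ler_normD _ _) _.
  by rewrite lerD // distrC.
have -> : N - F z - F (star z) + F (star z ** z) - (N - F y - F (star y) + F (star y ** y)) =
    F (star z ** (z - y) + star (z - y) ** y - (z - y) - star (z - y)).
  rewrite !(linB lF) (linD lF) starB (linB lF) amulDr samulNr (linB lF) amulDl samulNl (linB lF).
  by rewrite /=; ring.
apply: le_trans (FM _) _; apply: (@le_trans _ _ (D * `|z - y|)).
  rewrite /D -mulrA ler_wpM2l //.
  have -> : (2 * `|z| + 3) * `|z - y| = `|z| * `|z - y| + `|z - y| * (`|z| + 1) + `|z - y| + `|z - y|.
    by ring.
  apply: le_trans (ler_normB _ _) _; rewrite lerD ?norm_star //.
  apply: le_trans (ler_normB _ _) _; rewrite lerD //.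
  apply: le_trans (ler_normD _ _) _; rewrite lerD //; apply: le_trans (norm_amul _ _) _.
    by rewrite norm_star.
  by rewrite norm_star ler_wpM2l.
apply: (@le_trans _ _ (D * (e / (D + e)))); first by rewrite ler_wpM2l // ltW.
by rewrite mulrA ler_pdivrMr // mulrC ler_wpM2l ?(ltW e0) // lerDl ltW.
Qed.

End CstarBasics.

Section HilbertBasics.
Variables (R : realType).
Local Notation K := R[i].

Lemma semi_inner_CS (V : lmodType K) (ip : V -> V -> K) :
  (forall k x y z, ip (k *: x + y) z = k * ip x z + ip y z) ->
  (forall x y, ip y x = conjc (ip x y)) -> (forall x, 0 <= ip x x) ->
  forall x y, `|ip x y| ^+ 2 <= ip x x * ip y y.
Proof.
move=> lip ipC ip0 x y.
have conjM (a b : K) : conjc (a * b) = conjc a * conjc b by exact: rmorphM.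
have conjD (a b : K) : conjc (a + b) = conjc a + conjc b by exact: rmorphD.
have conjN (a : K) : conjc (- a) = - conjc a by exact: rmorphN.
have rip k u v w : ip w (k *: u + v) = conjc k * ip w u + ip w v.
  by rewrite ipC lip conjD conjM -!ipC.
set p := `|ip x y| ^+ 2.
have pE : p = ip x y * ip y x by rewrite /p sqr_normc (ipC x y).
have p0 : 0 <= p by rewrite exprn_ge0.
have h (t : K) : 0 <= t -> 0 <= ip x x - 2 * t * p + t ^+ 2 * p * ip y y.
  move=> t0; have := ip0 ((- (t * ip x y)) *: y + x).
  rewrite lip !rip conjN conjM (conjc_ge0 t0) -(ipC x y) => h; apply: le_trans h _.
  by rewrite le_eqVlt; apply/orP; left; apply/eqP; rewrite pE; ring.
have [y0|y0] := eqVneq (ip y y) 0; last first.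
  have yy : 0 < ip y y by rewrite lt_neqAle eq_sym y0 ip0.
  have := h (ip y y)^-1; rewrite invr_ge0 ip0 => /(_ isT) h'.
  rewrite -subr_ge0 -(pmulr_lge0 _ (_ : 0 < (ip y y)^-1)) ?invr_gt0 //.
  by apply: le_trans h' _; rewrite le_eqVlt; apply/orP; left; apply/eqP; field.
rewrite y0 mulr0; have [->//|pn0] := eqVneq p 0.
have pp : 0 < p by rewrite lt_neqAle eq_sym pn0.
(* For a null [y] the expansion is affine in [t]; at this value of [t] it equals [- (ip x x + 2)],
   which cannot be nonnegative. *)
have t0 : 0 <= (ip x x + 1) / p by apply: divr_ge0 => //; apply: addr_ge0.
move: (h _ t0).
rewrite y0 mulr0 addr0.
have -> : ip x x - 2 * ((ip x x + 1) / p) * p = - (ip x x + 2) by field.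
by rewrite oppr_ge0 => h'; have := le_lt_trans h' (_ : 0 < ip x x + 2); rewrite ltr_wpDl // ltxx => /(_ isT).
Qed.

Variable H : hilbert R.
Implicit Types x y z : H.

Lemma inner_lin k x y z : inner (k *: x + y) z = k * inner x z + inner y z.
Proof. by rewrite innerDl innerZl. Qed.

Lemma innerDr x y z : inner x (y + z) = inner x y + inner x z.
Proof. by rewrite innerC innerDl rmorphD /= -!innerC. Qed.

Lemma innerZr k x y : inner x (k *: y) = conjc k * inner x y.
Proof. by rewrite innerC innerZl rmorphM /= -innerC. Qed.

Lemma inner0l x : inner 0 x = 0.
Proof. by rewrite -(scale0r 0) innerZl mul0r. Qed.

Lemma inner0r x : inner x 0 = 0.
Proof. by rewrite innerC inner0l conjc0. Qed.

Lemma innerNl x y : inner (- x) y = - inner x y.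
Proof. by rewrite -scaleN1r innerZl mulN1r. Qed.

Lemma innerNr x y : inner x (- y) = - inner x y.
Proof. by rewrite innerC innerNl rmorphN /= -innerC. Qed.

Lemma inner_suml (J : Type) (s : seq J) (g : J -> H) x :
  inner (\sum_(i <- s) g i) x = \sum_(i <- s) inner (g i) x.
Proof. by elim: s => [|i s ih]; rewrite ?big_nil ?inner0l // !big_cons innerDl ih. Qed.

Lemma inner_sumr (J : Type) (s : seq J) (g : J -> H) x :
  inner x (\sum_(i <- s) g i) = \sum_(i <- s) inner x (g i).
Proof. by elim: s => [|i s ih]; rewrite ?big_nil ?inner0r // !big_cons innerDr ih. Qed.

Lemma inner_CS x y : `|inner x y| <= `|x| * `|y|.
Proof.
rewrite -(@ler_pXn2r _ 2) ?nnegrE ?mulr_ge0 // exprMn -!inner_norm.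
apply: semi_inner_CS => [||u]; [exact: inner_lin|exact: innerC|].
by rewrite inner_norm exprn_ge0.
Qed.

Lemma inner_ge0 x : 0 <= inner x x.
Proof. by rewrite inner_norm exprn_ge0. Qed.

Lemma inner_le_norm x (r : K) : 0 <= r -> (forall y, `|inner x y| <= r * `|y|) -> `|x| <= r.
Proof.
move=> r0 h; have [->|x0] := eqVneq x 0; first by rewrite normr0.
have nx : 0 < `|x| by rewrite normr_gt0.
by have := h x; rewrite inner_norm normrX normr_id expr2 ler_pM2r.
Qed.

Lemma inner_eq0 x : (forall y, inner x y = 0) -> x = 0.
Proof.
move=> h; apply/eqP; rewrite -normr_le0; apply: inner_le_norm => // y.
by rewrite h normr0 mul0r.
Qed.

Lemma blin_inner y : blin (fun x : H => inner x y : K^o).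
Proof.
split=> [k x z|]; first exact: inner_lin.
by exists `|y| => // x; rewrite mulrC; exact: inner_CS.
Qed.

End HilbertBasics.

(** The functional [z |-> inner (V z) v] satisfies [positive_functional_bound] with [N = |v|^2],
    since the expression required to be nonnegative is [|v - V z|^2]. So [V z] behaves like a
    represented element applied to [v] although no operator is given. Representations, homomorphisms
    into multipliers and operators on one tensor leg are all instances. *)
Lemma positive_vector_bound (R : realType) (A : cstarAlgType R) (H : hilbert R)
    (V : A -> H) (v : H) :
  linear V -> (forall x y, inner (V x) (V y) = inner (V (star y ** x)) v) ->
  (forall z, inner (V (star z)) v = inner v (V z)) ->
  forall x, `|V x| <= `|x| * `|v|.
Proof.
move=> lV VV Vs x.
rewrite -(@ler_pXn2r _ 2) ?nnegrE ?mulr_ge0 // exprMn mulrC -[leLHS]inner_norm VV.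
apply: (@positive_functional_bound R A (fun z => inner (V z) v)) => [k y z|z].
  by rewrite lV innerDl innerZl.
apply: le_trans (inner_ge0 (v - V z)) _.
rewrite innerDl !innerDr !innerNl !innerNr Vs -VV inner_norm.
by rewrite le_eqVlt; apply/orP; left; apply/eqP; ring.
Qed.

(** * Representations: contractivity, and isometry of faithful families *)

Section Representations.
Variables (R : realType) (A : cstarAlgType R).
Local Notation K := R[i].

Section OneRepresentation.
Variables (H : hilbert R) (s : A -> H -> H).
Hypothesis rs : representation s.

Lemma rep_lin a : linear (s a). Proof. by case: rs => h _ _ _; case: (h a). Qed.

Lemma rep_linl h : linear (fun a => s a h).
Proof. by case: rs => _ l _ _ k a b; rewrite l. Qed.

Lemma repM a b h : s (a ** b) h = s a (s b h). Proof. by case: rs. Qed.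

Lemma rep_adj a h k : inner (s a h) k = inner h (s (star a) k).
Proof. by case: rs. Qed.

Lemma rep_adjr a h k : inner h (s a k) = inner (s (star a) h) k.
Proof. by rewrite rep_adj starK. Qed.

Lemma rep_inner a b h k : inner (s a h) (s b k) = inner (s (star b ** a) h) k.
Proof. by rewrite rep_adjr -repM. Qed.

Lemma rep_contract a h : `|s a h| <= `|a| * `|h|.
Proof.
apply: (@positive_vector_bound R A H (fun z => s z h)) => [|x y|z]; first exact: rep_linl.
  by rewrite rep_adjr -repM.
by rewrite rep_adj starK.
Qed.

Lemma rep_blin a : blin (s a).
Proof. by split; [exact: rep_lin|exists `|a| => // h; exact: rep_contract]. Qed.

Lemma rep_blinl h : blin (fun a => s a h).
Proof.
split; first exact: rep_linl.
by exists `|h| => // a; rewrite mulrC; exact: rep_contract.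
Qed.

Lemma rep_bound_star a (r : K) : 0 <= r -> (forall h, `|s a h| <= r * `|h|) ->
  forall h, `|s (star a) h| <= r * `|h|.
Proof.
move=> r0 h1 h; have [->|n0] := eqVneq (s (star a) h) 0; first by rewrite normr0 mulr_ge0.
have nx : 0 < `|s (star a) h| by rewrite normr_gt0.
rewrite -(ler_pM2r nx) -expr2 -inner_norm rep_adj starK.
have -> : inner h (s a (s (star a) h)) = `|inner h (s a (s (star a) h))|.
  by rewrite ger0_norm // -[a in s a]starK -rep_adj inner_ge0.
apply: le_trans (inner_CS _ _) _; rewrite [r * _]mulrC -mulrA ler_wpM2l //.
Qed.

End OneRepresentation.

(* [b + i (1 - y)] is unitary, and [2 b (1 - y)] is the imaginary part of its
   square. *)
Lemma norm_imaginary_part (b y : A) : star b = b -> star y = y ->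
  b ** b = 2 *: y - y ** y -> y ** b = b ** y -> `|2 *: (b - b ** y)| <= 1.
Proof.
move=> sb sy bb yb.
have Wbb w : w ** b ** b = 2 *: (w ** y) - w ** y ** y.
  by rewrite -amulA bb amulDr samulNr amulZr amulA.
have Wyb w : w ** y ** b = w ** b ** y by rewrite -!amulA yb.
(* The algebra has no unit, so the unitary enters only through its left multiplication [U i]. *)
pose U (i : K) (u : A) : A := b ** u + i *: (u - y ** u).
have U_iso (i : K) u : i * i = -1 -> conjc i = - i -> `|U i u| = `|u|.
  move=> ii ci; apply/eqP; rewrite -(@eqrXn2 _ 2) // -!norm_starM; apply/eqP; congr `|_|.
  rewrite /U starD starZ starB !starM sb sy conjCE ci.
  rewrite ?(amulDl, amulDr, samulNl, samulNr, amulZl, amulZr) ?amulA Wbb.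
  have -> : star u ** y ** b ** u = star u ** b ** y ** u by rewrite Wyb.
  rewrite ?(amulDl, amulDr, samulNl, samulNr, amulZl, amulZr) ?amulA.
  by lmod; ring: ii.
pose i : K := 'i%C.
have ii : i * i = -1 by rewrite -expr2 sqr_i.
have ci : conjc i = - i by apply/eqP; rewrite /i eq_complex /= oppr0 !eqxx.
have ci' : conjc (- i) = - - i by apply/eqP; rewrite /i eq_complex /= ?opprK ?oppr0 !eqxx.
have ii' : (- i) * (- i) = -1 by rewrite mulrNN.
have c_le u : `|(2 *: (b - b ** y)) ** u| <= `|u|.
  rewrite -(@ler_pM2l _ 2) //.
  have <- : `|(2 : K) *: ((2 *: (b - b ** y)) ** u)| = 2 * `|(2 *: (b - b ** y)) ** u|.
    by rewrite normrZ normr_nat.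
  have -> : (2 : K) *: ((2 *: (b - b ** y)) ** u) = (- i) *: (U i (U i u) - U (- i) (U (- i) u)).
    rewrite /U ?(amulDl, amulDr, samulNl, samulNr, amulZl, amulZr) ?amulA.
    have -> : y ** b ** u = b ** y ** u by rewrite yb.
    by lmod; ring: ii.
  rewrite normrZ normrN (_ : `|i| = 1) ?mul1r; last first.
    by apply/eqP; rewrite -(@eqrXn2 _ 2) // expr1n sqr_normc ci mulrN ii opprK.
  apply: le_trans (ler_normB _ _) _; rewrite !U_iso //.
  by rewrite mulr_natl mulr2n.
have sc : star (2 *: (b - b ** y)) = 2 *: (b - b ** y).
  by rewrite starZ starB starM sb sy yb conjCE conjc_nat.
have := c_le (2 *: (b - b ** y)); rewrite norm_sa2 // expr2.
have [->|c0] := eqVneq (2 *: (b - b ** y)) 0; first by rewrite normr0.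
by rewrite ger_pMl ?normr_gt0.
Qed.

Lemma small_pow2 (r : K) : 0 <= r -> r < 1 -> exists k, r ^+ (2 ^ k) <= 2^-1.
Proof.
move=> r0 r1; have d0 : 0 < 1 - r by rewrite subr_gt0.
have [N hN] := exists_invS_lt d0; exists N.+1.
(* A Bernoulli estimate in division-free form, giving decay of [r ^+ n] without logarithms. *)
have key n : r ^+ n * (1 + n%:R * (1 - r)) <= 1.
  elim: n => [|n ih]; first by rewrite mul0r addr0 mulr1.
  apply: le_trans ih; rewrite exprSr -mulrA ler_wpM2l ?exprn_ge0 //.
  rewrite -subr_ge0.
  have -> : 1 + n%:R * (1 - r) - r * (1 + n.+1%:R * (1 - r)) = (n.+1%:R) * (1 - r) ^+ 2.
    by rewrite -natr1; ring.
  by rewrite mulr_ge0 // exprn_ge0 // ltW.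
have [m Em] : exists m, (2 ^ N.+1 = m + N.+1)%N.
  by exists (2 ^ N.+1 - N.+1)%N; rewrite subnK // ltnW // ltn_expl.
have rpow n : r ^+ n <= 1 by rewrite exprn_ile1 // ltW.
rewrite Em exprD; apply: (@le_trans _ _ (r ^+ N.+1)).
  by rewrite ler_piMl ?exprn_ge0.
rewrite -[leRHS]mul1r ler_pdivlMr //; apply: le_trans (key N.+1); rewrite ler_wpM2l ?exprn_ge0 //.
have := hN N (leqnn _); rewrite -[X in X < _]mul1r ltr_pdivrMr ?ltr0n // => /ltW h.
by rewrite mulrC -[2]/(1 + 1) lerD.
Qed.

Section JointlyFaithful.
Variables (I : Type) (H : I -> hilbert R) (s : forall i, A -> H i -> H i).
Hypotheses (rs : forall i, representation (@s i))
  (s_inj : forall a, (forall i h, @s i a h = 0) -> a = 0).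

(* With [b^2 = 1 - w^2] and [z = 1 - |1 - 2 b^2|], the operators [s i (1 - 2 b^2)]
   are positive, so [s i z = s i (2 b^2)]. *)
Lemma half_bound_lift b : star b = b -> `|b| <= 1 ->
  (forall i h, 2 * `|@s i b h| ^+ 2 <= `|h| ^+ 2) -> 2 * `|b| ^+ 2 <= 1.
Proof.
move=> sb b1 hb.
have [||y [sy bb _ yC]] := @sqrt_complement R A (b ** b).
- by rewrite starM sb.
- by rewrite norm_sa2 // exprn_ile1.
have yb : y ** b = b ** y by apply/esym/yC; rewrite amulA.
have Wyy w : w ** y ** y = 2 *: (w ** y) - w ** b ** b.
  by rewrite -(amulA w b) bb amulDr samulNr amulZr amulA opprB addrC subrK.
have Wyb w : w ** y ** b = w ** b ** y by rewrite -!amulA yb.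
set c := 2 *: (b - b ** y).
have c1 : `|c| <= 1 by exact: norm_imaginary_part.
have sc : star c = c by rewrite starZ starB starM sb sy yb conjCE conjc_nat.
have ccE : c ** c = 4 *: (b ** b - b ** b ** b ** b).
  rewrite /c ?(amulDl, amulDr, samulNl, samulNr, amulZl, amulZr) ?amulA !(Wyb, Wyy).
  rewrite ?(amulDl, amulDr, samulNl, samulNr, amulZl, amulZr) ?amulA ?Wyb.
  by lmod.
have [||z [sz cc z1 zC]] := @sqrt_complement R A (c ** c).
- by rewrite starM sc.
- by rewrite norm_sa2 // exprn_ile1.
have zb : z ** b = b ** z.
  by apply/esym/zC; rewrite ccE amulZr amulZl amulDr amulDl samulNl samulNr !amulA.
have zzE : z ** z = 2 *: z - 4 *: (b ** b - b ** b ** b ** b).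
  by rewrite -ccE cc opprB addrC subrK.
set d := 2 *: (b ** b) - z.
(* A difference of squares: [(1 - z)^2 = (1 - 2 b^2)^2] factors as [(2 - z - 2 b^2) d = 0]. *)
have dE : 2 *: d - z ** d - 2 *: (b ** b ** d) = 0.
  rewrite /d ?(amulDl, amulDr, samulNl, samulNr, amulZl, amulZr) ?amulA zzE.
  have -> : z ** b ** b = b ** b ** z by rewrite zb -!amulA zb.
  by lmod.
have sd : star d = d by rewrite /d starB starZ starM sb sz conjCE conjc_nat.
(* For [k = s d h], [dE] gives [<z k, k> = 2 (|k|^2 - |b k|^2)]. This is at least [|k|^2] by the
   bound on [b], and at most [|k|^2] since [|z| <= 1]; equality forces [<d k, k> = 0]. *)
have dd0 i h : inner (@s i (d ** d ** d) h) h = 0.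
  rewrite !(repM (rs i)) (rep_adj (rs i)) sd; set k := s d h.
  have := congr1 (fun a => inner (@s i a h) k) dE.
  rewrite (linB (rep_linl (rs i) h)) (linB (rep_linl (rs i) h)) !(linZ (rep_linl (rs i) h)).
  rewrite (lin0 (rep_linl (rs i) h)) inner0l !(repM (rs i)) -/k.
  rewrite !innerDl !innerNl !innerZl (rep_adj (rs i) b (s b k)) sb !inner_norm => e0.
  have zk : inner (s z k) k = 2 * (`|k| ^+ 2 - `|@s i b k| ^+ 2).
    by apply/eqP; rewrite -subr_eq0 -oppr_eq0 -e0; apply/eqP; ring.
  have p1 : `|k| ^+ 2 <= inner (s z k) k.
    rewrite zk -subr_ge0; have := hb i k; rewrite -subr_ge0 => h'; apply: le_trans h' _.
    by rewrite le_eqVlt; apply/orP; left; apply/eqP; ring.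
  have p2 : inner (s z k) k <= `|k| ^+ 2.
    have -> : inner (s z k) k = `|inner (s z k) k|.
      by rewrite ger0_norm //; apply: le_trans p1; rewrite exprn_ge0.
    apply: le_trans (inner_CS _ _) _; rewrite expr2 ler_wpM2r //.
    by apply: le_trans (rep_contract (rs i) _ _) _; rewrite ler_piMl.
  have E : inner (s z k) k = `|k| ^+ 2 by apply/le_anti; rewrite p1 p2.
  rewrite /d (linB (rep_linl (rs i) k)) (linZ (rep_linl (rs i) k)) (repM (rs i)).
  rewrite innerDl innerNl innerZl (rep_adj (rs i) b (s b k)) sb inner_norm E.
  by apply/eqP; rewrite E in e0; rewrite -oppr_eq0 -e0; apply/eqP; ring.
(* A self-adjoint [e] with vanishing quadratic form is zero: expand the form at [h + e h]. *)
have ddd0 : d ** d ** d = 0.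
  have se : star (d ** d ** d) = d ** d ** d by rewrite !starM sd amulA.
  apply: s_inj => i h; set e := d ** d ** d in dd0 se *; apply/eqP.
  rewrite -normr_eq0 -sqrf_eq0 -inner_norm -(mulrI_eq0 _ (lregN (@lreg1 K))) mulN1r oppr_eq0.
  have := dd0 i (h + s e h); rewrite (linD (rep_lin (rs i) e)) !innerDl !innerDr !dd0 add0r addr0.
  rewrite (rep_adj (rs i) e (s e h)) se -mulr2n => /eqP; rewrite mulrn_eq0 /=.
  by [].
have d0 : d = 0.
  have dd : d ** d = 0.
    apply/eqP; rewrite -normr_eq0 -sqrf_eq0 -norm_sa2 ?starM ?sd //.
    by rewrite amulA ddd0 samul0l normr0.
  by apply/eqP; rewrite -normr_eq0 -sqrf_eq0 -norm_sa2 // dd normr0.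
have <- : `|2 *: (b ** b)| = 2 * `|b| ^+ 2 by rewrite normrZ normr_nat norm_sa2.
by rewrite (_ : 2 *: (b ** b) = z) //; apply/eqP; rewrite -subr_eq0 -/d d0.
Qed.

(** Suppose that a self-adjoint element of norm [1] had norm at most [q < 1] in every
    representation. Repeated squaring keeps its norm equal to [1] while the represented norms drop
    to [1/2], against [half_bound_lift]. The general case follows from [star a ** a]. *)
Lemma rep_isometry a (r : K) : 0 <= r ->
  (forall i h, `|@s i a h| <= r * `|h|) -> `|a| <= r.
Proof.
move=> r0; suff sa b (t : K) : 0 <= t -> star b = b -> (forall i h, `|@s i b h| <= t * `|h|) -> `|b| <= t.
  move=> h; rewrite -(@ler_pXn2r _ 2) ?nnegrE // -norm_starM.
  apply: sa => [||i x]; [by rewrite exprn_ge0|by rewrite starM starK|].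
  rewrite (repM (rs i)); apply: le_trans (rep_bound_star (rs i) r0 (h i) _) _.
  by rewrite expr2 -mulrA ler_wpM2l.
move=> t0 sb hb; rewrite real_leNgt ?ger0_real //; apply/negP => tb.
have nb : 0 < `|b| by exact: le_lt_trans tb.
pose b1 := `|b|^-1 *: b; pose q := t / `|b|.
have q0 : 0 <= q by rewrite divr_ge0.
have q1 : q < 1 by rewrite ltr_pdivrMr // mul1r.
pose bk k := iter k (fun x : A => x ** x) b1.
have bkP k : [/\ star (bk k) = bk k, `|bk k| = 1 & forall i h, `|@s i (bk k) h| <= q ^+ (2 ^ k) * `|h|].
  elim: k => [|k [sk nk hk]].
    split=> [||i h].
    - by rewrite /= starZ sb conjCE conjc_ge0 // invr_ge0.
    - by rewrite /= normrZ normfV normr_id mulVf // gt_eqF.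
    - rewrite /= (linZ (rep_linl (rs i) h)) normrZ normfV normr_id expn0 expr1 /q.
      by rewrite mulrAC [leRHS]mulrC ler_wpM2l ?invr_ge0 //; exact: hb.
  split=> [||i h]; first by rewrite /= starM sk.
    by rewrite /= norm_sa2 // nk expr1n.
  rewrite /= (repM (rs i)) expnS mul2n -addnn exprD -mulrA.
  by apply: le_trans (hk _ _) _; rewrite ler_wpM2l // exprn_ge0.
have [k hk] := small_pow2 q0 q1.
have [sk nk hk'] := bkP k.
have : 2 * `|bk k| ^+ 2 <= 1.
  apply: half_bound_lift => //; first by rewrite nk.
  move=> i h; have : `|@s i (bk k) h| <= 2^-1 * `|h|.
    by apply: le_trans (hk' i h) _; rewrite ler_wpM2r.
  rewrite -(@ler_pXn2r _ 2) ?nnegrE ?mulr_ge0 // => /(ler_wpM2l (_ : 0 <= 2)) h'.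
  apply: le_trans (h' _) _ => //; rewrite exprMn mulrA ler_piMl ?exprn_ge0 //.
  by rewrite (_ : 2 * 2^-1 ^+ 2 = 2^-1) ?invf_le1 ?ler1n //; field.
by rewrite nk expr1n mulr1 (lern1 _ 2).
Qed.

End JointlyFaithful.
End Representations.

Section IsometricRepresentation.
Variables (R : realType) (tens : forall A B : cstarAlgType R, min_tensor A B).
Local Notation K := R[i].

Lemma faithful_isometry (A : cstarAlgType R) (H : hilbert R) (s : A -> H -> H) :
  faithful_rep s -> forall a (r : K), 0 <= r -> (forall h, `|s a h| <= r * `|h|) -> `|a| <= r.
Proof.
move=> [rs si] a r r0 h.
apply: (@rep_isometry R A unit (fun=> H) (fun=> s)) => // b b0; apply: si.
by apply/funext => k; rewrite (b0 tt) (lin0 (rep_linl rs k)).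
Qed.

(** The spatial data of [tens A A] contain such a representation, which replaces a GNS
    construction. *)
Lemma exists_faithful_rep (A : cstarAlgType R) :
  exists (H : hilbert R) (s : A -> H -> H), faithful_rep s.
Proof. by case: (tmk_spatial (tens A A)) => H [K' [L [t [p [q [r []]]]]]] _ fp; exists H, p. Qed.

(** For [|c| <= 1], take for [1 - u] a power of [1 - c (star c)], which is contractive. In a
    representation the vector [v h n], the [n]-th power of [1 - (star c) c] applied to [h], loses at
    least [|c (v h n)|^2] in squared norm at each step, and [|c (v h n)|] decreases; hence
    [|c (v h n)|^2 <= |h|^2 / (n + 1)]. *)
Lemma near_unit1 (A : cstarAlgType R) (b : A) (e : K) : 0 < e ->
  exists u : A, `|b - u ** b| < e /\ forall x, `|x - u ** x| <= `|x|.
Proof.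
move=> e0; have [->|b0] := eqVneq b 0.
  by exists 0; rewrite samul0r subr0 normr0; split=> // x; rewrite samul0l subr0.
have nb : 0 < `|b| by rewrite normr_gt0.
suff main (c : A) (d : K) : 0 < d -> `|c| <= 1 ->
    exists u : A, `|c - u ** c| < d /\ forall x, `|x - u ** x| <= `|x|.
  have [||u [u1 u2]] := main (`|b|^-1 *: b) (`|b|^-1 * e); first by rewrite mulr_gt0 ?invr_gt0.
    by rewrite normrZ normfV normr_id mulVf // gt_eqF.
  exists u; split=> //; move: u1; rewrite amulZr -scalerBr normrZ normfV normr_id.
  by rewrite ltr_pM2l ?invr_gt0.
move=> d0 c1; have [H [s fs]] := exists_faithful_rep A.
have [rs _] := fs.
have contr (x : A) h : `|x| <= 1 -> `|h - s (star x) (s x h)| ^+ 2 <= `|h| ^+ 2 - `|s x h| ^+ 2.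
  move=> x1; have : `|s (star x) (s x h)| ^+ 2 <= `|s x h| ^+ 2.
    rewrite ler_pXn2r ?nnegrE //; apply: le_trans (rep_contract rs _ _) _.
    by rewrite norm_star ler_piMl.
  have e1 : inner h (s (star x) (s x h)) = `|s x h| ^+ 2.
    by rewrite (rep_adjr rs (star x) h) starK inner_norm.
  have e2 : inner (s (star x) (s x h)) h = `|s x h| ^+ 2.
    by rewrite (rep_adj rs (star x)) starK inner_norm.
  rewrite -(inner_norm (h - _)) innerDl !innerDr !innerNl !innerNr e1 e2 !inner_norm.
  rewrite -subr_ge0 => h'; rewrite -subr_ge0; apply: le_trans h' _.
  by rewrite le_eqVlt; apply/orP; left; apply/eqP; ring.
pose D (x : A) := x - (c ** star c) ** x.
have D1 x : `|D x| <= `|x|.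
  apply: (faithful_isometry fs) => // h; rewrite /D (linB (rep_linl rs h)) !(repM rs).
  apply: (@le_trans _ _ `|s x h|); last exact: rep_contract.
  rewrite -(@ler_pXn2r _ 2) ?nnegrE //.
  have := contr (star c) (s x h); rewrite starK norm_star => /(_ c1) h'; apply: le_trans h' _.
  by rewrite lerBlDr lerDl exprn_ge0.
have iterD n : exists u, forall x, iter n D x = x - u ** x.
  elim: n => [|n [u hu]]; first by exists 0 => x; rewrite samul0l subr0.
  exists (u + c ** star c - (c ** star c) ** u) => x.
  by rewrite /= hu /D; alg.
pose v h n := iter n (fun k => k - s (star c) (s c k)) h.
have cv h n : s (iter n D c) h = s c (v h n).
  elim: n => //= n ih; rewrite {1}/D (linB (rep_linl rs h)) !(repM rs) ih.
  by rewrite (linB (rep_lin rs c)).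
have main h n : n.+1%:R * `|s c (v h n)| ^+ 2 + `|v h n.+1| ^+ 2 <= `|h| ^+ 2.
  elim: n => [|n ih].
    by rewrite mul1r /= -lerBrDl; exact: contr.
  apply: le_trans ih; rewrite -natr1 mulrDl mul1r -addrA lerD //.
    rewrite ler_wpM2l // ler_pXn2r ?nnegrE // /= (linB (rep_lin rs c)).
    rewrite -(@ler_pXn2r _ 2) ?nnegrE //.
    have := contr (star c) (s c (v h n)); rewrite starK norm_star => /(_ c1) h'; apply: le_trans h' _.
    by rewrite lerBlDr lerDl exprn_ge0.
  by rewrite -lerBrDl; exact: contr.
have [|N hN] := @exists_invS_lt R ((d / 2) ^+ 2); first by rewrite exprn_gt0 // divr_gt0.
have [u hu] := iterD N; exists u; split; last first.
  move=> x; rewrite -hu; elim: {hN hu} N => //= n ih; exact: le_trans (D1 _) ih.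
rewrite -hu; apply: (@le_lt_trans _ _ (d / 2)); last by rewrite ltr_pdivrMr // ltr_pMr // ltr1n.
apply: (faithful_isometry fs) => [|h]; first by rewrite divr_ge0 // ltW.
rewrite cv -(@ler_pXn2r _ 2) ?nnegrE ?mulr_ge0 ?divr_ge0 ?(ltW d0) // exprMn.
have {}main : `|s c (v h N)| ^+ 2 <= N.+1%:R^-1 * `|h| ^+ 2.
  rewrite ler_pdivlMl ?ltr0n //; apply: le_trans (main h N).
  by rewrite lerDl exprn_ge0.
apply: le_trans main _; rewrite ler_wpM2r ?exprn_ge0 // ltW //; exact: hN.
Qed.

(** Factors [1 - w] are multiplied on the left, one for each element of the list. Each factor is
    contractive, so it preserves the estimates already obtained. *)
Lemma near_unit (A : cstarAlgType R) (l : seq A) (e : K) : 0 < e ->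
  exists u : A, (forall b, List.In b l -> `|b - u ** b| < e) /\
    forall x, `|x - u ** x| <= `|x|.
Proof.
move=> e0; elim: l => [|b l [u [ul u1]]].
  by exists 0; split=> // x; rewrite samul0l subr0.
have [w [wb w1]] := near_unit1 (b - u ** b) e0.
have E x : x - (u + w - w ** u) ** x = (x - u ** x) - w ** (x - u ** x) by alg.
exists (u + w - w ** u); split=> [c /= [<-|cl]|x]; rewrite E //.
  by apply: le_lt_trans (w1 _) _; exact: ul.
by apply: le_trans (w1 _) _.
Qed.

End IsometricRepresentation.

(** * Multipliers *)

Section Multipliers.
Variables (R : realType) (A : cstarAlgType R).
Local Notation K := R[i].
Implicit Types (m n : mult A) (x y z : A).

Lemma lmultMx m x y : lmult m (x ** y) = lmult m x ** y.
Proof. by apply: amul_injl => z; rewrite amulA !mult_centralizer amulA. Qed.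

Lemma rmultMx m x y : rmult m (x ** y) = x ** rmult m y.
Proof. by apply: amul_injr => z; rewrite -amulA -!mult_centralizer amulA. Qed.

Lemma lmultB m x y : lmult m (x - y) = lmult m x - lmult m y.
Proof. by rewrite -scaleN1r lmultD lmultZ scaleN1r. Qed.

Lemma lmult0 m : lmult m 0 = 0.
Proof. by have := lmultZ m 0 0; rewrite !scale0r. Qed.

Lemma lmult_sum m (J : Type) (s : seq J) (g : J -> A) :
  lmult m (\sum_(i <- s) g i) = \sum_(i <- s) lmult m (g i).
Proof. by elim: s => [|i s ih]; rewrite ?big_nil ?lmult0 // !big_cons lmultD ih. Qed.

Lemma lmult_sumM (J : Type) (s : seq J) (g : J -> mult A) x :
  lmult (\sum_(i <- s) g i) x = \sum_(i <- s) lmult (g i) x.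
Proof. by elim: s => [|i s ih]; rewrite ?big_nil // !big_cons /= ih. Qed.

Lemma rmult_star m x : rmult m x = star (lmult (star m) (star x)).
Proof. by rewrite /= !starK. Qed.

Lemma lmult_star m x : lmult (star m) x = star (rmult m (star x)).
Proof. by []. Qed.

Lemma mult_adj m x y : star (lmult m x) ** y = star x ** lmult (star m) y.
Proof. by rewrite mult_centralizer rmult_star !starK. Qed.

Lemma mult_adjr m x y : star x ** lmult m y = star (lmult (star m) x) ** y.
Proof. by rewrite mult_adj starK. Qed.

Lemma lmult_inj m n : (forall x, lmult m x = lmult n x) -> m = n.
Proof.
move=> h; apply: mult_eq => // x; apply: amul_injr => y.
by rewrite -!mult_centralizer h.
Qed.

(** A multiplier carries no explicit bound, so equality is tested after multiplication by [w] on the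
    left: [w ** lmult m x = rmult m w ** x] is visibly bounded in [x]. *)
Lemma lmult_inj_dense (S : set A) m n : closed_span S = setT ->
  (forall x, S x -> lmult m x = lmult n x) -> m = n.
Proof.
move=> ST h; apply: lmult_inj => x; apply: amul_injl => w; rewrite !mult_centralizer.
apply: (dense_ind ST (P := fun x => rmult m w ** x = rmult n w ** x)).
  by apply: csubm_eq; exact: blin_mull.
by move=> z Sz; rewrite -!mult_centralizer h.
Qed.

Lemma to_mult_inj : injective (@to_mult R A).
Proof.
move=> x y /(congr1 (@lmult R A)) e; apply: amul_injr => z.
by have := congr1 (fun f => f z) e.
Qed.

Lemma mul_to_mult m x : m ** to_mult x = to_mult (lmult m x).
Proof. by apply: lmult_inj => y /=; rewrite lmultMx. Qed.

Lemma to_mult_mul m x : to_mult x ** m = to_mult (rmult m x).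
Proof. by apply: lmult_inj => y /=; rewrite mult_centralizer. Qed.

Lemma to_mult_hom : star_hom (@to_mult R A).
Proof.
split=> [k x y|x y|x]; apply: lmult_inj => z /=.
- by rewrite amulDl amulZl.
- by rewrite amulA.
- by rewrite starM starK.
Qed.

Lemma mulm1 m : m ** mult1 A = m. Proof. exact: lmult_inj. Qed.
Lemma star_mult1 : star (mult1 A) = mult1 A.
Proof. by apply: lmult_inj => x /=; rewrite starK. Qed.

(* A bounded operator with an adjoint for the A-valued inner product
   [(x, y) |-> star x ** y] is a multiplier. *)
Definition adj_mult (L L' : A -> A)
    (adjLL' : forall x y, star (L' x) ** y = star x ** L y) : mult A :=
  @Mult R A L (fun x => star (L' (star x)))
    (fun x y => ltac:(by rewrite adjLL' starK)).

(** The squared norm of [rmult m x] is the norm of [x ** lmult m (star (rmult m x))]. *)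
Lemma rmult_bound m (M : K) : 0 <= M -> (forall x, `|lmult m x| <= M * `|x|) ->
  forall x, `|rmult m x| <= M * `|x|.
Proof.
move=> M0 h x; have [->|n0] := eqVneq (rmult m x) 0; first by rewrite normr0 mulr_ge0.
have nx : 0 < `|rmult m x| by rewrite normr_gt0.
rewrite -(ler_pM2r nx) -expr2 -norm_star2 -mult_centralizer.
apply: le_trans (norm_amul _ _) _; rewrite [M * _]mulrC -mulrA ler_wpM2l //.
by apply: le_trans (h _) _; rewrite norm_star.
Qed.

Lemma blin_lmult m (M : K) : 0 <= M -> (forall x, `|lmult m x| <= M * `|x|) -> blin (lmult m).
Proof. by move=> M0 h; split=> [k x y|]; [rewrite lmultD lmultZ|exists M]. Qed.

Lemma blin_rmult m (M : K) : 0 <= M -> (forall x, `|lmult m x| <= M * `|x|) -> blin (rmult m).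
Proof.
move=> M0 h; split=> [k x y|]; first by rewrite rmultD rmultZ.
by exists M => //; exact: rmult_bound.
Qed.

Lemma unitary_norm m x : star m ** m = mult1 A -> `|lmult m x| = `|x|.
Proof.
move=> mm; apply/eqP; rewrite -(@eqrXn2 _ 2) // -!norm_starM mult_adj.
by rewrite -[lmult (star m) _]/(lmult (star m ** m) x) mm.
Qed.

End Multipliers.

Lemma ler_sum_In (R : numDomainType) (I : Type) (l : seq I) (F G : I -> R) :
  (forall i, List.In i l -> F i <= G i) -> \sum_(i <- l) F i <= \sum_(i <- l) G i.
Proof.
elim: l => [|i l ih] h; first by rewrite !big_nil.
by rewrite !big_cons lerD ?h ?ih //=; [left|move=> j jl; apply: h; right].
Qed.

(** Evaluate the hypothesis at [star u]. The resulting factor [2] reappears in the estimates that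
    insert an approximate unit. *)
Lemma near_unit_norm (R : realType) (A : cstarAlgType R) (u : A) :
  (forall x, `|x - u ** x| <= `|x|) -> `|u| <= 2.
Proof.
move=> h; have [->|u0] := eqVneq u 0; first by rewrite normr0.
have nu : 0 < `|u| by rewrite normr_gt0.
rewrite -(ler_pM2r nu) -expr2 -norm_star2 -(subrK (star u) (u ** star u)).
apply: le_trans (ler_normD _ _) _; rewrite mulr_natl mulr2n lerD ?norm_star //.
by rewrite distrC -(norm_star u); exact: h.
Qed.

Lemma blin_star (R : realType) (A B : cstarAlgType R) (f : A -> B) :
  blin f -> blin (fun x => star (f (star x))).
Proof.
move=> [lf [M M0 fM]]; split=> [k x y|].
  by rewrite starD starZ lf starD starZ !conjCE conjcK.
by exists M => // x; rewrite norm_star -(norm_star x).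
Qed.

Section GeneratedMultipliers.
Variables (R : realType) (A : cstarAlgType R) (I : Type) (g : I -> A).
Local Notation K := R[i].
Hypothesis gd : forall x (e : K), 0 < e -> exists l, `|x - comb g l| < e.

(** A multiplier is prescribed on generators by its values [f] and the values [f'] of its adjoint;
    the pairing relation is the centralizer identity on generators, and density propagates it. *)
Lemma mult_of_gen (f f' : I -> A) (M : K) : 0 <= M ->
  (forall l, `|comb f l| <= M * `|comb g l|) ->
  (forall l, `|comb f' l| <= M * `|comb g l|) ->
  (forall i j, star (f' i) ** g j = star (g i) ** f j) ->
  exists X : mult A, [/\ forall i, lmult X (g i) = f i,
    forall i, lmult (star X) (g i) = f' i & forall x, `|lmult X x| <= M * `|x|].
Proof.
move=> M0 fM f'M ff'.
have [L [lL Lg LM]] := blin_ext gd M0 fM.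
have [L' [lL' L'g L'M]] := blin_ext gd M0 f'M.
have bL : blin L by split=> //; exists M.
have bL' : blin L' by split=> //; exists M.
have adj x y : star (L' x) ** y = star x ** L y.
  rewrite -[LHS]starK -[RHS]starK; congr star; rewrite !starM !starK.
  move: x; apply: (gen_ind gd) => [|i].
    apply: csubm_eq; last exact: blin_mull.
    by apply: (blin_comp _ bL'); exact: blin_mull.
  rewrite -[LHS]starK -[RHS]starK; congr star; rewrite !starM !starK L'g.
  move: y; apply: (gen_ind gd) => [|j]; last by rewrite Lg.
  apply: csubm_eq; first exact: blin_mull.
  by apply: (blin_comp _ bL); exact: blin_mull.
exists (adj_mult adj); split=> // i; by rewrite /= !starK.
Qed.

End GeneratedMultipliers.

(** For fixed [z] the bound extends [g i |-> L i z] to [A]; linearity in [z], adjoints and products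
    then follow from the generators by density. *)
Lemma hom_of_gen (R : realType) (A B : cstarAlgType R) (I : Type) (g : I -> A)
    (L : I -> B -> B) (st : I -> I) (mul : I -> I -> I) :
  (forall x (e : R[i]), 0 < e -> exists l, `|x - comb g l| < e) ->
  (forall i, g (st i) = star (g i)) -> (forall i j, g (mul i j) = g i ** g j) ->
  (forall i, blin (L i)) ->
  (forall i z z', star (L (st i) z) ** z' = star z ** L i z') ->
  (forall i j z, L (mul i j) z = L i (L j z)) ->
  (forall l z, `|comb (fun i => L i z) l| <= `|comb g l| * `|z|) ->
  exists Phi : A -> mult B, star_hom Phi /\ forall i z, lmult (Phi (g i)) z = L i z.
Proof.
move=> gd gs gm bL Ls Lm LM.
have ex z : exists f : A -> B, [/\ linear f, forall i, f (g i) = L i z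
    & forall x, `|f x| <= `|z| * `|x|].
  by apply: blin_ext => // l; rewrite mulrC.
have /choice[F FP] := ex.
have bF z : blin (F z) by have [lF _ FM] := FP z; split=> //; exists `|z|.
have Fg z i : F z (g i) = L i z by have [_ ->] := FP z.
have bF' x : blin (F^~ x).
  split=> [k z z'|]; last by exists `|x| => // z; have [_ _ FM] := FP z; rewrite mulrC.
  move: x; apply: (gen_ind gd) => [|i]; last by rewrite !Fg (blin_lin (bL i)).
  by apply: csubm_eq => //; apply: blin_combo.
have adj x z z' : star (F z (star x)) ** z' = star z ** F z' x.
  move: x; apply: (gen_ind gd) => [|i]; last by rewrite -gs !Fg Ls.
  apply: csubm_eq; last by apply: (blin_comp _ (bF z')); exact: blin_mull.
  by apply: (blin_comp (blin_mulr z')); exact: blin_star.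
exists (fun x => adj_mult (adj x)); split=> [|i z]; last exact: Fg.
split=> [k x y|x y|x]; apply: lmult_inj => z /=.
- by rewrite (blin_lin (bF z)).
- move: y; apply: (gen_ind gd) => [|j].
    apply: csubm_eq; first by apply: (blin_comp (bF z)); exact: blin_mull.
    exact: (blin_comp (bF' x)).
  rewrite Fg; move: x; apply: (gen_ind gd) => [|i]; last by rewrite -gm !Fg Lm.
  apply: csubm_eq; last exact: bF.
  by apply: (blin_comp (bF z)); exact: blin_mulr.
- by rewrite !starK.
Qed.

Section HomIntoMultipliers.
Variables (R : realType) (tens : forall A B : cstarAlgType R, min_tensor A B).
Local Notation K := R[i].
Variables (A B : cstarAlgType R) (phi : A -> mult B).
Hypothesis hphi : star_hom phi.

Lemma hom_lin : linear phi. Proof. by case: hphi. Qed.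
Lemma homM x y : phi (x ** y) = phi x ** phi y. Proof. by case: hphi. Qed.
Lemma hom_star x : phi (star x) = star (phi x). Proof. by case: hphi. Qed.

(** Apply [positive_vector_bound] to [z |-> s (lmult (phi z) b) h] with base vector [s b h]: only
    elements of [B], never the multiplier itself, have to be represented. *)
Lemma hom_contract a b : `|lmult (phi a) b| <= `|a| * `|b|.
Proof.
have [H [s fs]] := exists_faithful_rep tens B; have [rs _] := fs.
apply: (faithful_isometry fs) => [|h]; first by rewrite mulr_ge0.
suff : `|s (lmult (phi a) b) h| <= `|a| * `|s b h|.
  move=> h'; apply: le_trans h' _; rewrite -mulrA ler_wpM2l //; exact: rep_contract.
apply: (@positive_vector_bound R A H (fun z => s (lmult (phi z) b) h)) => [k x y|x y|z].
- by rewrite hom_lin /= (rep_linl rs).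
- by rewrite !(rep_inner rs) mult_adj homM hom_star.
- by rewrite !(rep_inner rs) mult_adj hom_star.
Qed.

Lemma hom_lmult_blin a : blin (lmult (phi a)).
Proof. by apply: (@blin_lmult _ _ _ `|a|) => // b; exact: hom_contract. Qed.

Lemma hom_rmult_blin a : blin (rmult (phi a)).
Proof. by apply: (@blin_rmult _ _ _ `|a|) => // b; exact: hom_contract. Qed.

Lemma hom_rcontract a b : `|rmult (phi a) b| <= `|a| * `|b|.
Proof. by apply: rmult_bound => // c; exact: hom_contract. Qed.

Lemma hom_lmult_blinl b : blin (fun a => lmult (phi a) b).
Proof.
split=> [k x y|]; first by rewrite hom_lin.
by exists `|b| => // a; rewrite mulrC hom_contract.
Qed.

Lemma hom_rmult_blinl b : blin (fun a => rmult (phi a) b).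
Proof.
split=> [k x y|]; first by rewrite hom_lin.
by exists `|b| => // a; rewrite mulrC hom_rcontract.
Qed.

(** The approximate unit only has to fix the finitely many elements of [A] occurring in an
    approximant of [b]. The hypothesis concerns a single [b], so that the result also reaches
    vectors in the range of a degenerate homomorphism. *)
Lemma closed_span_near_unit b (e : K) :
  closed_span [set x | exists a b, x = lmult (phi a) b] b -> 0 < e -> exists u : A,
    `|b - lmult (phi u) b| < e /\ forall x, `|x - u ** x| <= `|x|.
Proof.
move=> /closureP nd e0.
have gen x : (exists a b, x = lmult (phi a) b) -> exists p : A * B, x = lmult (phi p.1) p.2.
  by move=> [a [c ->]]; exists (a, c).
(* The distance [|b - c|] enters three times, once directly and twice through [|u| <= 2]; with the
   [e / 3] spent on [c] the total stays below [e]. *)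
have [|y /(lin_span_comb gen)[l ->] bl] := nd (e / 9); first by rewrite divr_gt0.
pose M := \sum_(p <- l) `|p.1| * `|p.2.2|.
have M0 : 0 <= M by apply: sumr_ge0 => p _; rewrite mulr_ge0.
have M1 : 0 < M + 1 by rewrite ltr_wpDl.
have [|u [ul u1]] := near_unit tens [seq p.2.1 | p <- l] (_ : 0 < e / 3 / (M + 1)).
  by rewrite !divr_gt0.
exists u; split=> //.
set c := comb _ l in bl.
have -> : b - lmult (phi u) b = (b - c) + (c - lmult (phi u) c) - lmult (phi u) (b - c).
  by rewrite lmultB; lmod.
have cu : `|c - lmult (phi u) c| <= e / 3.
  rewrite /c /comb lmult_sum -sumrB; apply: le_trans (ler_norm_sum _ _ _) _.
  apply: (@le_trans _ _ (\sum_(p <- l) `|p.1| * `|p.2.2| * (e / 3 / (M + 1)))).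
    apply: ler_sum_In => -[k [a d]] pl /=.
    rewrite lmultZ -scalerBr normrZ -[in leRHS]mulrA ler_wpM2l //.
    rewrite -[lmult (phi u) _]/(lmult (phi u ** phi a) d) -homM.
    have -> : lmult (phi a) d - lmult (phi (u ** a)) d = lmult (phi (a - u ** a)) d.
      by rewrite (linB hom_lin) -scaleN1r /= scaleN1r.
    apply: le_trans (hom_contract _ _) _; rewrite mulrC ler_wpM2l //; apply/ltW/ul.
    exact: (List.in_map (fun p : K * (A * B) => p.2.1) l (k, (a, d)) pl).
  rewrite -mulr_suml -/M mulrA ler_pdivrMr // mulrC ler_wpM2l //.
    by rewrite divr_ge0 // ltW.
  by rewrite lerDl.
have cu2 : `|lmult (phi u) (b - c)| <= 2 * `|b - c|.
  apply: le_trans (hom_contract _ _) _; rewrite ler_wpM2r //; exact: near_unit_norm.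
apply: le_lt_trans (ler_normB _ _) _.
apply: (@le_lt_trans _ _ (`|b - c| + e / 3 + 2 * `|b - c|)).
  by rewrite lerD //; apply: le_trans (ler_normD _ _) _; rewrite lerD.
have -> : `|b - c| + e / 3 + 2 * `|b - c| = 3 * `|b - c| + e / 3 by ring.
rewrite [ltRHS](_ : e = 3 * (e / 9) + e / 3 + e / 3); last by field.
apply: (@lt_trans _ _ (3 * (e / 9) + e / 3)); first by rewrite ltrD2r ltr_pM2l.
by rewrite ltrDl divr_gt0.
Qed.

Lemma nondegenerate_near_unit : nondegenerate phi ->
  forall b (e : K), 0 < e -> exists u : A,
    `|b - lmult (phi u) b| < e /\ forall x, `|x - u ** x| <= `|x|.
Proof. by move=> nd b e; apply: closed_span_near_unit; rewrite nd. Qed.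

End HomIntoMultipliers.

(** * Minimal tensor products *)

Lemma the_spec (U : Type) (d : U) (P : U -> Prop) : (exists x, P x) -> P (the d P).
Proof. by rewrite /the; case: pselect => // e _; exact: projT2 (cid e). Qed.

Lemma the_eq (U : Type) (d : U) (P : U -> Prop) x :
  P x -> (forall y, P y -> y = x) -> the d P = x.
Proof. by move=> Px u; apply: u; apply: the_spec; exists x. Qed.

Section HilbertTensor.
Variables (R : realType) (H K' L : hilbert R) (t : H -> K' -> L).
Hypothesis ht : is_hilbert_tensor t.
Local Notation K := R[i].

Lemma ht_inner h h' k k' : inner (t h k) (t h' k') = inner h h' * inner k k'.
Proof. by case: ht. Qed.

Lemma ht_eq0 v : (forall h k, inner v (t h k) = 0) -> v = 0.
Proof.
move=> h; apply: inner_eq0 => w; rewrite innerC -[RHS]conjc0; congr conjc.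
case: ht => _ dt; apply: (dense_ind dt (P := fun w => inner w v = 0)).
  exact: (csubm_eq (blin_inner v) (@blin0 _ _ (K^o))).
by move=> _ [a [b ->]]; rewrite innerC h conjc0.
Qed.

Lemma ht_linl a h h' k : t (a *: h + h') k = a *: t h k + t h' k.
Proof.
apply/eqP; rewrite -subr_eq0; apply/eqP/ht_eq0 => u v.
by rewrite innerDl innerNl inner_lin !ht_inner inner_lin; ring.
Qed.

Lemma ht_linr a h k k' : t h (a *: k + k') = a *: t h k + t h k'.
Proof.
apply/eqP; rewrite -subr_eq0; apply/eqP/ht_eq0 => u v.
by rewrite innerDl innerNl inner_lin !ht_inner inner_lin; ring.
Qed.

Lemma ht_norm h k : `|t h k| = `|h| * `|k|.
Proof.
apply/eqP; rewrite -(@eqrXn2 _ 2) ?mulr_ge0 //.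
by rewrite -inner_norm ht_inner !inner_norm exprMn.
Qed.

Definition ht_vec (l : seq (H * K')) : L := \sum_(p <- l) t p.1 p.2.

Lemma ht_vec_dense : closure [set v | exists l, v = ht_vec l] = setT.
Proof.
case: ht => _ dt; rewrite -dt; apply: congr1; apply/seteqP; split=> v /=.
  move=> [l ->]; exists [seq (1, t p.1 p.2) | p <- l]; split.
    by move=> p /mapP[q _ ->]; exists q.1, q.2.
  by rewrite big_map; apply: eq_bigr => p _; rewrite scale1r.
move=> [s [sS ->]]; elim: s sS => [|p s ih] sS.
  by exists [::]; rewrite /ht_vec !big_nil.
have [q qs|l El] := ih; first by apply: sS; rewrite inE qs orbT.
have [h [k hk]] := sS p (mem_head _ _).
exists ((p.1 *: h, k) :: l); rewrite big_cons El /ht_vec big_cons hk /=; congr (_ + _).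
rewrite -[p.1 *: h]addr0 ht_linl (_ : t 0 k = 0) ?addr0 //.
by apply: ht_eq0 => u w; rewrite ht_inner inner0l mul0r.
Qed.

End HilbertTensor.

Section TensorBasics.
Variables (R : realType) (tens : forall A B : cstarAlgType R, min_tensor A B).
Local Notation K := R[i].

(** Transfers statements about one leg to the other, as in [tmk_normr] and for the evaluations on
    [C_0(G)]. *)
Program Definition flip_tensor (A C : cstarAlgType R) (T : min_tensor A C) : min_tensor C A :=
  @MinTensor R C A T (fun c a => tmk T a c) _ _.
Next Obligation.
move=> A C T; rewrite -(tmk_dense T); congr closed_span; apply/seteqP.
by split=> x [a [b ->]]; exists b, a.
Qed.
Next Obligation.
move=> A C T; have [H [K' [L [t [p [s [r [[ti td] fp fs fr rt]]]]]]]] := tmk_spatial T.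
exists K', H, L, (fun k h => t h k), s, p, r; split=> //.
split=> [h h' k k'|]; first by rewrite ti mulrC.
rewrite -td; congr closed_span; apply/seteqP.
by split=> x [a [b ->]]; exists b, a.
Qed.

Section OneTensor.
Variables (A C : cstarAlgType R) (T : min_tensor A C).

Lemma tensor_ind (P : set T) : csubm P -> (forall a c, P (tmk T a c)) -> forall x, P x.
Proof.
by move=> cP h; apply: (dense_ind (tmk_dense T) cP) => _ [a [c ->]].
Qed.

Lemma tensor_near x (e : K) : 0 < e ->
  exists l : seq (K * (A * C)), `|x - comb (fun p => tmk T p.1 p.2) l| < e.
Proof.
apply: (closed_span_comb (S := [set x | exists a b, x = tmk T a b])); last exact: tmk_dense.
by move=> _ [a [c ->]]; exists (a, c).
Qed.

Section Spatial.
Variables (H K' L : hilbert R) (t : H -> K' -> L) (p : A -> H -> H) (s : C -> K' -> K')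
  (r : T -> L -> L).
Hypotheses (ht : is_hilbert_tensor t) (fp : faithful_rep p) (fs : faithful_rep s)
  (fr : faithful_rep r) (rt : forall a b h k, r (tmk T a b) (t h k) = t (p a h) (s b k)).

Lemma spatial_inj x y : (forall h k, r x (t h k) = r y (t h k)) -> x = y.
Proof.
move=> h; case: fr => rr ri; apply: ri; apply/funext.
case: (ht) => _ dt; apply: (dense_ind dt (P := fun v => r x v = r y v)).
  by apply: csubm_eq; exact: rep_blin.
by move=> _ [u [v ->]].
Qed.

Lemma spatial_tmk a c h k h' k' :
  inner (r (tmk T a c) (t h k)) (t h' k') = inner (p a h) h' * inner (s c k) k'.
Proof. by rewrite rt (ht_inner ht). Qed.

End Spatial.

Lemma tmk_linl c : linear (fun a => tmk T a c).
Proof.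
have [H [K' [L [t [p [s [r [ht [rp _] fs fr rt]]]]]]]] := tmk_spatial T.
move=> k a b; apply: (spatial_inj ht fr) => h h'; have [rr _] := fr.
by rewrite (rep_linl rr) !rt (rep_linl rp) (ht_linl ht).
Qed.

Lemma tmk_linr a : linear (tmk T a).
Proof.
have [H [K' [L [t [p [s [r [ht fp [rs _] fr rt]]]]]]]] := tmk_spatial T.
move=> k c d; apply: (spatial_inj ht fr) => h h'; have [rr _] := fr.
by rewrite (rep_linl rr) !rt (rep_linl rs) (ht_linr ht).
Qed.

Lemma tmkM a b c d : tmk T a c ** tmk T b d = tmk T (a ** b) (c ** d).
Proof.
have [H [K' [L [t [p [s [r [ht [rp _] [rs _] fr rt]]]]]]]] := tmk_spatial T.
apply: (spatial_inj ht fr) => h h'; have [rr _] := fr.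
by rewrite (repM rr) !rt (repM rp) (repM rs).
Qed.

Lemma star_tmk a c : star (tmk T a c) = tmk T (star a) (star c).
Proof.
have [H [K' [L [t [p [s [r [ht [rp _] [rs _] fr rt]]]]]]]] := tmk_spatial T.
apply: (spatial_inj ht fr) => h h'; have [rr _] := fr.
apply/eqP; rewrite -subr_eq0; apply/eqP/(ht_eq0 ht) => u v.
rewrite innerDl innerNl (rep_adj rr) starK !rt !(ht_inner ht).
by rewrite (rep_adj rp) (rep_adj rs) !starK subrr.
Qed.

(** This estimates [phi d (x) 1] before it is known to exist. For a finite sum [z], the vectors
    [s (V d) h] obey [positive_vector_bound] with base vector [s z h], because [star (V y) ** V x =
    star z ** V (star y ** x)]. *)
Lemma tmk_norml (D : cstarAlgType R) (phi : D -> mult A) (l : seq (A * C)) d :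
  star_hom phi ->
  `|\sum_(q <- l) tmk T (lmult (phi d) q.1) q.2| <= `|d| * `|\sum_(q <- l) tmk T q.1 q.2|.
Proof.
move=> hphi.
have [H [s fs]] := exists_faithful_rep tens T; have [rs _] := fs.
set z := \sum_(q <- l) tmk T q.1 q.2.
pose V d := \sum_(q <- l) tmk T (lmult (phi d) q.1) q.2.
rewrite -/(V d).
have lV : linear V.
  move=> k x y; rewrite /V scaler_sumr -big_split; apply: eq_bigr => q _ /=.
  by rewrite (hom_lin hphi) /= tmk_linl.
have VM x y : star (V y) ** V x = star z ** V (star y ** x).
  rewrite /V /z !star_sum !amul_suml; apply: eq_bigr => q _.
  rewrite !amul_sumr; apply: eq_bigr => q' _.
  by rewrite !star_tmk !tmkM mult_adj (homM hphi) (hom_star hphi).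
have Vs x : star z ** V (star x) = star (V x) ** z.
  rewrite /V /z !star_sum !amul_suml; apply: eq_bigr => q _.
  rewrite !amul_sumr; apply: eq_bigr => q' _.
  by rewrite !star_tmk !tmkM mult_adj (hom_star hphi).
apply: (faithful_isometry fs) => [|h]; first by rewrite mulr_ge0.
suff h' : `|s (V d) h| <= `|d| * `|s z h|.
  by apply: le_trans h' _; rewrite -mulrA ler_wpM2l //; exact: rep_contract.
apply: (@positive_vector_bound R D H (fun d => s (V d) h)) => [k x y|x y|x].
- by rewrite lV (rep_linl rs).
- by rewrite !(rep_inner rs) VM.
- by rewrite !(rep_inner rs) Vs.
Qed.

End OneTensor.

Lemma tmk_normr (A C D : cstarAlgType R) (T : min_tensor A C) (phi : D -> mult C)
    (l : seq (A * C)) d : star_hom phi ->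
  `|\sum_(q <- l) tmk T q.1 (lmult (phi d) q.2)| <= `|d| * `|\sum_(q <- l) tmk T q.1 q.2|.
Proof.
move=> hphi; have := @tmk_norml _ _ (flip_tensor T) D phi [seq (q.2, q.1) | q <- l] d hphi.
by rewrite !big_map.
Qed.

Section OneTensor2.
Variables (A C : cstarAlgType R) (T : min_tensor A C).

(** Squaring gives [star a ** a] and [star c ** c] on the two legs; [star a] and [star c] are then
    moved out one leg at a time. *)
Lemma tmk_norm a c : `|tmk T a c| <= `|a| * `|c|.
Proof.
have [->|t0] := eqVneq (tmk T a c) 0; first by rewrite normr0 mulr_ge0.
have nt : 0 < `|tmk T a c| by rewrite normr_gt0.
rewrite -(ler_pM2r nt) -expr2 -norm_starM star_tmk tmkM.
have := @tmk_norml A C T A (@to_mult R A) [:: (a, star c ** c)] (star a) (@to_mult_hom R A).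
rewrite !big_seq1 /= => h; apply: le_trans h _; rewrite norm_star -mulrA ler_wpM2l //.
have := tmk_normr T [:: (a, c)] (star c) (@to_mult_hom R C).
by rewrite !big_seq1 /= norm_star.
Qed.

Lemma blin_tmkl c : blin (fun a => tmk T a c).
Proof.
split; first exact: tmk_linl.
by exists `|c| => // a; rewrite mulrC tmk_norm.
Qed.

Lemma comb_tmk (l : seq (K * (A * C))) :
  comb (fun p => tmk T p.1 p.2) l = \sum_(q <- [seq (p.1 *: p.2.1, p.2.2) | p <- l]) tmk T q.1 q.2.
Proof.
rewrite big_map; apply: eq_bigr => -[k [a c]] _ /=.
by rewrite (linZ (tmk_linl T c)).
Qed.

(** Tested on [h] and [h'], the slice of [x] is [psi z], where [z] slices the other leg by the
    vector functional of [h] and [h']. The matrix coefficients of [z] are those of [x] on elementary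
    vectors, so the spatial norm of [x] controls [|z|]. *)
Lemma slice_bound (psi : C -> K^o) (M : K) (l : seq (K * (A * C))) :
  linear psi -> 0 <= M -> (forall c, `|psi c| <= M * `|c|) ->
  `|comb (fun p => psi p.2 *: p.1) l| <= M * `|comb (fun p => tmk T p.1 p.2) l|.
Proof.
move=> lp M0 pM.
have [H [K' [L [t [p [s [r [ht fp fs fr rt]]]]]]]] := tmk_spatial T.
have [[rp _] [rs _] [rr _]] := And3 fp fs fr.
set x := comb (fun p => tmk T p.1 p.2) l.
apply: (faithful_isometry fp) => [|h]; first by rewrite mulr_ge0.
apply: inner_le_norm => [|h']; first by rewrite !mulr_ge0.
pose z := \sum_(q <- l) (q.1 * inner (p q.2.1 h) h') *: q.2.2.
have -> : inner (p (comb (fun p => psi p.2 *: p.1) l) h) h' = psi z.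
  rewrite (lin_comb (rep_linl rp h)) /comb inner_suml /z (lin_sum lp).
  apply: eq_bigr => q _; rewrite /= innerZl (linZ (rep_linl rp h)) innerZl (linZ lp).
  by rewrite -[RHS]/(_ * _) -mulrA [psi _ * _]mulrC.
apply: le_trans (pM _) _; rewrite -!mulrA ler_wpM2l //.
apply: (faithful_isometry fs) => [|k]; first by rewrite !mulr_ge0.
apply: inner_le_norm => [|k']; first by rewrite !mulr_ge0.
have -> : inner (s z k) k' = inner (r x (t h k)) (t h' k').
  rewrite (lin_sum (rep_linl rs k)) /x (lin_comb (rep_linl rr _)) /comb !inner_suml.
  apply: eq_bigr => q _; rewrite /= (linZ (rep_linl rs k)) !innerZl.
  by rewrite (spatial_tmk ht rt) mulrA.
apply: le_trans (inner_CS _ _) _.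
have -> : `|x| * (`|h| * `|h'|) * `|k| * `|k'| = (`|x| * (`|h| * `|k|)) * (`|h'| * `|k'|) by ring.
by rewrite !(ht_norm ht) ler_wpM2r ?mulr_ge0 // -(ht_norm ht); exact: rep_contract.
Qed.

(* The slice map [id (x) psi] (a junk value unless [psi] is bounded linear). *)
Definition slice (psi : C -> K^o) : T -> A :=
  the (fun=> 0) (fun S => blin S /\ forall a c, S (tmk T a c) = psi c *: a).

Lemma sliceP (psi : C -> K^o) : blin psi ->
  blin (slice psi) /\ forall a c, slice psi (tmk T a c) = psi c *: a.
Proof.
move=> [lp [M M0 pM]].
apply: (@the_spec (T -> A) _ (fun S => blin S /\ forall a c, S (tmk T a c) = psi c *: a)).
have [Phi [lP gP bP]] := @blin_ext R T A (A * C)%type (fun p => tmk T p.1 p.2)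
  (fun p => psi p.2 *: p.1) M (@tensor_near A C T) M0 (fun l => slice_bound l lp M0 pM).
exists Phi; split; first by split=> //; exists M.
by move=> a c; exact: (gP (a, c)).
Qed.

Lemma slice_blin psi : blin psi -> blin (slice psi). Proof. by case/sliceP. Qed.

Lemma slice_tmk psi a c : blin psi -> slice psi (tmk T a c) = psi c *: a.
Proof. by case/sliceP. Qed.

(** Vector functionals suffice: slicing by them recovers every matrix coefficient of [x] between
    elementary vectors, and these vectors are total. *)
Lemma slice_sep x : (forall psi, blin psi -> slice psi x = 0) -> x = 0.
Proof.
move=> h.
have [H [K' [L [t [p [s [r [ht fp fs fr rt]]]]]]]] := tmk_spatial T.
have [[rp _] [rs _] [rr _]] := And3 fp fs fr.
apply: (spatial_inj ht fr) => u v; rewrite (lin0 (rep_linl rr _)).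
apply: (ht_eq0 ht) => u' v'.
pose psi c : K^o := inner (s c v) v'.
have bp : blin psi by apply: (blin_comp (blin_inner v')); exact: rep_blinl.
suff -> : inner (r x (t u v)) (t u' v') = inner (p (slice psi x) u) u'.
  by rewrite h // (lin0 (rep_linl rp _)) inner0l.
move: x {h}; apply: tensor_ind => [|a c].
  apply: (@csubm_eq _ _ (K^o)).
    by apply: (blin_comp (blin_inner _)); exact: rep_blinl.
  apply: (blin_comp (blin_inner _)); apply: (blin_comp (rep_blinl rp u)).
  exact: slice_blin.
by rewrite (spatial_tmk ht rt) slice_tmk // (linZ (rep_linl rp _)) innerZl mulrC.
Qed.

Lemma tensor_functional (phi : A -> K^o) (psi : C -> K^o) : blin phi -> blin psi ->
  exists F : T -> K^o, blin F /\ forall a c, F (tmk T a c) = phi a * psi c.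
Proof.
move=> bf bp; exists (fun x => phi (slice psi x)); split.
  by apply: blin_comp => //; exact: slice_blin.
by move=> a c; rewrite slice_tmk // (linZ (blin_lin bf)) mulrC.
Qed.

End OneTensor2.
End TensorBasics.

(** * Tensor products of multipliers and homomorphisms *)

Section TensorHomBound.
Variables (R : realType) (tens : forall A B : cstarAlgType R, min_tensor A B).
Local Notation K := R[i].
Variables (A C B E : cstarAlgType R) (T1 : min_tensor A C) (T2 : min_tensor B E).
Variables (pi : A -> mult B) (rho : C -> mult E).
Hypotheses (hpi : star_hom pi) (hrho : star_hom rho).
Implicit Types (Z : seq (B * E)) (q : A * C).

Let val Z : T2 := \sum_(b <- Z) tmk T2 b.1 b.2.
Let V Z q : T2 := \sum_(b <- Z) tmk T2 (lmult (pi q.1) b.1) (lmult (rho q.2) b.2).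
Let st q := (star q.1, star q.2).
Let mul q q' := (q.1 ** q'.1, q.2 ** q'.2).
Let g q := tmk T1 q.1 q.2.

Let VstE Z q : star (val Z) ** V Z (st q) = star (V Z q) ** val Z.
Proof.
rewrite /V /val !star_sum !amul_suml; apply: eq_bigr => b _.
rewrite !amul_sumr; apply: eq_bigr => b' _.
by rewrite !star_tmk !tmkM !mult_adj !hom_star.
Qed.

Let VmulE Z q q' : star (V Z q) ** V Z q' = star (val Z) ** V Z (mul (st q) q').
Proof.
rewrite /V /val !star_sum !amul_suml; apply: eq_bigr => b _.
rewrite !amul_sumr; apply: eq_bigr => b' _.
by rewrite !star_tmk !tmkM !mult_adj /= !homM // !hom_star.
Qed.

Lemma tensor_functional_sum (J : Type) (s : seq J) (f : J -> A -> C -> K) :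
  (forall j, exists F : T1 -> K^o, blin F /\ forall a c, F (tmk T1 a c) = f j a c) ->
  exists F : T1 -> K^o, blin F /\ forall a c, F (tmk T1 a c) = \sum_(j <- s) f j a c.
Proof.
move=> h; elim: s => [|j s [F [bF FE]]].
  exists (fun _ => 0 : K^o); split; first exact: blin0.
  by move=> a c; rewrite big_nil.
have [F' [bF' F'E]] := h j; exists (fun x => F' x + F x); split; first exact: blinD.
by move=> a c; rewrite big_cons F'E FE.
Qed.

(** For [xi] a finite sum of elementary vectors, [q |-> inner (r (V Z q) xi) (r z0 xi)] is a finite
    sum of products of bounded functionals, hence extends to a bounded [F] on the minimal tensor
    product [T1]. Its positivity on finite sums reduces the estimate to [positive_functional_dense];
    density of such [xi] does the rest. *)
Lemma tensor_hom_bound Z l :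
  `|comb (V Z) l| <= `|comb g l| * `|val Z|.
Proof.
have [H [K' [L [t [p [s [r [ht fp fs fr rt]]]]]]]] := tmk_spatial T2.
have [[rp _] [rs _] [rr _]] := And3 fp fs fr.
apply: (faithful_isometry fr) => [|xi]; first by rewrite mulr_ge0.
move: xi; apply: csubm_le (ht_vec_dense ht) _; [exact: rep_blin| |by rewrite mulr_ge0].
move=> _ [m ->]; set xi := ht_vec t m; set z0 := val Z.
suff h : `|r (comb (V Z) l) xi| <= `|comb g l| * `|r z0 xi|.
  by apply: le_trans h _; rewrite -mulrA ler_wpM2l //; exact: rep_contract.
pose f q := inner (r (V Z q) xi) (r z0 xi).
have [F [bF FE]] : exists F : T1 -> K^o, blin F /\ forall a c, F (tmk T1 a c) = f (a, c).
  suff [F [bF FE]] : exists F : T1 -> K^o, blin F /\ forall a c, F (tmk T1 a c) =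
      \sum_(b <- Z) \sum_(b' <- Z) \sum_(u <- m) \sum_(u' <- m)
        inner (p (lmult (pi a) b.1) u.1) (p b'.1 u'.1) *
        inner (s (lmult (rho c) b.2) u.2) (s b'.2 u'.2).
    exists F; split=> // a c; rewrite FE /f /V /z0 /val.
    rewrite !(lin_sum (rep_linl rr _)) inner_suml; apply: eq_bigr => b _.
    rewrite inner_sumr; apply: eq_bigr => b' _.
    rewrite /xi /ht_vec !(lin_sum (rep_lin rr _)) inner_suml; apply: eq_bigr => u _.
    rewrite inner_sumr; apply: eq_bigr => u' _.
    by rewrite !rt (ht_inner ht).
  apply: tensor_functional_sum => b; apply: tensor_functional_sum => b'.
  apply: tensor_functional_sum => u; apply: tensor_functional_sum => u'.
  have b1 : blin (fun a => inner (p (lmult (pi a) b.1) u.1) (p b'.1 u'.1) : K^o).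
    apply: (blin_comp (blin_inner _)); apply: (blin_comp (rep_blinl rp _)).
    exact: (hom_lmult_blinl tens).
  have b2 : blin (fun c => inner (s (lmult (rho c) b.2) u.2) (s b'.2 u'.2) : K^o).
    apply: (blin_comp (blin_inner _)); apply: (blin_comp (rep_blinl rs _)).
    exact: (hom_lmult_blinl tens).
  by have [F [bF FE]] := tensor_functional T1 b1 b2; exists F.
have Fg q : F (g q) = f q by rewrite /g FE; case: q.
have Fcomb l1 : F (comb g l1) = inner (r (comb (V Z) l1) xi) (r z0 xi).
  rewrite (lin_comb (blin_lin bF)) (lin_comb (rep_linl rr xi)) /comb inner_suml.
  by apply: eq_bigr => q _; rewrite /= Fg innerZl.
have Fstar l1 : F (star (comb g l1)) = inner (r z0 xi) (r (comb (V Z) l1) xi).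
  rewrite (lin_comb (rep_linl rr xi)) /comb star_sum (lin_sum (blin_lin bF)) inner_sumr.
  apply: eq_bigr => q _; rewrite starZ /g star_tmk (linZ (blin_lin bF)) innerZr.
  rewrite -[tmk _ _ _]/(g (st q.2)) Fg /f (rep_inner rr) VstE -(rep_inner rr).
  by rewrite conjCE.
have Fmul l1 : F (star (comb g l1) ** comb g l1) = `|r (comb (V Z) l1) xi| ^+ 2.
  rewrite -inner_norm (lin_comb (rep_linl rr xi)) /comb star_sum amul_suml.
  rewrite (lin_sum (blin_lin bF)) inner_sumr; apply: eq_bigr => q _.
  rewrite amul_sumr (lin_sum (blin_lin bF)) inner_suml; apply: eq_bigr => q' _.
  rewrite starZ /g star_tmk amulZl amulZr !(linZ (blin_lin bF)).
  rewrite tmkM -[tmk _ _ _]/(g (mul (st q.2) q'.2)) Fg /f (rep_inner rr) -VmulE -(rep_inner rr).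
  by rewrite innerZl innerZr conjCE -[LHS]/(_ * (_ * _)); ring.
rewrite -(@ler_pXn2r _ 2) ?nnegrE ?mulr_ge0 // exprMn mulrC -Fmul.
apply: (positive_functional_dense (P := [set x | exists l, x = comb g l]) bF).
  by move=> x e e0; have [l1 xl] := @tensor_near R _ _ T1 x _ e0; exists (comb g l1) => //; exists l1.
move=> _ [l1 ->]; rewrite Fcomb Fstar Fmul.
apply: le_trans (inner_ge0 (r z0 xi - r (comb (V Z) l1) xi)) _.
rewrite innerDl !innerDr !innerNl !innerNr !inner_norm.
by rewrite le_eqVlt; apply/orP; left; apply/eqP; ring.
Qed.

Lemma comb_val (l : seq (K * (B * E))) : exists Z, forall q : A * C,
  comb (fun p => tmk T2 p.1 p.2) l = val Z /\
  comb (fun b => tmk T2 (lmult (pi q.1) b.1) (lmult (rho q.2) b.2)) l = V Z q.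
Proof.
exists [seq (p.1 *: p.2.1, p.2.2) | p <- l] => q; rewrite /val /V !big_map.
by split; apply: eq_bigr => b _ /=; rewrite ?lmultZ (linZ (tmk_linl T2 _)).
Qed.

(** Two stages: for a fixed pair [q], [mult_of_gen] yields a multiplier [X q] of [T2]; then
    [hom_of_gen] extends [q |-> X q] over [T1]. The first stage uses [tensor_hom_bound] for one
    term, the second for arbitrary sums. *)
Lemma tensor_hom_exists : exists Phi : T1 -> mult T2, star_hom Phi /\
  forall a c b e, lmult (Phi (tmk T1 a c)) (tmk T2 b e) = tmk T2 (lmult (pi a) b) (lmult (rho c) e).
Proof.
pose g2 (b : B * E) := tmk T2 b.1 b.2.
pose f q (b : B * E) := tmk T2 (lmult (pi q.1) b.1) (lmult (rho q.2) b.2).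
have fM q l : `|comb (f q) l| <= `|g q| * `|comb g2 l|.
  have [Z hZ] := comb_val l; have [h1 h2] := hZ q.
  by rewrite /f /g2 h1 h2; have := tensor_hom_bound Z [:: (1, q)]; rewrite !comb1.
have /choice[X XP] : forall q, exists X : mult T2, [/\ forall b, lmult X (g2 b) = f q b,
    forall b, lmult (star X) (g2 b) = f (st q) b & forall x, `|lmult X x| <= `|g q| * `|x|].
  move=> q; apply: mult_of_gen => // [|l|b b']; first exact: tensor_near.
    apply: le_trans (fM _ _) _; rewrite /g /= -star_tmk norm_star //.
  by rewrite /f /g2 !star_tmk !tmkM /= !mult_adj !hom_star // !starK.
have Xext q m : (forall b e, lmult m (tmk T2 b e) = f q (b, e)) -> X q = m.
  move=> h; apply: (lmult_inj_dense (tmk_dense T2)) => _ [b [e ->]].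
  by rewrite h; have [h1 _ _] := XP q; rewrite -(h1 (b, e)).
have XE q b : lmult (X q) (g2 b) = f q b by have [->] := XP q.
have bX q : blin (lmult (X q)) by have [_ _ h] := XP q; apply: blin_lmult h.
have [|||||||Phi [hPhi PhiE]] := @hom_of_gen R T1 T2 (A * C) g (fun q => lmult (X q)) st mul.
- exact: tensor_near.
- by move=> q; rewrite /g star_tmk.
- by move=> q q'; rewrite /g tmkM.
- exact: bX.
- move=> q z z'; rewrite mult_adjr (Xext (st q) (star (X q))) // => b e.
  by have [_ h _] := XP q; exact: (h (b, e)).
- move=> q q' z; rewrite (Xext (mul q q') (X q ** X q')) // => b e.
  by rewrite -[lmult _ _]/(lmult (X q) (lmult (X q') (g2 (b, e)))) XE /f (XE q (_, _)) /f /= !homM.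
- move=> l z; move: z; apply: (csubm_le (P := [set x | exists l, x = comb g2 l])) => //.
  + by apply: blin_sum => q; exact: blinZ.
  + move=> _ [m ->]; have [Z hZ] := comb_val m.
    have -> : comb (fun i => lmult (X i) (comb g2 m)) l = comb (V Z) l.
      apply: eq_bigr => q _; congr (_ *: _); have [_ <-] := hZ q.2.
      rewrite /comb lmult_sum; apply: eq_bigr => b _.
      by rewrite lmultZ XE.
    have [zE _] := hZ (0, 0); rewrite /g2 zE; exact: tensor_hom_bound.
  + apply/seteqP; split=> // x _; apply/closureP => e e0.
    by have [m xm] := @tensor_near R _ _ T2 x _ e0; exists (comb g2 m) => //; exists m.
exists Phi; split=> // a c b e.
by have := PhiE (a, c) (g2 (b, e)); rewrite XE.
Qed.

End TensorHomBound.

Section MultiplierTensor.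
Variables (R : realType) (tens : forall A B : cstarAlgType R, min_tensor A B).
Local Notation K := R[i].

(** The description of [mtens] prescribes both actions. The right one follows from the left one by
    multiplying with elementary tensors, and density gives uniqueness. *)
Lemma mtensE (A C : cstarAlgType R) (m : mult A) (n : mult C) (X : mult (tens A C)) :
  (forall a c, lmult X (tmk (tens A C) a c) = tmk (tens A C) (lmult m a) (lmult n c)) ->
  mtens tens m n = X.
Proof.
move=> h; apply: the_eq => [a c|Y Yh].
  split=> //; apply: amul_injr; apply: (tensor_ind (T := tens A C)) => [|b d].
    by apply: csubm_eq; exact: blin_mull.
  by rewrite -mult_centralizer h !tmkM !mult_centralizer.
apply: (lmult_inj_dense (tmk_dense (tens A C))) => _ [a [c ->]].
by rewrite h; have [->] := Yh a c.
Qed.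

(** The multiplier is taken of the form [phi d] because a homomorphism supplies the bound [|d|]
    through [tmk_norml]. *)
Lemma mtens_left (A C D : cstarAlgType R) (phi : D -> mult A) d : star_hom phi ->
  (forall a c, lmult (mtens tens (phi d) (mult1 C)) (tmk (tens A C) a c) =
     tmk (tens A C) (lmult (phi d) a) c) /\
  (forall x, `|lmult (mtens tens (phi d) (mult1 C)) x| <= `|d| * `|x|).
Proof.
move=> hphi; pose T := tens A C.
pose f d (q : A * C) := tmk T (lmult (phi d) q.1) q.2.
have fM y l : `|comb (f y) l| <= `|y| * `|comb (fun q => tmk T q.1 q.2) l|.
  have := tmk_norml tens T [seq (p.1 *: p.2.1, p.2.2) | p <- l] y hphi.
  rewrite -comb_tmk big_map; congr (`|_| <= _).
  by apply: eq_bigr => p _ /=; rewrite lmultZ (linZ (tmk_linl T _)).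
have [//|l|l|q q'|X [XE _ XM]] := @mult_of_gen R T _ _ (@tensor_near R _ _ T) (f d) (f (star d)) `|d|.
- exact: fM.
- by rewrite -(norm_star d); exact: fM.
- by rewrite /f !star_tmk !tmkM mult_adj hom_star // starK.
rewrite (mtensE (X := X)); first by split=> // a c; exact: (XE (a, c)).
by move=> a c; exact: (XE (a, c)).
Qed.

Lemma mtens_right (A C D : cstarAlgType R) (phi : D -> mult C) d : star_hom phi ->
  (forall a c, lmult (mtens tens (mult1 A) (phi d)) (tmk (tens A C) a c) =
     tmk (tens A C) a (lmult (phi d) c)) /\
  (forall x, `|lmult (mtens tens (mult1 A) (phi d)) x| <= `|d| * `|x|).
Proof.
move=> hphi; pose T := tens A C.
pose f d (q : A * C) := tmk T q.1 (lmult (phi d) q.2).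
have fM y l : `|comb (f y) l| <= `|y| * `|comb (fun q => tmk T q.1 q.2) l|.
  have := tmk_normr tens T [seq (p.1 *: p.2.1, p.2.2) | p <- l] y hphi.
  rewrite -comb_tmk big_map; congr (`|_| <= _).
  by apply: eq_bigr => p _ /=; rewrite (linZ (tmk_linl T _)).
have [//|l|l|q q'|X [XE _ XM]] := @mult_of_gen R T _ _ (@tensor_near R _ _ T) (f d) (f (star d)) `|d|.
- exact: fM.
- by rewrite -(norm_star d); exact: fM.
- by rewrite /f !star_tmk !tmkM mult_adj hom_star // starK.
rewrite (mtensE (X := X)); first by split=> // a c; exact: (XE (a, c)).
by move=> a c; exact: (XE (a, c)).
Qed.

Section Htens.
Variables (A C B E : cstarAlgType R) (pi : A -> mult B) (rho : C -> mult E).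
Hypotheses (hpi : star_hom pi) (hrho : star_hom rho).

Lemma htensP : star_hom (htens (tens := tens) pi rho) /\
  forall a c, htens (tens := tens) pi rho (tmk (tens A C) a c) = mtens tens (pi a) (rho c).
Proof.
have [Phi [hPhi PhiE]] := tensor_hom_exists tens (tens A C) (tens B E) hpi hrho.
apply: (@the_spec (tens A C -> mult (tens B E)) _ (fun Phi => star_hom Phi /\
  forall a c, Phi (tmk (tens A C) a c) = mtens tens (pi a) (rho c))).
by exists Phi; split=> // a c; apply/esym/mtensE.
Qed.

Lemma htens_hom : star_hom (htens (tens := tens) pi rho). Proof. by case: htensP. Qed.

Lemma htens_tmk a c b e :
  lmult (htens (tens := tens) pi rho (tmk (tens A C) a c)) (tmk (tens B E) b e) =
  tmk (tens B E) (lmult (pi a) b) (lmult (rho c) e).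
Proof.
have [_ ->] := htensP.
have [Phi [hPhi PhiE]] := tensor_hom_exists tens (tens A C) (tens B E) hpi hrho.
by rewrite (mtensE (X := Phi (tmk _ a c))).
Qed.

End Htens.
End MultiplierTensor.

Section UnitaryExtension.
Variables (R : realType) (tens : forall A B : cstarAlgType R, min_tensor A B).
Local Notation K := R[i].
Variables (A B : cstarAlgType R) (phi : A -> mult B) (m : mult A).
Hypotheses (hphi : star_hom phi) (nphi : nondegenerate phi).
Hypotheses (mm : star m ** m = mult1 A) (mm' : m ** star m = mult1 A).

Let g (p : A * B) := lmult (phi p.1) p.2.

Lemma nondegenerate_near x (e : K) : 0 < e ->
  exists l, `|x - comb (fun p : A * B => lmult (phi p.1) p.2) l| < e.
Proof.
apply: (closed_span_comb (S := [set x | exists a b, x = lmult (phi a) b])); last exact: nphi.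
by move=> _ [a [b ->]]; exists (a, b).
Qed.

Let iso (n : mult A) : star n ** n = mult1 A -> forall l,
  `|comb (fun p => lmult (phi (lmult n p.1)) p.2) l| <= 1 * `|comb g l|.
Proof.
move=> nn l; rewrite mul1r le_eqVlt; apply/orP; left.
rewrite -(@eqrXn2 _ 2) // -!norm_starM /comb !star_sum !amul_suml.
apply/eqP; congr `|_|; apply: eq_bigr => p _; rewrite !amul_sumr; apply: eq_bigr => q _.
rewrite /g !starZ !amulZl !amulZr; congr (_ *: (_ *: _)).
rewrite !mult_adj -!hom_star // -![lmult (phi _) (lmult _ _)]/(lmult (phi _ ** phi _) _) -!homM //.
by rewrite mult_adj -[lmult (star n) _]/(lmult (star n ** n) _) nn.
Qed.

(** Unitarity makes the map from [phi a b] to [phi (m a) b] preserve all products [star x ** y] of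
    generators, so it is isometric on finite sums. The same for [star m] gives the adjoint. *)
Lemma mext_unitaryP : [/\ forall a b, lmult (mext phi m) (lmult (phi a) b) = lmult (phi (lmult m a)) b,
  star (mext phi m) ** mext phi m = mult1 B & mext phi m ** star (mext phi m) = mult1 B].
Proof.
have mmm : star (star m) ** star m = mult1 A by rewrite starK.
have [//|||p q|X [XE X'E _]] := @mult_of_gen R B _ g nondegenerate_near
  (fun p => lmult (phi (lmult m p.1)) p.2) (fun p => lmult (phi (lmult (star m) p.1)) p.2) 1.
- exact: iso.
- exact: iso.
- rewrite /g !mult_adj -!hom_star // -![lmult (phi _) (lmult _ _)]/(lmult (phi _ ** phi _) _) -!homM //.
  by rewrite mult_adj starK.
have EX : mext phi m = X.
  apply: the_eq => [a|Y Yh].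
    by apply: lmult_inj => b; exact: (XE (a, b)).
  apply: (lmult_inj_dense nphi) => _ [a [b ->]].
  by rewrite -[LHS]/(lmult (Y ** phi a) b) Yh -(XE (a, b)).
rewrite EX; split=> [a b||]; first exact: (XE (a, b)).
- apply: (lmult_inj_dense nphi) => _ [a [b ->]].
  rewrite -[LHS]/(lmult (star X) (lmult X (g (a, b)))) XE.
  transitivity (lmult (phi (lmult (star m ** m) a)) b); last by rewrite mm.
  exact: (X'E (lmult m a, b)).
- apply: (lmult_inj_dense nphi) => _ [a [b ->]].
  rewrite -[LHS]/(lmult X (lmult (star X) (g (a, b)))) X'E.
  transitivity (lmult (phi (lmult (m ** star m) a)) b); last by rewrite mm'.
  exact: (XE (lmult (star m) a, b)).
Qed.

End UnitaryExtension.

Section AlgebraHom.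
Variables (R : realType) (tens : forall A B : cstarAlgType R, min_tensor A B).
Variables (A B : cstarAlgType R) (f : A -> B).
Hypothesis hf : star_hom f.

Lemma to_mult_comp_hom : star_hom (fun x => to_mult (f x)).
Proof.
have [l m s] := hf; have [l' m' s'] := to_mult_hom B.
by split=> [k x y|x y|x]; rewrite ?l ?m ?s ?l' ?m' ?s'.
Qed.

Lemma alg_hom_blin : blin f.
Proof.
split; first by case: hf.
exists 1 => // x; rewrite mul1r.
have [->|f0] := eqVneq (f x) 0; first by rewrite normr0.
have nf : 0 < `|f x| by rewrite normr_gt0.
rewrite -(ler_pM2r nf) -expr2 -norm_star2 -(norm_star (f x)).
exact: (hom_contract tens to_mult_comp_hom).
Qed.

End AlgebraHom.

(** * C*-subalgebras *)

Record cstar_sub (R : realType) (B : cstarAlgType R) := CstarSub {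
  csub_set :> B -> Prop ;
  csub_csubm : csubm csub_set ;
  csub_mul : forall x y, csub_set x -> csub_set y -> csub_set (x ** y) ;
  csub_star : forall x, csub_set x -> csub_set (star x) }.

Section CstarSubalgebra.
Variables (R : realType) (B : cstarAlgType R) (S : cstar_sub B).
Local Notation K := R[i].

Definition csub_pred : {pred B} := fun x => `[< S x >].

Lemma csub_submod : submod_closed csub_pred.
Proof.
have [S0 SD _] := csub_csubm S; split; first exact/asboolP.
by move=> k x y /asboolP Sx /asboolP Sy; apply/asboolP; apply: SD.
Qed.

HB.instance Definition _ := GRing.isSubmodClosed.Build K B csub_pred csub_submod.

Record csub_alg := CsubAlg { csub_val : B ; csub_valP : csub_val \in csub_pred }.

HB.instance Definition _ := [isSub for csub_val].
HB.instance Definition _ := [Choice of csub_alg by <:].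
HB.instance Definition _ := [SubChoice_isSubLmodule of csub_alg by <:].

Implicit Types x y z : csub_alg.

Lemma csub_val_inj : injective csub_val. Proof. exact: val_inj. Qed.

Lemma csub_valS x : S (csub_val x). Proof. exact/asboolP/csub_valP. Qed.

Definition csub_mk (v : B) (Sv : S v) : csub_alg := @CsubAlg v (asboolT Sv).

Definition csub_norm x : K := `|csub_val x|.

Lemma csub_normD x y : csub_norm (x + y) <= csub_norm x + csub_norm y.
Proof. exact: ler_normD. Qed.

Lemma csub_normZ (k : K) x : csub_norm (k *: x) = `|k| * csub_norm x.
Proof. exact: normrZ. Qed.

Lemma csub_norm0_eq0 x : csub_norm x = 0 -> x = 0.
Proof. by move=> /normr0_eq0 x0; apply: csub_val_inj; rewrite x0. Qed.

HB.instance Definition _ :=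
  Lmodule_isNormed.Build K csub_alg csub_normD csub_normZ csub_norm0_eq0.

Lemma csub_cauchy_cvg (F : set_system csub_alg) : ProperFilter F -> cauchy F -> cvg F.
Proof.
move=> FF /cauchyP Fc.
have Bc : cauchy (csub_val @ F).
  apply/cauchyP => e e0; have [x Fx] := Fc e e0; exists (csub_val x).
  suff : F (csub_val @^-1` ball (csub_val x) e) by [].
  by move: Fx; rewrite -!ball_normE; apply: filterS.
move/cauchy_cvg : Bc => /cvg_ex[l Fl].
have Sl : S l.
  have [_ _ Sc] := csub_csubm S; apply: Sc => e e0.
  move/cvgrPdist_lt : Fl => /(_ e e0) Fe.
  have [x xe] := filter_ex Fe; exists (csub_val x) => //; exact: csub_valS.
apply/cvg_ex; exists (csub_mk Sl); apply/cvgrPdist_lt => e e0.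
by move/cvgrPdist_lt : Fl => /(_ e e0).
Qed.

HB.instance Definition _ := Uniform_isComplete.Build csub_alg csub_cauchy_cvg.

Definition csub_amul x y : csub_alg := csub_mk (csub_mul (csub_valS x) (csub_valS y)).
Definition csub_astar x : csub_alg := csub_mk (csub_star (csub_valS x)).

Lemma csub_mulA : associative csub_amul.
Proof. by move=> x y z; apply: csub_val_inj; rewrite /= amulA. Qed.
Lemma csub_mulDl : left_distributive csub_amul +%R.
Proof. by move=> x y z; apply: csub_val_inj; rewrite /= amulDl. Qed.
Lemma csub_mulDr : right_distributive csub_amul +%R.
Proof. by move=> x y z; apply: csub_val_inj; rewrite /= amulDr. Qed.
Lemma csub_mulZl (k : K) x y : csub_amul (k *: x) y = k *: csub_amul x y.
Proof. by apply: csub_val_inj; rewrite /= amulZl. Qed.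
Lemma csub_mulZr (k : K) x y : csub_amul x (k *: y) = k *: csub_amul x y.
Proof. by apply: csub_val_inj; rewrite /= amulZr. Qed.
Lemma csub_starK : involutive csub_astar.
Proof. by move=> x; apply: csub_val_inj; rewrite /= starK. Qed.
Lemma csub_starD x y : csub_astar (x + y) = csub_astar x + csub_astar y.
Proof. by apply: csub_val_inj; rewrite /= starD. Qed.
Lemma csub_starZ (k : K) x : csub_astar (k *: x) = (k^*)%R *: csub_astar x.
Proof. by apply: csub_val_inj; rewrite /= starZ. Qed.
Lemma csub_starM x y : csub_astar (csub_amul x y) = csub_amul (csub_astar y) (csub_astar x).
Proof. by apply: csub_val_inj; rewrite /= starM. Qed.

HB.instance Definition _ := isStarAlgebra.Build R csub_alg csub_mulA csub_mulDl
  csub_mulDr csub_mulZl csub_mulZr csub_starK csub_starD csub_starZ csub_starM.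

Lemma csub_norm_mul x y : `|x ** y| <= `|x| * `|y|.
Proof. exact: norm_amul. Qed.
Lemma csub_norm_starM x : `|star x ** x| = `|x| ^+ 2.
Proof. exact: norm_starM. Qed.

HB.instance Definition _ := isCstarAlgebra.Build R csub_alg csub_norm_mul csub_norm_starM.

End CstarSubalgebra.

(** * Continuous functions on a locally compact group *)

Section CompactSets.
Variable T : topologicalType.

(** The sets whose complement in [K] satisfies [Q] form a filter. Were [Q K] false, the filter would
    be proper and cluster at a point of [K], against the neighbourhood with property [Q] at that
    point. *)
Lemma compact_ind (K : set T) (Q : set T -> Prop) :
  Q set0 -> (forall A B, A `<=` B -> Q B -> Q A) ->
  (forall A B, Q A -> Q B -> Q (A `|` B)) -> compact K ->
  (forall x, K x -> exists2 U, nbhs x U & Q U) -> Q K.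
Proof.
move=> Q0 Qs QU cK loc; apply: contrapT => nQK.
pose F : set_system T := [set S | Q (K `\` S)].
have FF : ProperFilter F.
  split; first by rewrite /F /= setD0.
  split; rewrite /F /=.
  - by rewrite setDT.
  - move=> A B QA QB; apply: Qs (QU _ _ QA QB) => y [Ky nAB].
    have [Ay|nAy] := pselect (A y); last by left.
    by right; split=> // By; apply: nAB.
  - by move=> A B AB; apply: Qs; exact: setDS.
have [|x [Kx xF]] := cK F FF; first by rewrite /F /= setDv.
have [U xU QU'] := loc x Kx.
have [|y [nUy Uy]] := xF (~` U) U _ xU; last exact: nUy.
by apply: Qs QU' => y [_ /contrapT].
Qed.

End CompactSets.

Section BumpFunctions.
Variables (R : realType) (G : topGroupType).
Hypotheses (hG : hausdorff_space G) (lG : locally_compact [set: G]).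
Local Notation K := R[i].

Lemma compact_nbhs (x : G) : exists2 C, nbhs x C & compact C.
Proof.
have [C xC [cC _]] := lG Logic.I (x := x).
exists C => //; have : nbhs x [set t | setT t -> C t] by exact: xC.
by apply: filterS => t; exact.
Qed.

Lemma bump_function (x : G) (U : set G) : nbhs x U ->
  exists f : G -> R, [/\ continuous f, forall s, 0 <= f s <= 1, f x = 1
    & exists2 C, compact C & forall s, f s != 0 -> C s /\ U s].
Proof.
move=> xU; have [C xC cC] := compact_nbhs x.
pose B := ~` interior (U `&` C).
have cB : closed B by rewrite closedC; exact: open_interior.
have nBx : ~ B x.
  by move=> h; apply: h; exact: filterI.
have sep := @locally_compact_completely_regular G R lG hG x B cB nBx.
have [f [fc f01 fx fB]] := (@uniform_separatorP G R [set x] B).1 sep.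
have f01' s : 0 <= f s <= 1.
  by have := f01 (f s); rewrite /= in_itv /=; apply; exists s.
exists (fun s => 1 - f s); split.
- by move=> s; apply: cvgB; [exact: cvg_cst|exact: fc].
- by move=> s; have /andP[f0 f1] := f01' s; rewrite subr_ge0 f1 lerBlDr lerDl.
- by rewrite (fx (f x)) ?subr0 //; exists x.
exists C => // s fs; apply: contrapT => nUC.
have : B s by move=> h; apply: nUC; have [] := interior_subset h.
by move=> Bs; move/eqP: fs; rewrite (fB (f s)) ?subrr //; exists s.
Qed.

Lemma realC_continuous (f : G -> R) : continuous f -> continuous (fun s => (f s)%:C : K^o).
Proof.
move=> fc s; apply/cvgrPdist_lt => e /gt0_realc[-> e0].
move/cvgrPdist_lt : (fc s) => /(_ _ e0); apply: filterS => t /=.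
by rewrite -rmorphB normcE_real /= expr0n /= addr0 sqrtr_sqr ltcR.
Qed.

Lemma c0_of_real (f : G -> R) (C : set G) : continuous f -> compact C ->
  (forall s, f s != 0 -> C s) -> (fun s => (f s)%:C) \in @c0_pred R G.
Proof.
move=> fc cC fC; apply/asboolP; split; first exact: realC_continuous.
move=> e e0; exists C => // s nC; have [->|/fC//] := eqVneq (f s) 0.
by rewrite normr0.
Qed.

Lemma c0_mul_bounded (f : c0 R G) (k : G -> K) (M : K) :
  continuous (k : G -> K^o) -> (forall s, `|k s| <= M) ->
  exists h : c0 R G, forall s, h s = f s * k s.
Proof.
move=> kc kM; have M0 : 0 <= M by apply: le_trans (kM 1%g).
suff P : (fun s => f s * k s) \in @c0_pred R G by exists (C0 P).
apply/asboolP; split.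
  by move=> s; apply: (@cvgM K); [exact: c0_continuous|exact: kc].
move=> e e0; have M1 : 0 < M + 1 by rewrite ltr_wpDl.
have [|C cC Ce] := @c0_vanish R G f (e / (M + 1)); first by rewrite divr_gt0.
exists C => // s /Ce; rewrite ltr_pdivlMr // => h; rewrite normrM.
apply: le_lt_trans h; rewrite ler_wpM2l //; apply: le_trans (kM s) _; by rewrite lerDl.
Qed.

Lemma blin_eval (s : G) : @blin R (c0 R G : cstarAlgType R) K^o (fun f : c0 R G => f s).
Proof. by split=> //; exists 1 => // f; rewrite mul1r; exact: c0_normcP. Qed.

Lemma c0_norm_ptwise (f : c0 R G) (M : K) : (forall s, `|f s| <= M) -> `|f| <= M.
Proof. exact: c0_norm_le. Qed.

Lemma c0_separate (s : G) : exists f : c0 R G, f s = 1.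
Proof.
have [f [fc _ fs [C cC fC]]] := bump_function (@filterT _ (nbhs s) _).
by exists (C0 (c0_of_real fc cC (fun t ft => (fC t ft).1))); rewrite /= fs.
Qed.

End BumpFunctions.

(** * The canonical unitary [wG] *)

Section CanonicalUnitary.
Variables (R : realType) (tens : forall A B : cstarAlgType R, min_tensor A B).
Variables (G : topGroupType) (CG : group_cstar R G).
Hypotheses (hG : hausdorff_space G) (lG : locally_compact [set: G]).
Local Notation K := R[i].
Local Notation T := (tens (c0 R G) CG).
Local Notation ev := (ev_tens (tens := tens) (CG := CG)).

Lemma ev_tensP s : star_hom (ev s) /\
  forall f c, ev s (tmk T f c) = f s *: c.
Proof.
apply: (@the_spec (T -> CG) _ (fun E => star_hom E /\ forall f c, E (tmk T f c) = f s *: c)).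
pose E : T -> CG := slice (T := flip_tensor T) (fun f : c0 R G => f s : K^o).
have bE : blin E by exact: (slice_blin (flip_tensor T) (blin_eval R s)).
have EE f c : E (tmk T f c) = f s *: c by exact: (slice_tmk (flip_tensor T) c f (blin_eval R s)).
exists E; split=> //; split; first exact: blin_lin.
  move=> x y; move: x; apply: (tensor_ind (T := T)) => [|f c].
    apply: csubm_eq; first by apply: (blin_comp bE); exact: blin_mulr.
    by apply: (blin_comp (blin_mulr _)).
  move: y; apply: (tensor_ind (T := T)) => [|g d]; last first.
    by rewrite tmkM !EE amulZl amulZr scalerA.
  apply: csubm_eq; first by apply: (blin_comp bE); exact: blin_mull.
  by apply: (blin_comp (blin_mull _)).
move=> x; rewrite -[LHS]starK; congr star; move: x.
apply: (tensor_ind (T := T)) => [|f c].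
  apply: csubm_eq => //; exact: blin_star.
by rewrite star_tmk !EE starZ !starK conjCE conjcK.
Qed.

Lemma ev_hom s : star_hom (ev s). Proof. by case: (ev_tensP s). Qed.
Lemma ev_tmk s f c : ev s (tmk T f c) = f s *: c. Proof. by case: (ev_tensP s). Qed.
Lemma ev_blin s : blin (ev s). Proof. exact: (alg_hom_blin tens (ev_hom s)). Qed.

Lemma ev_slice (psi : CG -> K^o) s (x : T) :
  blin psi -> (slice psi x : c0 R G) s = psi (ev s x).
Proof.
move=> bp; move: x; apply: tensor_ind => [|f c].
  apply: (@csubm_eq _ _ (K^o)).
    by apply: (blin_comp (blin_eval R s)); exact: slice_blin.
  by apply: (blin_comp bp); exact: ev_blin.
by rewrite slice_tmk // ev_tmk (linZ (blin_lin bp)); exact: mulrC.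
Qed.

Lemma ev_inj x y : (forall s, ev s x = ev s y) -> x = y.
Proof.
move=> h; apply/eqP; rewrite -subr_eq0; apply/eqP; apply: slice_sep => psi bp.
apply: c0_eq => s; rewrite ev_slice // (linB (blin_lin (ev_blin s))) h subrr.
exact: (lin0 (blin_lin bp)).
Qed.

(** The evaluations, composed with a faithful representation of [CG], form a jointly faithful family
    indexed by [G], to which [rep_isometry] applies. *)
Lemma ev_norm x (r : K) : 0 <= r -> (forall s, `|ev s x| <= r) -> `|x| <= r.
Proof.
move=> r0 h; have [H [sg [rs si]]] := exists_faithful_rep tens CG.
apply: (@rep_isometry R T G (fun=> H) (fun s x k => sg (ev s x) k)) => //.
- move=> s; have [El Em Es] := ev_hom s; split.
  + move=> a; split; first exact: (rep_lin rs).
    by case: rs => + _ _ _ => /(_ (ev s a))[].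
  + by move=> k a b h'; rewrite El (rep_linl rs).
  + by move=> a b h'; rewrite Em (repM rs).
  + by move=> a h1 h2; rewrite Es (rep_adj rs).
- move=> a a0; apply: ev_inj => s; rewrite (lin0 (blin_lin (ev_blin s))).
  by apply: si; apply/funext => k; rewrite a0 (lin0 (rep_linl rs k)).
- move=> s k; apply: le_trans (rep_contract rs _ _) _; by rewrite ler_wpM2r.
Qed.

Section PointwiseMultiplier.
Variable u : G -> mult CG.
Hypotheses (u_iso : forall s c, `|lmult (u s) c| = `|c|)
  (u_cont : forall c, continuous (fun s => lmult (u s) c : CG)).

(* A partition of unity subordinate to the sets where [u s c] is almost
   constant. *)
Lemma pointwise_near (f : c0 R G) (c : CG) (e : K) : 0 < e ->
  (* Both final errors, [|f| eta (|c| + 1)] on the compact set [C] and [eta (|c| + 1)] outside it,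
     will be at most [eta * M]. *)
  exists x : T, forall s, `|f s *: lmult (u s) c - ev s x| <= e.
Proof.
move=> e0; pose M : K := (`|c| + 1) * (`|f| + 1).
have M0 : 0 < M by rewrite mulr_gt0 // ltr_wpDl.
pose eta : K := e / (M + e).
have eta0 : 0 < eta by rewrite divr_gt0 // addr_gt0.
have eta1 : eta <= 1 by rewrite ler_pdivrMr ?addr_gt0 // mul1r lerDr ltW.
have etaM : eta * M <= e.
  by rewrite mulrAC ler_pdivrMr ?addr_gt0 // ler_wpM2l ?lerDl // ltW.
have [C cC Ce] := c0_vanish f eta0.
have [N hN] := exists_invS_lt eta0.
(* The functions sum to at least [N] on [C] instead of to [1]. Dividing by [1 + S], which never
   vanishes, then leaves a defect of at most [1 / (N + 1)], below [eta]. *)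
pose Q (S : set G) := exists l : seq (c0 R G * CG),
  (forall p, List.In p l -> forall s, 0 <= p.1 s /\ (p.1 s != 0 -> `|lmult (u s) c - p.2| <= eta)) /\
  (forall s, S s -> N%:R <= \sum_(p <- l) p.1 s).
have Ige0 (l : seq (c0 R G * CG)) s : (forall p, List.In p l -> 0 <= p.1 s) -> 0 <= \sum_(p <- l) p.1 s.
  by move=> h; have := ler_sum_In h; rewrite big1.
have [l [l1 l2]] : Q C.
  apply: (@compact_ind G C Q) => [|A B AB [l [l1 l2]]|A B [l [l1 l2]] [l' [l1' l2']]| |s Cs].
  - by exists [::]; split.
  - by exists l; split=> // s /AB; exact: l2.
  - exists (l ++ l'); split.
      by move=> p pl; case: (List.in_app_or _ _ _ pl); [exact: l1|exact: l1'].
    move=> s [As|Bs]; rewrite big_cat /=.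
      apply: le_trans (l2 s As) _; rewrite lerDl; apply: Ige0 => p pl; by case: (l1' p pl s).
    apply: le_trans (l2' s Bs) _; rewrite lerDr; apply: Ige0 => p pl; by case: (l1 p pl s).
  - exact: cC.
  - move/cvgrPdist_lt : (@u_cont c s) => /(_ _ eta0) us.
    have [chi [chic chi01 chis [D cD chiD]]] := bump_function R hG lG us.
    pose b := N%:R *: (2 *: C0 (c0_of_real chic cD (fun t ft => (chiD t ft).1))).
    exists [set t | 2^-1 < chi t].
      move/cvgrPdist_lt : (@chic s) => /(_ 2^-1); rewrite invr_gt0 => /(_ ltac:(done)).
      apply: filterS => t /=; rewrite chis ltr_norml => /andP[_ h].
      by move: h; lra.
    exists [:: (b, lmult (u s) c)]; split.
      move=> p /= [<-|//] t; rewrite /b /=; have /andP[c0 _] := chi01 t.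
      split; first by rewrite !mulr_ge0 // lecR.
      rewrite !mulf_eq0 => /norP[_ /norP[_ h]].
      have /chiD[_] : chi t != 0 by apply: contraNN h => /eqP ->.
      by rewrite /= distrC => /ltW.
    move=> t /= ct; rewrite big_seq1 /b /= -[X in X <= _]mulr1 ler_wpM2l //.
    rewrite -[leRHS]/(2 * (chi t)%:C) (_ : 2 * _ = (2 * chi t)%:C); last by rewrite rmorphM rmorph_nat.
    by rewrite -[1]/(1%:C) lecR; lra.
pose S s : K := \sum_(p <- l) p.1 s.
have S0 s : 0 <= S s by apply: Ige0 => p pl; case: (l1 p pl s).
have S1 s : 0 < 1 + S s by rewrite ltr_wpDr.
have Sc : continuous (S : G -> K^o).
  move=> s; rewrite /S; elim: (l) => [|p l' ih].
    rewrite [X in continuous_at _ X](_ : _ = fun=> 0); last by apply/funext => t; rewrite big_nil.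
    exact: cvg_cst.
  rewrite [X in continuous_at _ X](_ : _ = fun t => p.1 t + \sum_(p <- l') p.1 t).
    by apply: (@cvgD K K^o) => //; exact: c0_continuous.
  by apply/funext => t; rewrite big_cons.
pose th s : K := (1 + S s)^-1.
have thc : continuous (th : G -> K^o).
  move=> s; apply: (@cvgV K); first by rewrite gt_eqF.
  by apply: (@cvgD K K^o); [exact: cvg_cst|exact: Sc].
have th0 s : 0 <= th s by rewrite invr_ge0 ltW.
have th1 s : `|th s| <= 1 by rewrite ger0_norm // invf_le1 // lerDl.
have /choice[h hE] : forall p : c0 R G * CG, exists h : c0 R G, forall s, h s = (f ** p.1) s * th s.
  by move=> p; exact: (c0_mul_bounded _ thc th1).
exists (\sum_(p <- l) tmk T (h p) p.2) => s.
rewrite (lin_sum (blin_lin (ev_blin s))).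
have -> : f s *: lmult (u s) c - \sum_(p <- l) ev s (tmk T (h p) p.2) =
    f s *: (th s *: lmult (u s) c + \sum_(p <- l) (th s * p.1 s) *: (lmult (u s) c - p.2)).
  have {1}-> : lmult (u s) c = (th s * (1 + S s)) *: lmult (u s) c.
    by rewrite mulVf ?gt_eqF // scale1r.
  rewrite mulrDr mulr1 scalerDl !scalerDr -addrA; congr (_ + _).
  rewrite /S mulr_sumr scaler_suml !scaler_sumr -sumrB; apply: eq_bigr => p _.
  by rewrite ev_tmk hE /=; lmod.
rewrite normrZ.
have in1 : `|\sum_(p <- l) (th s * p.1 s) *: (lmult (u s) c - p.2)| <= eta.
  apply: le_trans (ler_norm_sum _ _ _) _.
  apply: (@le_trans _ _ (\sum_(p <- l) th s * p.1 s * eta)).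
    apply: ler_sum_In => p pl; have [p0 pe] := l1 p pl s.
    have [p00|pn0] := eqVneq (p.1 s) 0.
      by rewrite p00 mulr0 scale0r normr0 mul0r.
    by rewrite normrZ (ger0_norm (mulr_ge0 (th0 s) p0)) ler_wpM2l ?mulr_ge0 // pe.
  rewrite -mulr_suml -mulr_sumr -/(S s) ler_piMl ?(ltW eta0) //.
  by rewrite mulrC ler_pdivrMr // mul1r lerDr.
have in2 : `|th s *: lmult (u s) c + \sum_(p <- l) (th s * p.1 s) *: (lmult (u s) c - p.2)| <= th s * `|c| + eta.
  apply: le_trans (ler_normD _ _) _; rewrite lerD // normrZ u_iso ger0_norm //.
apply: le_trans etaM; have [Cs|nCs] := pselect (C s).
  apply: (@le_trans _ _ (`|f| * (eta * `|c| + eta))).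
    apply: ler_pM => //; first exact: c0_normcP.
    apply: le_trans in2 _; rewrite lerD2r ler_wpM2r //.
    apply: (@le_trans _ _ (N.+1%:R^-1)); last exact/ltW/hN.
    by rewrite lef_pV2 ?posrE // -natr1 addrC lerD2l l2.
  rewrite /M (_ : `|f| * _ = eta * ((`|c| + 1) * `|f|)); last by ring.
  by rewrite ler_wpM2l ?(ltW eta0) // ler_wpM2l ?addr_ge0 // lerDl.
apply: (@le_trans _ _ (eta * (`|c| + 1))).
  apply: ler_pM => //; first exact/ltW/Ce.
  apply: le_trans in2 _; rewrite lerD // ler_piMl //.
  by rewrite -(ger0_norm (th0 s)).
by rewrite ler_wpM2l ?(ltW eta0) // /M ler_peMr ?addr_ge0 // lerDr.
Qed.

Lemma pointwise_exists (f : c0 R G) (c : CG) :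
  exists y : T, forall s, ev s y = f s *: lmult (u s) c.
Proof.
have /choice[x xP] : forall n : nat, exists x : T, forall s, `|f s *: lmult (u s) c - ev s x| <= n.+1%:R^-1.
  by move=> n; apply: pointwise_near; rewrite invr_gt0 ltr0n.
have [|l lx] := @cauchy_seq_lim R T x.
  move=> e e0; have [|N hN] := @exists_invS_lt R (e / 3); first by rewrite divr_gt0.
  exists N => m n Nm Nn; apply: (@le_lt_trans _ _ (e / 3 + e / 3)).
    apply: ev_norm => [|s]; first by rewrite addr_ge0 // divr_ge0 // ltW.
    rewrite (linB (blin_lin (ev_blin s))) -(subrKA (f s *: lmult (u s) c)).
    apply: le_trans (ler_normD _ _) _; rewrite lerD //.
      by rewrite distrC; apply: le_trans (xP _ _) _; exact/ltW/hN.
    by apply: le_trans (xP _ _) _; exact/ltW/hN.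
  rewrite [ltRHS](_ : e = e / 3 + e / 3 + e / 3); last by field.
  by rewrite ltrDl divr_gt0.
exists l => s; apply/eqP; rewrite -subr_eq0 -normr_le0; apply/ler_addgt0Pr => e e0; rewrite add0r.
have e2 : 0 < e / 2 by rewrite divr_gt0.
have [N1 h1] := lx _ e2; have [N2 h2] := exists_invS_lt e2.
pose n := maxn N1 N2; rewrite -(subrKA (ev s (x n))) (splitr e).
apply: le_trans (ler_normD _ _) _; apply: lerD.
  rewrite -(linB (blin_lin (ev_blin s))).
  have ev1 z : `|ev s z| <= `|z|.
    have [->|z0] := eqVneq (ev s z) 0; first by rewrite normr0.
    have nz : 0 < `|ev s z| by rewrite normr_gt0.
    rewrite -(ler_pM2r nz) -expr2 -norm_star2 -(norm_star (ev s z)).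
    exact: (hom_contract tens (to_mult_comp_hom (ev_hom s))).
  by apply: le_trans (ev1 _) _; apply/ltW/h1; exact: leq_maxl.
by rewrite distrC; apply: le_trans (xP n s) _; apply/ltW/h2; exact: leq_maxr.
Qed.

End PointwiseMultiplier.

Lemma gc_mul1 s : star (gc_unit CG s) ** gc_unit CG s = mult1 CG.
Proof. by have [_ h _] := gc_unitary CG; case: (h s). Qed.

Lemma gc_mul1' s : gc_unit CG s ** star (gc_unit CG s) = mult1 CG.
Proof. by have [_ h _] := gc_unitary CG; case: (h s). Qed.

Lemma gc_iso s c : `|lmult (gc_unit CG s) c| = `|c|.
Proof. exact: unitary_norm (gc_mul1 s). Qed.

Lemma gc_iso' s c : `|lmult (star (gc_unit CG s)) c| = `|c|.
Proof. by apply: unitary_norm; rewrite starK gc_mul1'. Qed.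

(** On [f (x) c] the value has to be [s |-> f(s) s c], which lies in [T] by [pointwise_exists]. Each
    [s] acts isometrically on [CG], so [ev_norm] bounds the map on finite sums. *)
Lemma wG_exists : exists w : mult T, forall s x,
  ev s (lmult w x) = lmult (gc_unit CG s) (ev s x).
Proof.
have [_ _ vc] := gc_unitary CG.
have /choice[y yE] : forall q : c0 R G * CG, exists y : T,
    forall s, ev s y = q.1 s *: lmult (gc_unit CG s) q.2.
  move=> q; apply: pointwise_exists; first exact: gc_iso.
  by move=> c; case: (vc c).
have /choice[y' y'E] : forall q : c0 R G * CG, exists y : T,
    forall s, ev s y = q.1 s *: lmult (star (gc_unit CG s)) q.2.
  move=> q; apply: pointwise_exists; first exact: gc_iso'.
  (* Continuity of the adjoint action comes from the right-hand half of strict continuity. *)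
  move=> c s; apply/cvgrPdist_lt => e e0; have [_ h] := vc (star c).
  move/cvgrPdist_lt : (h s) => /(_ e e0); apply: filterS => t /=.
  by rewrite -starB norm_star.
have norm_le (z : c0 R G * CG -> T) (v : G -> mult CG) :
    (forall s c, `|lmult (v s) c| = `|c|) ->
    (forall q s, ev s (z q) = q.1 s *: lmult (v s) q.2) ->
    forall l, `|comb z l| <= 1 * `|comb (fun q => tmk T q.1 q.2) l|.
  move=> v1 zE l; rewrite mul1r; apply: ev_norm => // s.
  have -> : ev s (comb z l) = lmult (v s) (ev s (comb (fun q => tmk T q.1 q.2) l)).
    rewrite !(lin_comb (blin_lin (ev_blin s))) /comb lmult_sum; apply: eq_bigr => q _.
    by rewrite lmultZ /= zE ev_tmk lmultZ.
  rewrite v1; set z0 := comb _ l.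
  have [->|n0] := eqVneq (ev s z0) 0; first by rewrite normr0.
  have nz : 0 < `|ev s z0| by rewrite normr_gt0.
  rewrite -(ler_pM2r nz) -expr2 -norm_star2 -(norm_star (ev s z0)).
  exact: (hom_contract tens (to_mult_comp_hom (ev_hom s))).
have [//|l|l|q q'|X [XE _ XM]] := @mult_of_gen R T _ _ (@tensor_near R _ _ T) y y' 1.
- exact: (norm_le y (fun s => gc_unit CG s) gc_iso yE l).
- exact: (norm_le y' (fun s => star (gc_unit CG s)) gc_iso' y'E l).
- apply: ev_inj => s; have [_ Em Es] := ev_hom s.
  by rewrite !Em !Es yE y'E !ev_tmk !starZ !amulZl !amulZr mult_adj starK.
exists X => s; apply: tensor_ind => [|f c].
  apply: csubm_eq.
    by apply: (blin_comp (ev_blin s)); exact: blin_lmult XM.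
  by apply: (blin_comp _ (ev_blin s)); apply: (@blin_lmult _ _ _ 1) => // c; rewrite gc_iso mul1r.
by rewrite (XE (f, c)) yE ev_tmk lmultZ.
Qed.

Lemma ev_wG s x : ev s (lmult (wG tens CG) x) = lmult (gc_unit CG s) (ev s x).
Proof.
have := @the_spec (mult T) 0 (fun w => forall s x, ev s (lmult w x) = lmult (gc_unit CG s) (ev s x)) wG_exists.
exact.
Qed.

Lemma ev_star_wG s x : ev s (lmult (star (wG tens CG)) x) = lmult (star (gc_unit CG s)) (ev s x).
Proof.
apply: amul_injl => c; have [f fs] := @c0_separate R G hG lG s.
have [_ Em Es] := ev_hom s.
have := congr1 (ev s) (mult_adj (wG tens CG) (tmk T f (star c)) x).
by rewrite !Em !Es ev_wG !ev_tmk fs !scale1r mult_adj !starK.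
Qed.

Lemma wG_unitary : star (wG tens CG) ** wG tens CG = mult1 T /\
  wG tens CG ** star (wG tens CG) = mult1 T.
Proof.
split; apply: lmult_inj => x; apply: ev_inj => s.
  rewrite -[lmult _ x]/(lmult (star (wG tens CG)) (lmult (wG tens CG) x)) ev_star_wG ev_wG.
  by rewrite -[LHS]/(lmult (star (gc_unit CG s) ** gc_unit CG s) _) gc_mul1.
rewrite -[lmult _ x]/(lmult (wG tens CG) (lmult (star (wG tens CG)) x)) ev_wG ev_star_wG.
by rewrite -[LHS]/(lmult (gc_unit CG s ** star (gc_unit CG s)) _) gc_mul1'.
Qed.

End CanonicalUnitary.

(** * Haar functional *)

Lemma sumr_ge0_In (R : numDomainType) (I : Type) (l : seq I) (F : I -> R) :
  (forall i, List.In i l -> 0 <= F i) -> 0 <= \sum_(i <- l) F i.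
Proof. by move=> h; have := ler_sum_In h; rewrite big1. Qed.

Section TopologicalGroup.
Variable G : topGroupType.
Implicit Types (s t u x : G) (V W : set G).
Local Open Scope group_scope.

Lemma mulgl_cvg x : continuous (fun s : G => x * s).
Proof.
move=> s; apply: (cvg_comp (fun s => (x, s)) (fun p : G * G => p.1 * p.2) _ (@mulg_continuous G (x, s))).
by apply: cvg_pair; [exact: cvg_cst|exact: cvg_id].
Qed.

Lemma mulgr_cvg x : continuous (fun s : G => s * x).
Proof.
move=> s; apply: (cvg_comp (fun s => (s, x)) (fun p : G * G => p.1 * p.2) _ (@mulg_continuous G (s, x))).
by apply: cvg_pair; [exact: cvg_id|exact: cvg_cst].
Qed.

Lemma nbhs_mul1 V : nbhs 1 V -> exists2 W, nbhs 1 W & forall s t, W s -> W t -> V (s * t).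
Proof.
move=> V1; have := @mulg_continuous G (1, 1) V; rewrite /= mulg1 => /(_ V1).
move=> [[A B] /= [A1 B1] AB]; exists (A `&` B); first exact: filterI.
by move=> s t [As _] [_ Bt]; exact: (AB (s, t)).
Qed.

Lemma nbhs_inv1 V : nbhs 1 V -> nbhs 1 [set s | V s^-1].
Proof.
by move=> V1; have := @invg_continuous G 1 V; rewrite invg1; apply.
Qed.

Lemma nbhs_translate x V : nbhs 1 V -> nbhs x [set s | V (x^-1 * s)].
Proof. by move=> V1; have := @mulgl_cvg x^-1 x V; rewrite mulVg; apply. Qed.

Lemma nbhs_mull x V : nbhs x V -> nbhs 1 [set s | V (x * s)].
Proof. by move=> V1; have := @mulgl_cvg x 1 V; rewrite mulg1; apply. Qed.

End TopologicalGroup.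

Section CompactSupport.
Variables (R : realType) (G : topGroupType).
Hypotheses (hG : hausdorff_space G) (lG : locally_compact [set: G]).
Implicit Types (f g h phi psi : G -> R) (s t u : G).

Definition compact_support (T : nmodType) (f : G -> T) :=
  exists2 C, compact C & forall s, f s != 0 -> C s.

Definition ccp f := [/\ continuous f, forall s, 0 <= f s & compact_support f].

Lemma compact_support_le (T T' : nmodType) (f : G -> T) (g : G -> T') :
  compact_support g -> (forall s, f s != 0 -> g s != 0) -> compact_support f.
Proof. by move=> [C cC gC] fg; exists C => // s /fg; exact: gC. Qed.

Lemma compact_supportD (T : nmodType) (f g : G -> T) :
  compact_support f -> compact_support g -> compact_support (fun s => f s + g s).
Proof.
move=> [C cC fC] [D cD gD]; exists (C `|` D); first exact: compactU.
move=> s; have [-> |fs _] := eqVneq (f s) 0; last by left; exact: fC.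
by rewrite add0r => gs; right; exact: gD.
Qed.

Lemma ccpD f g : ccp f -> ccp g -> ccp (fun s => f s + g s).
Proof.
move=> [fc f0 fC] [gc g0 gC]; split; last exact: compact_supportD.
  by move=> s; apply: cvgD; [exact: fc|exact: gc].
by move=> s; rewrite addr_ge0.
Qed.

Lemma ccpZ (c : R) f : 0 <= c -> ccp f -> ccp (fun s => c * f s).
Proof.
move=> c0 [fc f0 fC]; split.
- by move=> s; apply: cvgM; [exact: cvg_cst|exact: fc].
- by move=> s; rewrite mulr_ge0.
- by apply: compact_support_le fC _ => s; rewrite mulf_eq0 negb_or => /andP[].
Qed.

Lemma ccp0 : ccp (fun=> 0).
Proof.
split=> //; first by move=> s; exact: cvg_cst.
by exists set0; [exact: compact0|move=> s; rewrite eqxx].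
Qed.

Lemma compact_support_translate (T : nmodType) (f : G -> T) t : compact_support f ->
  compact_support (fun s => f (t^-1 * s)%g).
Proof.
move=> [C cC fC]; exists ((fun s => t * s)%g @` C).
  by apply: continuous_compact => //; apply: continuous_subspaceT; exact: mulgl_cvg.
by move=> s /fC Cs; exists (t^-1 * s)%g => //; rewrite mulVKg.
Qed.

Lemma continuous_translate (T : topologicalType) (f : G -> T) t : continuous f ->
  continuous (fun s => f (t^-1 * s)%g).
Proof. by move=> fc s; apply: continuous_comp; [exact: mulgl_cvg|exact: fc]. Qed.

Lemma ccp_translate f t : ccp f -> ccp (fun s => f (t^-1 * s)%g).
Proof.
move=> [fc f0 fC]; split=> //; first exact: continuous_translate.
exact: compact_support_translate.
Qed.

Lemma ccp_bounded f : ccp f -> exists2 M : R, 0 < M & forall s, f s <= M.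
Proof.
move=> [fc f0 [C cC fC]].
have [M M0 fM] : exists2 M : R, 0 < M & forall s, C s -> f s <= M.
  apply: (@compact_ind G C (fun S => exists2 M : R, 0 < M & forall s, S s -> f s <= M)) => //.
  - by exists 1.
  - by move=> A B AB [M M0 fM]; exists M => // s /AB; exact: fM.
  - move=> A B [M M0 fM] [N N0 fN]; exists (M + N); first exact: addr_gt0.
    move=> s [/fM h|/fN h]; apply: le_trans h _; by rewrite ?lerDl ?lerDr ltW.
  - move=> x _; exists [set s | f s < f x + 1]; last first.
      by exists (f x + 1) => [|s /ltW//]; rewrite ltr_wpDl.
    move/cvgrPdist_lt : (@fc x) => /(_ 1 ltr01); apply: filterS => s /=.
    by rewrite ltr_norml => /andP[h1 h2]; lra.
exists M => // s; have [->|/fC] := eqVneq (f s) 0; first exact: ltW.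
exact: fM.
Qed.

Lemma bump_compact (C : set G) : compact C -> exists2 k, ccp k & forall s, C s -> 1 <= k s.
Proof.
move=> cC; apply: (@compact_ind G C (fun S => exists2 k, ccp k & forall s, S s -> 1 <= k s)) => //.
- by exists (fun=> 0) => //; exact: ccp0.
- by move=> A B AB [k kc k1]; exists k => // s /AB; exact: k1.
- move=> A B [k kc k1] [k' kc' k1']; exists (fun s => k s + k' s); first exact: ccpD.
  have [_ k0 _] := kc; have [_ k0' _] := kc'.
  by move=> s [/k1 h|/k1' h]; have := k0 s; have := k0' s; lra.
- move=> x _; have [f [fc f01 fx [D cD fD]]] := bump_function R hG lG (@filterT _ (nbhs x) _).
  exists [set s | 1 <= 2 * f s].
    move/cvgrPdist_lt : (@fc x) => /(_ 2^-1); rewrite invr_gt0 => /(_ ltac:(done)).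
    by apply: filterS => s /=; rewrite fx ltr_norml => /andP[h1 h2]; lra.
  exists (fun s => 2 * f s) => //; apply: ccpZ => //; split=> //.
    by move=> s; case/andP: (f01 s).
  by exists D => // s /fD[].
Qed.

Lemma uniform_continuity (f : G -> R) : continuous f -> compact_support f ->
  forall e : R, 0 < e -> exists2 V, nbhs (1%g : G) V &
    forall s u, V (u^-1 * s)%g -> `|f s - f u| <= e.
Proof.
move=> fc [C cC fC] e e0.
have [V V1 hV] : exists2 V, nbhs (1%g : G) V & forall u, C u -> forall s, V (u^-1 * s)%g -> `|f s - f u| <= e.
  apply: (@compact_ind G C (fun S => exists2 V, nbhs (1%g : G) V &
    forall u, S u -> forall s, V (u^-1 * s)%g -> `|f s - f u| <= e)) => //.
  - by exists setT => //; exact: filterT.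
  - by move=> A B AB [V V1 hV]; exists V => // u /AB; exact: hV.
  - move=> A B [V V1 hV] [W W1 hW]; exists (V `&` W); first exact: filterI.
    by move=> u [Au|Bu] s [Vs Ws]; [exact: hV|exact: hW].
  - move=> x _; have e2 : 0 < e / 2 by rewrite divr_gt0.
    move/cvgrPdist_lt : (@fc x) => /(_ _ e2) fx.
    have [W W1 hW] := nbhs_mul1 (nbhs_mull fx).
    exists [set u | W (x^-1 * u)%g]; first exact: nbhs_translate.
    exists W => // u Wu s Ws; have W11 := nbhs_singleton W1.
    have := hW _ _ Wu Ws; have := hW _ _ Wu W11; rewrite /= mulg1 -!mulgA !mulVKg.
    rewrite ltr_norml => /andP[a1 a2]; rewrite ltr_norml => /andP[b1 b2].
    by rewrite ler_norml; apply/andP; split; lra.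
(* Symmetrizing [V] covers the case where only [s] lies in [C]: the roles of [s] and [u] are
   exchanged. *)
exists (V `&` [set s | V s^-1%g]); first by apply: filterI => //; exact: nbhs_inv1.
move=> s u [V1' V2]; have [Cu|nCu] := pselect (C u); first exact: hV.
have fu : f u = 0 by apply/eqP; apply: contrapT => /negP/fC.
have [Cs|nCs] := pselect (C s).
  by rewrite distrC; apply: hV => //; move: V2; rewrite /= invgM invgK.
have -> : f s = 0 by apply/eqP; apply: contrapT => /negP/fC.
by rewrite fu subrr normr0 ltW.
Qed.

End CompactSupport.

Section CoveringNumbers.
Variables (R : realType) (G : topGroupType).
Hypotheses (hG : hausdorff_space G) (lG : locally_compact [set: G]).
Implicit Types (f g h phi psi : G -> R) (s t u : G).

Definition covers phi f (l : seq (R * G)) :=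
  (forall p, List.In p l -> 0 <= p.1) /\
  forall s, f s <= \sum_(p <- l) p.1 * phi (p.2^-1 * s)%g.

(* Weil's covering number [(f : phi)]. *)
Definition cov phi f : R :=
  inf [set c | exists2 l, covers phi f l & c = \sum_(p <- l) p.1].

Lemma covers_exist phi f s0 : ccp phi -> 0 < phi s0 -> ccp f -> exists l, covers phi f l.
Proof.
move=> [pc p0 _] ps0 fP; have [M M0 fM] := ccp_bounded fP.
have [_ _ [C cC fC]] := fP.
pose Q (S : set G) := exists l : seq (R * G), (forall p, List.In p l -> 0 <= p.1) /\
  forall s, S s -> M <= \sum_(p <- l) p.1 * phi (p.2^-1 * s)%g.
have sum0 l s : (forall p : R * G, List.In p l -> 0 <= p.1) ->
    0 <= \sum_(p <- l) p.1 * phi (p.2^-1 * s)%g.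
  by move=> h; apply: sumr_ge0_In => p /h h'; rewrite mulr_ge0.
have [l [l0 lM]] : Q C.
  apply: (@compact_ind G C Q) => [|A B AB [l [l0 lM]]|A B [l [l0 lM]] [l' [l0' lM']]| |x Cx].
  - by exists [::].
  - by exists l; split=> // s /AB; exact: lM.
  - exists (l ++ l'); split; first by move=> p pl; case: (List.in_app_or _ _ _ pl); [exact: l0|exact: l0'].
    move=> s [/lM h|/lM' h]; rewrite big_cat /=; apply: le_trans h _.
      by rewrite lerDl; exact: sum0.
    by rewrite lerDr; exact: sum0.
  - exact: cC.
  - exists [set s | phi s0 / 2 < phi (s0 * x^-1 * s)%g].
      have c1 := @continuous_translate G R^o phi (x * s0^-1)%g pc x.
      have e0 : 0 < phi s0 / 2 by rewrite divr_gt0.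
      move/cvgrPdist_lt : c1 => /(_ _ e0); apply: filterS => s /=.
      by rewrite invgM invgK mulgVK ltr_norml => /andP[h1 h2]; lra.
    (* Near [x] the translate of [phi] by [x s0^-1] exceeds [phi s0 / 2], so this coefficient raises
       it to at least [M]. *)
    exists [:: (2 * M / phi s0, (x * s0^-1)%g)]; split.
      by move=> p /= [<-|//] /=; rewrite divr_ge0 ?mulr_ge0 ?ltW.
    move=> s /= h; rewrite big_seq1 /= invgM invgK.
    rewrite [leRHS](_ : _ = M * (phi (s0 / x * s)%g * 2 / phi s0)); last by ring.
    by rewrite ler_pMr // ler_pdivlMr //; lra.
exists l; split=> // s; have [->|/fC Cs] := eqVneq (f s) 0; first exact: sum0.
by apply: le_trans (fM s) (lM s Cs).
Qed.

Section Fixed.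
Variables (phi : G -> R) (s0 : G).
Hypotheses (pP : ccp phi) (ps0 : 0 < phi s0).

Let covset f := [set c | exists2 l, covers phi f l & c = \sum_(p <- l) p.1].

Let sum_ge0 (l : seq (R * G)) : (forall p, List.In p l -> 0 <= p.1) -> 0 <= \sum_(p <- l) p.1.
Proof. exact: sumr_ge0_In. Qed.

Lemma cov_has_inf f : ccp f -> has_inf (covset f).
Proof.
move=> fP; split.
  by have [l lP] := covers_exist pP ps0 fP; exists (\sum_(p <- l) p.1); exists l.
by exists 0 => _ [l [l0 _] ->]; exact: sum_ge0.
Qed.

Lemma cov_le f l : ccp f -> covers phi f l -> cov phi f <= \sum_(p <- l) p.1.
Proof.
by move=> fP lP; apply: ge_inf; [case: (cov_has_inf fP)|exists l].
Qed.

Lemma cov_ge f c : ccp f -> (forall l, covers phi f l -> c <= \sum_(p <- l) p.1) -> c <= cov phi f.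
Proof.
move=> fP h; apply: lb_le_inf; first by case: (cov_has_inf fP).
by move=> _ [l lP ->]; exact: h.
Qed.

Lemma cov_near f e : ccp f -> 0 < e -> exists2 l, covers phi f l & \sum_(p <- l) p.1 < cov phi f + e.
Proof.
move=> fP e0; have [_ [l lP ->] h] := inf_adherent e0 (cov_has_inf fP).
by exists l.
Qed.

Lemma cov_ge0 f : ccp f -> 0 <= cov phi f.
Proof. by move=> fP; apply: cov_ge => // l [l0 _]; exact: sum_ge0. Qed.

Lemma cov_mono f g : ccp f -> ccp g -> (forall s, f s <= g s) -> cov phi f <= cov phi g.
Proof.
move=> fP gP fg; apply: cov_ge => // l [l0 lg]; apply: cov_le => //; split=> // s.
exact: le_trans (fg s) (lg s).
Qed.

Lemma covD f g : ccp f -> ccp g -> cov phi (fun s => f s + g s) <= cov phi f + cov phi g.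
Proof.
move=> fP gP; apply/ler_addgt0Pr => e e0; have e2 : 0 < e / 2 by rewrite divr_gt0.
have [l [l0 lf] le] := cov_near fP e2; have [l' [l0' lg] le'] := cov_near gP e2.
have : cov phi (fun s => f s + g s) <= \sum_(p <- l ++ l') p.1.
  apply: cov_le; first exact: ccpD.
  split; first by move=> p pl; case: (List.in_app_or _ _ _ pl); [exact: l0|exact: l0'].
  by move=> s; rewrite big_cat lerD.
by rewrite big_cat /=; lra.
Qed.

Lemma covZ_le c f : 0 <= c -> ccp f -> cov phi (fun s => c * f s) <= c * cov phi f.
Proof.
move=> c0 fP; have [->|cn0] := eqVneq c 0.
  rewrite mul0r; apply: le_trans (cov_le (l := [::]) _ _) _; first exact: (ccpZ (c := 0)).
    by split=> // s; rewrite mul0r big_nil.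
  by rewrite big_nil.
have c1 : 0 < c by rewrite lt_neqAle eq_sym cn0.
rewrite -ler_pdivrMl //; apply: cov_ge => // l [l0 lf]; rewrite ler_pdivrMl // mulr_sumr.
have -> : \sum_(p <- l) c * p.1 = \sum_(q <- [seq (c * p.1, p.2) | p <- l]) q.1 by rewrite big_map.
apply: cov_le; first exact: ccpZ.
split; first by move=> p /List.in_map_iff[q [<- ql]]; rewrite mulr_ge0 // l0.
move=> s; rewrite big_map; apply: le_trans (ler_wpM2l c0 (lf s)) _.
by rewrite mulr_sumr le_eqVlt; apply/orP; left; apply/eqP/eq_bigr => p _; rewrite mulrA.
Qed.

Lemma cov_translate_le f t : ccp f -> cov phi (fun s => f (t^-1 * s)%g) <= cov phi f.
Proof.
move=> fP; apply: cov_ge => // l [l0 lf].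
have -> : \sum_(p <- l) p.1 = \sum_(q <- [seq (p.1, (t * p.2)%g) | p <- l]) q.1 by rewrite big_map.
apply: cov_le; first exact: ccp_translate.
split; first by move=> p /List.in_map_iff[q [<- ql]]; exact: (l0 q ql).
move=> s; rewrite big_map; apply: le_trans (lf _) _.
by rewrite le_eqVlt; apply/orP; left; apply/eqP/eq_bigr => p _; rewrite /= invgM mulgA.
Qed.

Lemma cov_gt0 f s1 : ccp f -> 0 < f s1 -> 0 < cov phi f.
Proof.
move=> fP fs1; have [M M0 pM] := ccp_bounded pP.
apply: (@lt_le_trans _ _ (f s1 / M)); first exact: divr_gt0.
apply: cov_ge => // l [l0 lf]; rewrite ler_pdivrMr //; apply: le_trans (lf s1) _.
by rewrite mulr_suml; apply: ler_sum_In => p pl; rewrite ler_wpM2l ?l0.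
Qed.

End Fixed.

(** In a cover of [f] by translates of [psi], each translate is covered in turn by translates of
    [phi]. With [psi = g0] this bounds the normalized covering numbers independently of [phi], as
    the limit requires. *)
Lemma cov_trans phi psi s0 s1 f : ccp phi -> 0 < phi s0 -> ccp psi -> 0 < psi s1 -> ccp f ->
  cov phi f <= cov psi f * cov phi psi.
Proof.
move=> pP ps qP qs fP.
have c0 := cov_gt0 pP ps qP qs.
have step c : 0 <= c -> ccp f -> (exists2 l, covers psi f l & \sum_(p <- l) p.1 <= c) -> cov phi f <= c * cov phi psi.
  move=> c00 _ [l [l0 lf] lc].
  apply: le_trans (_ : (\sum_(p <- l) p.1) * cov phi psi <= _); last by rewrite ler_wpM2r ?(ltW c0).
  pose g (l : seq (R * G)) s := \sum_(p <- l) p.1 * psi (p.2^-1 * s)%g.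
  have gP : ccp (g l) /\ cov phi (g l) <= (\sum_(p <- l) p.1) * cov phi psi.
    elim: l l0 {lf lc} => [|p l ih] l0.
      have -> : g [::] = fun=> 0 * psi 1%g by apply/funext => s; rewrite /g big_nil mul0r.
      split; first by rewrite mul0r; exact: ccp0.
      have -> : (fun _ : G => 0 * psi 1%g) = fun s => 0 * psi s by apply/funext => s; rewrite !mul0r.
      by rewrite big_nil; exact: (covZ_le pP ps).
    have [gl cl] := ih (fun q ql => l0 q (or_intror ql)).
    have p0 := l0 p (or_introl erefl).
    have -> : g (p :: l) = fun s => p.1 * psi (p.2^-1 * s)%g + g l s.
      by apply/funext => s; rewrite /g big_cons.
    have tP : ccp (fun s => psi (p.2^-1 * s)%g) by exact: ccp_translate.
    split; first by apply: ccpD => //; exact: ccpZ.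
    rewrite big_cons mulrDl; apply: le_trans (covD pP ps _ gl) _; first exact: ccpZ.
    rewrite lerD //; apply: le_trans (covZ_le pP ps p0 tP) _.
    by rewrite ler_wpM2l //; exact: (cov_translate_le pP ps).
  have [gP1 gP2] := gP; apply: le_trans gP2; exact: (cov_mono pP ps).
rewrite -ler_pdivrMr //; apply: (cov_ge qP qs) => // l lP; rewrite ler_pdivrMr //.
by apply: step => //; [apply: sumr_ge0_In; case: lP|exists l].
Qed.

End CoveringNumbers.

Lemma ultra_fmap (S T : Type) (f : S -> T) (F : set_system S) :
  UltraFilter F -> UltraFilter (f @ F).
Proof.
move=> UF; have PF := ultra_proper (F := F); split; first exact: fmap_proper_filter.
move=> H PH FH; apply/seteqP; split=> [A HA|]; last exact: FH.
have [//|FA] := in_ultra_setVsetC (f @^-1` A) UF; have HC := FH (~` A) FA.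
exfalso; apply: (@filter_not_empty _ H PH).
by have := @filterI _ H PH A (~` A) HA HC; rewrite setICr.
Qed.

Section HaarFunctional.
Variables (R : realType) (G : topGroupType).
Hypotheses (hG : hausdorff_space G) (lG : locally_compact [set: G]).
Implicit Types (f g h phi psi : G -> R) (s t u : G).

Section Normalized.
Variables (g0 : G -> R) (s0 : G).
Hypotheses (g0P : ccp g0) (gs0 : 0 < g0 s0).

Definition ncov phi f : R := cov phi f / cov phi g0.

Let test phi := ccp phi /\ 0 < phi 1%g.

Lemma ncov_ge0 phi f : test phi -> ccp f -> 0 <= ncov phi f.
Proof. by move=> [pP p1] fP; rewrite divr_ge0 // (cov_ge0 pP p1). Qed.

Lemma ncov_le phi f : test phi -> ccp f -> ncov phi f <= cov g0 f.
Proof.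
move=> [pP p1] fP; rewrite ler_pdivrMr; last exact: (cov_gt0 pP p1 g0P gs0).
exact: (cov_trans pP p1 g0P gs0 fP).
Qed.

(* With [F = f1 + f2 + d k] and [hi = fi / F], multiplying a cover of [F] by the
   almost constant values of [hi] on the supports of the translates of [phi]
   yields covers of [f1] and [f2]. *)
Lemma weil_additivity f1 f2 (e : R) : ccp f1 -> ccp f2 -> 0 < e ->
  exists2 V, nbhs (1%g : G) V & forall phi, test phi -> (forall s, phi s != 0 -> V s) ->
    ncov phi f1 + ncov phi f2 <= ncov phi (fun s => f1 s + f2 s) + e.
Proof.
move=> f1P f2P e0; pose f s := f1 s + f2 s.
have fP : ccp f by exact: ccpD.
have [fc fge [C cC fC]] := fP.
have [k kP k1] := bump_compact R hG lG cC.
have [kc k0 _] := kP.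
have Mf0 : 0 <= cov g0 f by exact: (cov_ge0 g0P gs0).
have Mk0 : 0 <= cov g0 k by exact: (cov_ge0 g0P gs0).
(* The excess of [(1 + 2 d) (ncov phi f + d ncov phi k)] over [ncov phi f] is at most
   [d (2 cov g0 f + 3 cov g0 k)] when [d <= 1]; the summand [e] ensures [d <= 1]. *)
pose d := e / (2 * cov g0 f + 3 * cov g0 k + e).
have den0 : 0 < 2 * cov g0 f + 3 * cov g0 k + e by lra.
have d0 : 0 < d by rewrite divr_gt0.
have d1 : d <= 1 by rewrite ler_pdivrMr // mul1r; lra.
have dE : d * (2 * cov g0 f + 3 * cov g0 k) <= e.
  by rewrite mulrAC ler_pdivrMr // ler_wpM2l ?ltW //; lra.
pose F s := f s + d * k s.
have FP : ccp F by apply: ccpD => //; apply: ccpZ => //; exact: ltW.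
have [Fc F0 _] := FP.
(* Truncating [F] below at [d] gives a continuous denominator that never vanishes. Where [f] is
   nonzero nothing changes, because [k >= 1] there. *)
pose D s := Num.max (F s) d.
have D0 s : 0 < D s by rewrite lt_max d0 orbT.
have FD s : F s <= D s by rewrite le_max lexx.
have DE s : f s != 0 -> D s = F s.
  move=> fs; apply/max_idPl; rewrite /F; have := fge s; have := k1 _ (fC _ fs).
  by rewrite -(ler_pM2l d0) mulr1; lra.
have part fi : ccp fi -> (forall s, fi s <= f s) -> exists2 V, nbhs (1%g : G) V &
    forall phi, test phi -> (forall s, phi s != 0 -> V s) -> forall l, covers phi F l ->
      cov phi fi <= \sum_(p <- l) p.1 * (fi p.2 / D p.2 + d).
  move=> fiP fif; have [fic fi0 fiC] := fiP.
  pose h s := fi s / D s.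
  have hc : continuous h.
    move=> s; apply: cvgM; first exact: fic.
    apply: cvgV; first by rewrite gt_eqF.
    exact: (@continuous_max _ _ F (fun=> d) s (Fc s) (cvg_cst _)).
  have [|V V1 hV] := uniform_continuity hc _ d0.
    by apply: compact_support_le fiC _ => s; rewrite mulf_eq0 negb_or => /andP[].
  exists V => // phi [phiP p1] pV l [l0 lF]; have [_ p0 _] := phiP.
  have -> : \sum_(p <- l) p.1 * (fi p.2 / D p.2 + d) =
      \sum_(q <- [seq (p.1 * (fi p.2 / D p.2 + d), p.2) | p <- l]) q.1 by rewrite big_map.
  have h0 s : 0 <= h s by rewrite divr_ge0 // ltW.
  apply: (cov_le phiP p1) => //; split.
    move=> _ /List.in_map_iff[q [<- ql]] /=; rewrite mulr_ge0 ?(l0 q ql) //.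
    by apply: addr_ge0; [exact: (h0 q.2)|exact: ltW].
  move=> s; rewrite big_map /=.
  have -> : fi s = F s * h s.
    have [fs|fs] := eqVneq (fi s) 0; first by rewrite /h fs mul0r mulr0.
    have : f s != 0 by rewrite gt_eqF // (lt_le_trans _ (fif s)) // lt_neqAle eq_sym fs fi0.
    by move=> /DE <-; rewrite /h mulrC divfK // gt_eqF.
  apply: le_trans (ler_wpM2r (h0 s) (lF s)) _; rewrite mulr_suml.
  apply: ler_sum_In => q ql; rewrite -!mulrA ler_wpM2l ?(l0 q ql) //.
  have [->|nz] := eqVneq (phi (q.2^-1 * s)%g) 0; first by rewrite mul0r mulr0.
  rewrite mulrC ler_wpM2r // -lerBlDl.
  by apply: le_trans (hV s q.2 (pV _ nz)); rewrite ler_norm.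
have [_ f10 _] := f1P; have [_ f20 _] := f2P.
have [|V1 nV1 h1] := part f1 f1P; first by move=> s; rewrite lerDl.
have [|V2 nV2 h2] := part f2 f2P; first by move=> s; rewrite lerDr.
exists (V1 `&` V2); first exact: filterI.
move=> phi pt pV; have [pP p1] := pt.
have gp0 : 0 < cov phi g0 by exact: (cov_gt0 pP p1 g0P gs0).
have b : cov phi f1 + cov phi f2 <= (1 + 2 * d) * cov phi F.
  have c0 : 0 < 1 + 2 * d by lra.
  rewrite -ler_pdivrMl //; apply: (cov_ge pP p1) => // l lP; rewrite ler_pdivrMl //.
  have b1 : cov phi f1 <= \sum_(p <- l) p.1 * (f1 p.2 / D p.2 + d).
    by apply: (h1 _ pt) => // s /pV[].
  have b2 : cov phi f2 <= \sum_(p <- l) p.1 * (f2 p.2 / D p.2 + d).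
    by apply: (h2 _ pt) => // s /pV[].
  apply: le_trans (lerD b1 b2) _.
  rewrite -big_split /= mulr_sumr; apply: ler_sum_In => p pl.
  rewrite -mulrDr mulrC ler_wpM2r //; first by case: lP => h _; exact: h.
  have : (f1 p.2 + f2 p.2) / D p.2 <= 1.
    rewrite ler_pdivrMr // mul1r; apply: le_trans (FD _).
    by rewrite lerDl mulr_ge0 // ltW.
  by rewrite mulrDl; lra.
have bF : cov phi F <= cov phi f + d * cov phi k.
  have dkP : ccp (fun s => d * k s) by apply: ccpZ => //; exact: ltW.
  apply: le_trans (covD pP p1 fP dkP) _; rewrite lerD2l.
  by apply: (covZ_le pP p1) => //; exact: ltW.
have nf : 0 <= ncov phi f <= cov g0 f by rewrite ncov_ge0 ?ncov_le.
have nk : 0 <= ncov phi k <= cov g0 k by rewrite ncov_ge0 ?ncov_le.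
have key : ncov phi f1 + ncov phi f2 <= (1 + 2 * d) * (ncov phi f + d * ncov phi k).
  rewrite /ncov mulrA -!mulrDl mulrA ler_pM2r ?invr_gt0 //.
  by apply: le_trans b _; rewrite ler_wpM2l //; lra.
apply: le_trans key _; rewrite -/f; case/andP: nf => nf0 nf1; case/andP: nk => nk0 nk1.
have a1 : d * ncov phi f <= d * cov g0 f by rewrite ler_pM2l.
have a2 : d * ncov phi k <= d * cov g0 k by rewrite ler_pM2l.
have a3 : d * (d * ncov phi k) <= d * cov g0 k.
  apply: le_trans a2; by rewrite ler_piMl // mulr_ge0 // ltW.
by nra.
Qed.

(** [I] is the limit of [ncov phi] along an ultrafilter on which the supports of [phi] shrink to the
    identity. The limit exists because [ncov phi f] stays in the compact interval from [0] to
    [cov g0 f]. The shrinking matters only for superadditivity, through [weil_additivity]. *)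
Lemma haar_functional : exists I : (G -> R) -> R,
  [/\ forall f, ccp f -> 0 <= I f,
      forall f g, ccp f -> ccp g -> I (fun s => f s + g s) = I f + I g,
      forall c f, 0 <= c -> ccp f -> I (fun s => c * f s) = c * I f,
      forall t f, ccp f -> I (fun s => f (t^-1 * s)%g) = I f
    & I g0 = 1].
Proof.
pose E (V : set G) : set (G -> R) := [set phi | test phi /\ forall s, phi s != 0 -> V s].
pose F : set_system (G -> R) := [set S | exists2 V, nbhs (1%g : G) V & E V `<=` S].
have FF : ProperFilter F.
  split.
    move=> [V V1 EV]; have [phi [pc p01 p1 [C cC pC]]] := bump_function R hG lG V1.
    apply: (EV phi); split; last by move=> s /pC[].
    split; last by rewrite p1.
    by split=> //; [move=> s; case/andP: (p01 s)|exists C => // s /pC[]].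
  split.
  - by exists setT => //; exact: filterT.
  - move=> A B [V V1 EV] [W W1 EW]; exists (V `&` W); first exact: filterI.
    by move=> phi [tp pV]; split; [apply: EV|apply: EW]; split=> // s /pV[].
  - by move=> A B AB [V V1 EV]; exists V => // phi /EV; exact: AB.
have [U [UU FU]] := ultraFilterLemma FF.
have UP : ProperFilter U by exact: ultra_proper.
have Utest : U [set phi | test phi].
  by apply: FU; exists setT; [exact: filterT|move=> phi []].
have lim f : exists x : R, ccp f -> (fun phi => ncov phi f) @ U --> x.
  have [fP|nf] := pselect (ccp f); last by exists 0 => /nf.
  have UI : UltraFilter ((fun phi => ncov phi f) @ U).
    exact: ultra_fmap.
  have bU : U ((fun phi => ncov phi f) @^-1` [set` `[0, cov g0 f]]).
    apply: filterS Utest => phi pt; rewrite /= in_itv /=.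
    by rewrite ncov_ge0 ?ncov_le.
  have := @segment_compact R 0 (cov g0 f); rewrite compact_ultra.
  move=> /(_ _ UI bU)[x [_ xU]].
  by exists x.
have /choice[I Ilim] := lim.
have near f (e : R) : ccp f -> 0 < e -> U [set phi | `|I f - ncov phi f| < e].
  by move=> fP e0; move/cvgrPdist_lt : (Ilim f fP) => /(_ _ e0).
have le_of f g (c d : R) : ccp f -> ccp g -> 0 <= c ->
    U [set phi | ncov phi f <= c * ncov phi g + d] -> I f <= c * I g + d.
  move=> fP gP c0 h; apply/ler_addgt0Pr => e e0.
  have e1 : 0 < e / (c + 1) by rewrite divr_gt0 // ltr_wpDl.
  have [phi [/= h1 [h2 h3]]] := filter_ex (filterI h (filterI (near f _ fP e1) (near g _ gP e1))).
  move: h2 h3; rewrite !ltr_norml => /andP[a1 a2] /andP[b1 b2].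
  have E1 : (c + 1) * (e / (c + 1)) = e by rewrite mulrC divfK // gt_eqF // ltr_wpDl.
  have : c * ncov phi g <= c * (I g + e / (c + 1)) by rewrite ler_wpM2l //; lra.
  by move: E1; rewrite mulrDl mul1r mulrDr; lra.
have I0 f : ccp f -> 0 <= I f.
  move=> fP; apply/ler_addgt0Pr => e e0.
  have [phi [/= pt h]] := filter_ex (filterI Utest (near f _ fP e0)).
  by have := ncov_ge0 pt fP; move: h; rewrite ltr_norml => /andP[]; lra.
have tr t f : ccp f -> I (fun s => f (t^-1 * s)%g) <= I f.
  move=> fP; rewrite -[leRHS]mul1r -[leRHS]addr0; apply: le_of => //; first exact: ccp_translate.
  apply: filterS Utest => phi [pP p1]; rewrite /= mul1r addr0 ler_wpM2r ?invr_ge0 ?(cov_ge0 pP p1) //.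
  exact: (cov_translate_le pP p1).
have hom c f : 0 <= c -> ccp f -> I (fun s => c * f s) <= c * I f.
  move=> c0 fP; rewrite -[leRHS]addr0; apply: le_of => //; first exact: ccpZ.
  apply: filterS Utest => phi [pP p1]; rewrite /= addr0 /ncov mulrA ler_wpM2r ?invr_ge0 ?(cov_ge0 pP p1) //.
  exact: (covZ_le pP p1).
exists I; split=> //.
- move=> f g fP gP; have fgP := ccpD fP gP; apply/le_anti/andP; split; apply/ler_addgt0Pr => e e0.
    have e3 : 0 < e / 3 by rewrite divr_gt0.
    have [phi [/= [pP p1] [h1 [h2 h3]]]] := filter_ex (filterI Utest
      (filterI (near f _ fP e3) (filterI (near g _ gP e3) (near _ _ fgP e3)))).
    have := covD pP p1 fP gP; rewrite -(ler_pM2r (x := (cov phi g0)^-1)); last first.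
      by rewrite invr_gt0 (cov_gt0 pP p1 g0P gs0).
    rewrite mulrDl -/(ncov phi f) -/(ncov phi g) -/(ncov phi _).
    by move: h1 h2 h3; rewrite !ltr_norml => /andP[? ?] /andP[? ?] /andP[? ?]; lra.
  have e4 : 0 < e / 4 by rewrite divr_gt0.
  have [V V1 hV] := weil_additivity fP gP e4.
  have UV : U (E V) by apply: FU; exists V.
  have [phi [/= [pt pV] [h1 [h2 h3]]]] := filter_ex (filterI UV
    (filterI (near f _ fP e4) (filterI (near g _ gP e4) (near _ _ fgP e4)))).
  have := hV phi pt pV.
  by move: h1 h2 h3; rewrite !ltr_norml => /andP[? ?] /andP[? ?] /andP[? ?]; lra.
- move=> c f c0 fP; apply/le_anti/andP; split; first exact: hom.
  have [->|cn0] := eqVneq c 0; first by rewrite mul0r I0 //; exact: (ccpZ (c := 0)).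
  have c1 : 0 < c by rewrite lt_neqAle eq_sym cn0.
  rewrite -ler_pdivlMl //; have cP : ccp (fun s => c * f s) by exact: ccpZ.
  apply: le_trans (hom c^-1 _ _ cP); last by rewrite invr_ge0.
  by rewrite le_eqVlt; apply/orP; left; apply/eqP; congr I; apply/funext => s; rewrite mulKf.
- move=> t f fP; apply/le_anti/andP; split; first exact: tr.
  have := tr t^-1%g _ (ccp_translate t fP).
  by congr (_ <= _); congr I; apply/funext => s; rewrite invgK mulKg.
- apply/le_anti/andP; split.
    apply: (@le_trans _ _ (0 * I g0 + 1)); last by rewrite mul0r add0r.
    apply: le_of => //; apply: filterS Utest => phi [pP p1].
    by rewrite /= mul0r add0r /ncov divff // gt_eqF // (cov_gt0 pP p1 g0P gs0).
  apply/ler_addgt0Pr => e e0.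
  have [phi [/= [pP p1] h]] := filter_ex (filterI Utest (near g0 _ g0P e0)).
  move: h; rewrite /ncov divff ?gt_eqF ?(cov_gt0 pP p1 g0P gs0) //.
  by rewrite ltr_norml => /andP[]; lra.
Qed.

End Normalized.
End HaarFunctional.

(** * Completion of a semi-inner product space *)

Lemma exists_small (R : realType) (M e : R[i]) : 0 <= M -> 0 < e ->
  exists d : R[i], [/\ 0 < d, d <= 1 & d * M <= e].
Proof.
move=> M0 e0; have den : 0 < M + e + 1 by rewrite ltr_wpDl // addr_ge0 // ltW.
exists (e / (M + e + 1)); split; first exact: divr_gt0.
  by rewrite ler_pdivrMr // mul1r addrAC lerDr addr_ge0.
by rewrite mulrAC ler_pdivrMr // ler_wpM2l ?(ltW e0) // -addrA lerDl addr_ge0 // ltW.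
Qed.

Lemma eps_le (R : realType) (x y M : R[i]) : 0 <= M ->
  (forall e : R[i], 0 < e -> e <= 1 -> x <= y + e * M) -> x <= y.
Proof.
move=> M0 h; apply/ler_addgt0Pr => e e0; have [d [d0 d1 dM]] := exists_small M0 e0.
by apply: le_trans (h d d0 d1) _; rewrite lerD2l.
Qed.

Lemma eps_eq0 (R : realType) (x M : R[i]) : 0 <= M ->
  (forall e : R[i], 0 < e -> e <= 1 -> `|x| <= e * M) -> x = 0.
Proof.
move=> M0 h; apply/eqP; rewrite -normr_le0; apply: (eps_le M0) => e e0 e1.
by rewrite add0r h.
Qed.

Lemma complex_cauchy_seq (R : realType) (u : nat -> R[i]) :
  (forall e : R[i], 0 < e -> exists N, forall m n, (N <= m)%N -> (N <= n)%N -> `|u m - u n| < e) ->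
  exists l, forall e : R[i], 0 < e -> exists N, forall n, (N <= n)%N -> `|l - u n| < e.
Proof.
move=> uc; pose v : nat -> R[i]^o := u.
have cu : cauchy (v @ \oo).
  apply/cauchyP => e e0; have [N uN] := uc e e0; exists (u N).
  by exists N => // n /= Nn; rewrite -ball_normE /=; apply: uN.
have [l ul] := complex_cauchy_cvg _ cu.
exists l => e e0; move/cvgrPdist_lt : ul => /(_ e e0)[N _ h].
by exists N => n Nn; apply: h.
Qed.

Record semi_inner (R : realType) := SemiInner {
  si_sort :> lmodType R[i] ;
  si_ip : si_sort -> si_sort -> R[i] ;
  si_lin : forall k x y z, si_ip (k *: x + y) z = k * si_ip x z + si_ip y z ;
  si_conj : forall x y, si_ip y x = conjc (si_ip x y) ;
  si_ge0 : forall x, 0 <= si_ip x x }.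

Section Completion.
Variables (R : realType) (V : semi_inner R).
Local Notation K := R[i].
Local Notation ip := (@si_ip R V).
Implicit Types u v w : V.

Definition si_norm v : K := sqrtC (ip v v).
Local Notation nv := si_norm.

Lemma si_norm_ge0 v : 0 <= nv v. Proof. by rewrite sqrtC_ge0 si_ge0. Qed.
Lemma si_norm2 v : nv v ^+ 2 = ip v v. Proof. exact: sqrtCK. Qed.
Local Hint Resolve si_norm_ge0 : core.

Lemma sqr_le (x y : K) : 0 <= x -> 0 <= y -> x ^+ 2 <= y ^+ 2 -> x <= y.
Proof. by move=> x0 y0; rewrite ler_pXn2r ?nnegrE. Qed.

Lemma ip_CS v w : `|ip v w| <= nv v * nv w.
Proof.
apply: sqr_le => //; first exact: mulr_ge0.
by rewrite exprMn !si_norm2; apply: semi_inner_CS; [exact: si_lin|exact: si_conj|exact: si_ge0].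
Qed.

Lemma ipDl x y z : ip (x + y) z = ip x z + ip y z.
Proof. by rewrite -{1}(scale1r x) si_lin mul1r. Qed.

Lemma ip0l z : ip 0 z = 0.
Proof. by apply: (@addrI _ (ip 0 z)); rewrite -ipDl !addr0. Qed.

Lemma ipNl x z : ip (- x) z = - ip x z.
Proof. by apply/eqP; rewrite -addr_eq0 -ipDl addNr ip0l. Qed.

Lemma ip_linr k x y z : ip z (k *: x + y) = conjc k * ip z x + ip z y.
Proof.
rewrite si_conj si_lin (si_conj x z) (si_conj y z) -!conjCE rmorphD rmorphM /=.
by rewrite ?conjCE.
Qed.

Lemma si_norm_le v (r : K) : 0 <= r -> (forall u, `|ip v u| <= r * nv u) -> nv v <= r.
Proof.
move=> r0 /(_ v); rewrite ger0_norm ?si_ge0 // -si_norm2 expr2.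
have [->//|n0] := eqVneq (nv v) 0.
by rewrite ler_pM2r // lt_neqAle eq_sym n0 si_norm_ge0.
Qed.

Definition approximates (f : V -> K) v (e : K) := forall w, `|f w - ip v w| <= e * nv w.

(* The completion consists of the functionals [f] on [V] that are norm limits of
   functionals [ip v]. *)
Definition completion_pred : {pred V -> K} :=
  fun f => `[< forall e : K, 0 < e -> exists v, approximates f v e >].

Lemma completion_submod : submod_closed completion_pred.
Proof.
split.
  apply/asboolP => e e0; exists 0 => w; rewrite ip0l subrr normr0.
  by rewrite mulr_ge0 // ltW.
move=> a f g /asboolP fh /asboolP gh; apply/asboolP => e e0.
have a1 : 0 < `|a| + 1 by rewrite ltr_wpDl.
have [|v vh] := fh (e / 2 / (`|a| + 1)); first by rewrite !divr_gt0.
have [|u uh] := gh (e / 2); first by rewrite divr_gt0.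
exists (a *: v + u) => w; rewrite si_lin.
have -> : (a *: f + g) w - (a * ip v w + ip u w) = a * (f w - ip v w) + (g w - ip u w).
  by rewrite -[(a *: f + g) w]/(a * f w + g w); ring.
apply: le_trans (ler_normD _ _) _; rewrite normrM.
rewrite [X in X * nv w]splitr mulrDl lerD //; apply: le_trans (ler_wpM2l _ (vh w)) _ => //.
rewrite [leLHS]mulrA ler_wpM2r // mulrA ler_pdivrMr // mulrC ler_wpM2l ?lerDl //.
by rewrite divr_ge0 // ltW.
Qed.

HB.instance Definition _ := GRing.isSubmodClosed.Build K (V -> K) completion_pred completion_submod.

Record completion := Completion { cpl_fun :> V -> K ; cpl_funP : cpl_fun \in completion_pred }.

HB.instance Definition _ := [isSub for cpl_fun].
HB.instance Definition _ := [Choice of completion by <:].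
HB.instance Definition _ := [SubChoice_isSubLmodule of completion by <:].

Implicit Types f g h : completion.

Lemma cpl_eq f g : (forall v, f v = g v) -> f = g.
Proof. by move=> fg; apply: val_inj; apply/funext. Qed.

Lemma cpl_near f (e : K) : 0 < e -> exists v, approximates f v e.
Proof. by have /asboolP := cpl_funP f; exact. Qed.

Lemma cpl_bounded f : exists2 M : K, 0 <= M & forall w, `|f w| <= M * nv w.
Proof.
have [v fv] := cpl_near f ltr01; exists (nv v + 1); first exact: addr_ge0.
move=> w; rewrite -(subrK (ip v w) (f w)) addrC mulrDl.
by apply: le_trans (ler_normD _ _) _; rewrite lerD ?ip_CS.
Qed.

Lemma cpl_linr f k x y : f (k *: x + y) = conjc k * f x + f y.
Proof.
apply/eqP; rewrite -subr_eq0; apply/eqP.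
apply: (@eps_eq0 _ _ (nv (k *: x + y) + `|k| * nv x + nv y)).
  by rewrite !addr_ge0 // mulr_ge0.
move=> e e0 _; have [v fv] := cpl_near f e0.
have -> : f (k *: x + y) - (conjc k * f x + f y) = (f (k *: x + y) - ip v (k *: x + y)) +
    - (conjc k * (f x - ip v x)) + - (f y - ip v y) by rewrite ip_linr; ring.
apply: le_trans (ler_normD _ _) _; rewrite [leRHS]mulrDr; apply: lerD; last by rewrite normrN.
apply: le_trans (ler_normD _ _) _; rewrite [leRHS]mulrDr; apply: lerD => //.
by rewrite normrN normrM normcJ mulrCA ler_wpM2l.
Qed.

Lemma cplB f x y : f (x - y) = f x - f y.
Proof.
by have := cpl_linr f (-1) y x; rewrite scaleN1r addrC => ->; rewrite -conjCE rmorphN1 mulN1r addrC.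
Qed.

Lemma approximates_sub f v v' (e e' : K) : 0 <= e -> 0 <= e' ->
  approximates f v e -> approximates f v' e' -> nv (v - v') <= e + e'.
Proof.
move=> e0 e0' h h'; apply: si_norm_le => [|u]; first exact: addr_ge0.
rewrite ipDl ipNl -(subrKA (f u)) mulrDl; apply: le_trans (ler_normD _ _) _.
by rewrite lerD // distrC.
Qed.

Lemma approximates_norm f v (e M : K) : 0 <= e -> 0 <= M -> approximates f v e ->
  (forall w, `|f w| <= M * nv w) -> nv v <= M + e.
Proof.
move=> e0 M0 h b; apply: si_norm_le => [|u]; first exact: addr_ge0.
rewrite -(subrK (f u) (ip v u)) addrC mulrDl; apply: le_trans (ler_normD _ _) _.
by rewrite lerD // distrC.
Qed.

(** [L] is the limit of [f (w n)] for approximants [w n] of [g]. The estimate is stated for every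
    bound [M] and every approximant [w], so that the chosen sequence never has to be mentioned
    again. *)
Lemma cpl_inner_exists f g : exists L : K, forall (M e : K) w, 0 <= M -> 0 <= e ->
  (forall u, `|f u| <= M * nv u) -> approximates g w e -> `|L - f w| <= M * e.
Proof.
have ng n : 0 < n.+1%:R^-1 :> K by rewrite invr_gt0 ltr0n.
have /choice[w wP] : forall n : nat, exists w, approximates g w n.+1%:R^-1.
  by move=> n; exact: cpl_near.
have [M0 M00 fM0] := cpl_bounded f.
have [|L LP] := @complex_cauchy_seq R (fun n => f (w n)).
  move=> e e0; have M1 : 0 < M0 + 1 by rewrite ltr_wpDl.
  have [|N hN] := @exists_invS_lt R (e / (M0 + 1) / 2); first by rewrite !divr_gt0.
  exists N => m n Nm Nn; rewrite -cplB; apply: le_lt_trans (fM0 _) _.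
  have : nv (w m - w n) < e / (M0 + 1).
    apply: le_lt_trans (approximates_sub _ _ (wP m) (wP n)) _; rewrite ?ltW //.
    by rewrite (splitr (_ / (M0 + 1))) ltrD // hN.
  rewrite ltr_pdivlMr // => h; apply: le_lt_trans h.
  by rewrite mulrC ler_wpM2l // lerDl.
exists L => M e v M1 e0 fM gv.
apply: (@eps_le _ _ _ (M + 1)) => [|d d0 _]; first exact: addr_ge0.
have [N1 h1] := LP d d0; have [N2 h2] := exists_invS_lt d0.
pose n := maxn N1 N2.
have p1 : `|L - f (w n)| <= d by apply/ltW/h1; exact: leq_maxl.
have p2 : `|f (w n) - f v| <= M * (d + e).
  rewrite -cplB; apply: le_trans (fM _) _; rewrite ler_wpM2l //.
  apply: le_trans (approximates_sub (ltW (ng n)) e0 (wP n) gv) _; rewrite lerD2r.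
  by apply/ltW/h2; exact: leq_maxr.
rewrite -(subrKA (f (w n))); apply: le_trans (ler_normD _ _) _; apply: le_trans (lerD p1 p2) _.
by rewrite (_ : d + M * (d + e) = M * e + d * (M + 1)) //; ring.
Qed.

Definition cpl_inner f g : K := projT1 (cid (cpl_inner_exists f g)).

Lemma cpl_innerP f g (M e : K) w : 0 <= M -> 0 <= e ->
  (forall u, `|f u| <= M * nv u) -> approximates g w e -> `|cpl_inner f g - f w| <= M * e.
Proof. exact: (projT2 (cid (cpl_inner_exists f g))). Qed.

Lemma cpl_inner_near f g (M N e : K) v w : 0 <= M -> 0 <= N -> 0 <= e -> e <= 1 ->
  (forall u, `|f u| <= M * nv u) -> (forall u, `|g u| <= N * nv u) ->
  approximates f v e -> approximates g w e ->
  `|cpl_inner f g - ip v w| <= e * (M + N + 1).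
Proof.
move=> M0 N0 e0 e1 fM gN fv gw; rewrite -(subrKA (f w)); apply: le_trans (ler_normD _ _) _.
rewrite -addrA mulrDr; apply: lerD; first by rewrite mulrC; exact: cpl_innerP.
apply: le_trans (fv w) _; rewrite ler_wpM2l //; apply: le_trans (approximates_norm _ _ gw gN) _ => //.
by rewrite lerD2l.
Qed.

Lemma cpl_inner_lin k f g h : cpl_inner (k *: f + g) h = k * cpl_inner f h + cpl_inner g h.
Proof.
have [M M0 fM] := cpl_bounded f; have [N N0 gN] := cpl_bounded g.
have kfg u : `|(k *: f + g) u| <= (`|k| * M + N) * nv u.
  rewrite mulrDl; apply: le_trans (ler_normD _ _) _; rewrite lerD //.
  by rewrite normrM -mulrA ler_wpM2l.
have B0 : 0 <= `|k| * M + N by rewrite addr_ge0 // mulr_ge0.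
apply/eqP; rewrite -subr_eq0; apply/eqP.
apply: (@eps_eq0 _ _ ((`|k| * M + N) + `|k| * M + N)); first by rewrite !addr_ge0 // mulr_ge0.
move=> e e0 _; have [w hw] := cpl_near h e0; have e0' := ltW e0.
have a1 := cpl_innerP B0 e0' kfg hw.
have a2 := cpl_innerP M0 e0' fM hw; have a3 := cpl_innerP N0 e0' gN hw.
have -> : cpl_inner (k *: f + g) h - (k * cpl_inner f h + cpl_inner g h) =
    (cpl_inner (k *: f + g) h - (k *: f + g) w) + - (k * (cpl_inner f h - f w)) +
    - (cpl_inner g h - g w).
  by rewrite -[(k *: f + g) w]/(k * f w + g w); ring.
rewrite [leRHS](_ : _ = (`|k| * M + N) * e + `|k| * (M * e) + N * e); last by ring.
apply: le_trans (ler_normD _ _) _; apply: lerD; last by rewrite normrN.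
apply: le_trans (ler_normD _ _) _; apply: lerD => //.
by rewrite normrN normrM ler_wpM2l.
Qed.

Lemma cpl_inner_conj f g : cpl_inner g f = conjc (cpl_inner f g).
Proof.
have [M M0 fM] := cpl_bounded f; have [N N0 gN] := cpl_bounded g.
apply/eqP; rewrite -subr_eq0; apply/eqP.
apply: (@eps_eq0 _ _ ((N + M + 1) + (M + N + 1))); first by rewrite !addr_ge0.
move=> e e0 e1; have [v fv] := cpl_near f e0; have [w gw] := cpl_near g e0; have e0' := ltW e0.
rewrite -(subrKA (ip w v)); apply: le_trans (ler_normD _ _) _; rewrite mulrDr; apply: lerD.
  exact: cpl_inner_near.
rewrite (si_conj v w) -!conjCE -rmorphB norm_conjC distrC.
exact: cpl_inner_near.
Qed.

Lemma cpl_inner_ge0 f : 0 <= cpl_inner f f.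
Proof.
have [M M0 fM] := cpl_bounded f; apply: ge0_closed => e e0.
have den : 0 < M + M + 1 + e by rewrite ltr_wpDl // !addr_ge0.
have d0 : 0 < e / (M + M + 1 + e) by rewrite divr_gt0.
have d1 : e / (M + M + 1 + e) <= 1 by rewrite ler_pdivrMr // mul1r lerDr !addr_ge0.
have [v fv] := cpl_near f d0; exists (ip v v); first exact: si_ge0.
apply: le_trans (cpl_inner_near M0 M0 (ltW d0) d1 fM fM fv fv) _.
by rewrite mulrAC ler_pdivrMr // ler_pM2l // lerDl ltW.
Qed.

Definition cpl_norm f : K := sqrtC (cpl_inner f f).

Lemma cpl_norm_ge0 f : 0 <= cpl_norm f. Proof. by rewrite sqrtC_ge0 cpl_inner_ge0. Qed.
Lemma cpl_norm2 f : cpl_norm f ^+ 2 = cpl_inner f f. Proof. exact: sqrtCK. Qed.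
Local Hint Resolve cpl_norm_ge0 : core.

Lemma embed_subproof v : ip v \in completion_pred.
Proof. by apply/asboolP => e e0; exists v => w; rewrite subrr normr0 mulr_ge0 // ltW. Qed.

Definition embed v : completion := Completion (embed_subproof v).

Lemma cpl_inner_embed f v : cpl_inner f (embed v) = f v.
Proof.
have [M M0 fM] := cpl_bounded f; apply/eqP; rewrite -subr_eq0 -normr_le0 -(mulr0 M).
by apply: cpl_innerP => // w; rewrite subrr normr0 mul0r.
Qed.

Lemma cpl_norm_bound f w : `|f w| <= cpl_norm f * nv w.
Proof.
apply: sqr_le => //; first exact: mulr_ge0.
rewrite exprMn cpl_norm2 si_norm2 -[ip w w](cpl_inner_embed (embed w)) -{1}cpl_inner_embed.
by apply: semi_inner_CS; [exact: cpl_inner_lin|exact: cpl_inner_conj|exact: cpl_inner_ge0].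
Qed.

Lemma cpl_norm_le f (r : K) : 0 <= r -> (forall w, `|f w| <= r * nv w) -> cpl_norm f <= r.
Proof.
move=> r0 fr; apply: sqr_le => //; rewrite cpl_norm2.
apply: (@eps_le _ _ _ (r + r)) => [|e e0 _]; first exact: addr_ge0.
have [w fw] := cpl_near f e0; have e0' := ltW e0.
rewrite -(ger0_norm (cpl_inner_ge0 f)) -(subrK (f w) (cpl_inner f f)) addrC.
apply: le_trans (ler_normD _ _) _; rewrite mulrDr addrA; apply: lerD; last first.
  by rewrite mulrC; exact: cpl_innerP.
apply: le_trans (fr w) _; rewrite expr2 [e * r]mulrC -mulrDr ler_wpM2l //.
exact: approximates_norm fw fr.
Qed.

Lemma cpl_normD f g : cpl_norm (f + g) <= cpl_norm f + cpl_norm g.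
Proof.
apply: cpl_norm_le => [|w]; first exact: addr_ge0.
by rewrite mulrDl; apply: le_trans (ler_normD _ _) _; rewrite lerD ?cpl_norm_bound.
Qed.

Lemma cpl_normZ (a : K) f : cpl_norm (a *: f) = `|a| * cpl_norm f.
Proof.
apply: le_anti; apply/andP; split.
  apply: cpl_norm_le => [|w]; first exact: mulr_ge0.
  by rewrite normrM -mulrA ler_wpM2l ?cpl_norm_bound.
have [->|a0] := eqVneq a 0; first by rewrite normr0 mul0r.
have a1 : 0 < `|a| by rewrite normr_gt0.
rewrite -ler_pdivlMl //; apply: cpl_norm_le => [|w]; first by rewrite mulr_ge0 ?invr_ge0.
by rewrite -mulrA ler_pdivlMl // -normrM; exact: (cpl_norm_bound (a *: f)).
Qed.

Lemma cpl_norm0_eq0 f : cpl_norm f = 0 -> f = 0.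
Proof.
move=> f0; apply: cpl_eq => v; apply/eqP; rewrite -normr_le0.
by apply: le_trans (cpl_norm_bound f v) _; rewrite f0 mul0r.
Qed.

HB.instance Definition _ :=
  Lmodule_isNormed.Build K completion cpl_normD cpl_normZ cpl_norm0_eq0.

Lemma cpl_cauchy_cvg (F : set_system completion) : ProperFilter F -> cauchy F -> cvg F.
Proof.
move=> FF /cauchyP Fc.
have [l Fl] : exists l : V -> K^o, forall v, (fun f : completion => f v : K^o) @ F --> l v.
  suff h v : exists l : K^o, (fun f : completion => f v : K^o) @ F --> l.
    by exists (fun v => projT1 (cid (h v))) => v; exact: projT2 (cid (h v)).
  apply: complex_cauchy_cvg; apply/cauchyP => e e0.
  have d0 : 0 < e / (nv v + 1) by rewrite divr_gt0 // ltr_wpDl.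
  have [f Ff] := Fc _ d0; exists (f v).
  suff : F ((fun f : completion => f v : K^o) @^-1` ball (f v : K^o) e) by [].
  move: Ff; rewrite -!ball_normE; apply: filterS => g /= fg.
  apply: le_lt_trans (cpl_norm_bound (f - g) v) _.
  move: fg; rewrite ltr_pdivlMr ?ltr_wpDl // => h; apply: le_lt_trans h.
  by rewrite ler_wpM2l // lerDl.
have unif e : 0 < e -> exists f : completion, (\forall g \near F, `|f - g| < e) /\
    forall v, `|f v - l v| <= e * nv v.
  move=> e0; have [f] := Fc e e0; rewrite -ball_normE => Ff; exists f; split => // v.
  apply/ler_addgt0Pr => d d0.
  have := Fl v; move/cvgrPdist_lt => /(_ _ d0) Fd.
  have [g [/= fg gl]] := filter_ex (filterI Ff Fd).
  rewrite -(subrKA (g v)); apply: le_trans (ler_normD _ _) _.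
  rewrite lerD //; last by rewrite distrC ltW.
  by apply: le_trans (cpl_norm_bound (f - g) v) _; rewrite ler_wpM2r // ltW.
have l0 : l \in completion_pred.
  apply/asboolP => e e0; have e2 : 0 < e / 2 by rewrite divr_gt0.
  have [f [_ fl]] := unif _ e2; have [v fv] := cpl_near f e2; exists v => w.
  rewrite -(subrKA (f w)) (splitr e) mulrDl; apply: le_trans (ler_normD _ _) _.
  by rewrite lerD // distrC.
apply/cvg_ex; exists (Completion l0); apply/cvgrPdist_le => e e0.
have e2 : 0 < e / 2 by rewrite divr_gt0.
have [f [Ff fl]] := unif _ e2.
apply: filterS Ff => g fg; apply: cpl_norm_le => [|v]; first exact: ltW.
rewrite -[_ v]/(l v - g v) -(subrKA (f v)) (splitr e) mulrDl.
apply: le_trans (ler_normD _ _) _; rewrite lerD //; first by rewrite distrC.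
by apply: le_trans (cpl_norm_bound (f - g) v) _; rewrite ler_wpM2r // ltW.
Qed.

HB.instance Definition _ := Uniform_isComplete.Build completion cpl_cauchy_cvg.

End Completion.

Lemma hilbert_completion (R : realType) (V : semi_inner R) :
  exists (H : hilbert R) (j : V -> H), [/\ linear j,
    forall v w, inner (j v) (j w) = si_ip v w
    & forall x (e : R[i]), 0 < e -> exists v, `|x - j v| < e].
Proof.
have Dl (f g h : completion V) : cpl_inner (f + g) h = cpl_inner f h + cpl_inner g h.
  by rewrite -{1}(scale1r f) cpl_inner_lin mul1r.
have Zl k (f g : completion V) : cpl_inner (k *: f) g = k * cpl_inner f g.
  have I0 : cpl_inner 0 g = 0 by apply: (@addrI _ (cpl_inner 0 g)); rewrite -Dl !addr0.
  by rewrite -[k *: f]addr0 cpl_inner_lin I0 addr0.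
have C (f g : completion V) : cpl_inner g f = ((cpl_inner f g)^*)%R.
  by rewrite conjCE cpl_inner_conj.
have N (f : completion V) : cpl_inner f f = `|f| ^+ 2 by rewrite -cpl_norm2.
exists (@Hilbert R (completion V) (@cpl_inner R V) Dl Zl C N), (@embed R V); split.
- by move=> k x y; apply: cpl_eq => w; exact: si_lin.
- by move=> v w; exact: cpl_inner_embed.
move=> x e e0; have e2 : 0 < e / 2 by rewrite divr_gt0.
have [v xv] := cpl_near x e2; exists v; apply: (@le_lt_trans _ _ (e / 2)).
  by apply: cpl_norm_le => //; exact: ltW.
by rewrite ltr_pdivrMr // ltr_pMr // ltr1n.
Qed.

(** * Bounded operators on a Hilbert space *)

Section BoundedOperators.
Variables (R : realType) (H : hilbert R).
Local Notation K := R[i].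

Definition adjoints (T T' : H -> H) := forall x y, inner (T x) y = inner x (T' y).

Lemma adjoints_sym (T T' : H -> H) : adjoints T T' -> adjoints T' T.
Proof. by move=> h x y; rewrite innerC -h -innerC. Qed.

Lemma adjoints_linear (T T' : H -> H) : adjoints T T' -> linear T.
Proof.
move=> h k x y; apply/eqP; rewrite -subr_eq0; apply/eqP/inner_eq0 => z.
by rewrite innerDl innerNl !inner_lin !h inner_lin; ring.
Qed.

Lemma adjoints_bound (T T' : H -> H) (M : K) : 0 <= M -> adjoints T T' ->
  (forall x, `|T x| <= M * `|x|) -> forall x, `|T' x| <= M * `|x|.
Proof.
move=> M0 h TM x; apply: inner_le_norm => [|y]; first exact: mulr_ge0.
rewrite (adjoints_sym h); apply: le_trans (inner_CS _ _) _.
by rewrite mulrAC mulrC ler_wpM2r.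
Qed.

Lemma adjoints_unique (T T' T'' : H -> H) : adjoints T T' -> adjoints T T'' -> T' =1 T''.
Proof.
move=> h h' x; apply/eqP; rewrite -subr_eq0; apply/eqP/inner_eq0 => z.
by rewrite innerDl innerNl (adjoints_sym h) (adjoints_sym h') subrr.
Qed.

(** Making the adjoint part of the definition bypasses the Riesz representation theorem; linearity
    is then a consequence. *)
Definition bop_pred : {pred H -> H} := fun T =>
  `[< exists T' (M : K), [/\ 0 <= M, adjoints T T' & forall x, `|T x| <= M * `|x|] >].

Lemma bop_submod : submod_closed bop_pred.
Proof.
split.
  apply/asboolP; exists (fun=> 0), 0; split=> // [x y|x].
    by rewrite inner0l inner0r.
  by rewrite normr0 mul0r.
move=> a S T /asboolP[S' [M [M0 hS SM]]] /asboolP[T' [N [N0 hT TN]]]; apply/asboolP.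
exists (fun y => conjc a *: S' y + T' y), (`|a| * M + N); split=> [|x y|x].
- by rewrite addr_ge0 // mulr_ge0.
- by rewrite -[(a *: S + T) x]/(a *: S x + T x) inner_lin innerDr innerZr conjcK hS hT.
- rewrite -[(a *: S + T) x]/(a *: S x + T x) mulrDl; apply: le_trans (ler_normD _ _) _.
  by rewrite lerD // normrZ -mulrA ler_wpM2l.
Qed.

HB.instance Definition _ := GRing.isSubmodClosed.Build K (H -> H) bop_pred bop_submod.

Record bop := Bop { bop_fun :> H -> H ; bop_funP : bop_fun \in bop_pred }.

HB.instance Definition _ := [isSub for bop_fun].
HB.instance Definition _ := [Choice of bop by <:].
HB.instance Definition _ := [SubChoice_isSubLmodule of bop by <:].

Implicit Types S T : bop.

Lemma bop_eq S T : (forall x, S x = T x) -> S = T.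
Proof. by move=> ST; apply: val_inj; apply/funext. Qed.

Definition bop_of (T T' : H -> H) (M : K) (M0 : 0 <= M) (h : adjoints T T')
  (b : forall x, `|T x| <= M * `|x|) : bop :=
  @Bop T (asboolT (ex_intro _ T' (ex_intro _ M (And3 M0 h b)))).

Lemma bop_adj_exists T : exists T' : H -> H, adjoints T T'.
Proof. by have /asboolP[T' [M [_ h _]]] := bop_funP T; exists T'. Qed.

Lemma bop_linear T : linear T.
Proof. by have [T' /adjoints_linear] := bop_adj_exists T. Qed.

Definition bop_norm T : K :=
  (inf [set M : R | 0 <= M /\ forall x, `|T x| <= M%:C * `|x|])%:C.

Lemma ge0_real (r : K) : 0 <= r -> r = (complex.Re r)%:C /\ 0 <= complex.Re r.
Proof. by case: r => a b; rewrite lecE /= => /andP[/eqP -> ->]. Qed.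

Lemma bop_norm_le T (r : K) : 0 <= r -> (forall x, `|T x| <= r * `|x|) -> bop_norm T <= r.
Proof.
move=> /ge0_real[-> r0] h; rewrite lecR; apply: ge_inf; last by split.
by exists 0 => M [].
Qed.

Lemma bop_norm_ge0 T : 0 <= bop_norm T.
Proof.
rewrite -[0]/(0%:C) lecR; apply: lb_le_inf => [|M [] //].
have /asboolP[T' [M [/ge0_real[ME M0] _ h]]] := bop_funP T.
by exists (complex.Re M); split=> //; rewrite -ME.
Qed.
Local Hint Resolve bop_norm_ge0 : core.

Lemma bop_normP T x : `|T x| <= bop_norm T * `|x|.
Proof.
apply: (@eps_le _ _ _ `|x|) => // e /gt0_realc[-> e0] _.
have hi : has_inf [set M : R | 0 <= M /\ forall x, `|T x| <= M%:C * `|x|].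
  split; last by exists 0 => M [].
  have /asboolP[T' [M [/ge0_real[ME M0] _ h]]] := bop_funP T.
  by exists (complex.Re M); split=> //; rewrite -ME.
have [M [M0 h] Me] := inf_adherent e0 hi.
apply: le_trans (h x) _; rewrite -mulrDl ler_wpM2r //.
by rewrite -rmorphD lecR ltW.
Qed.

Lemma bop_normD S T : bop_norm (S + T) <= bop_norm S + bop_norm T.
Proof.
apply: bop_norm_le => [|x]; first exact: addr_ge0.
by rewrite mulrDl; apply: le_trans (ler_normD _ _) _; rewrite lerD ?bop_normP.
Qed.

Lemma bop_normZ (a : K) T : bop_norm (a *: T) = `|a| * bop_norm T.
Proof.
apply: le_anti; apply/andP; split.
  apply: bop_norm_le => [|x]; first exact: mulr_ge0.
  by rewrite normrZ -mulrA ler_wpM2l ?bop_normP.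
have [->|a0] := eqVneq a 0; first by rewrite normr0 mul0r.
have a1 : 0 < `|a| by rewrite normr_gt0.
rewrite -ler_pdivlMl //; apply: bop_norm_le => [|x]; first by rewrite mulr_ge0 ?invr_ge0.
by rewrite -mulrA ler_pdivlMl // -normrZ; exact: (bop_normP (a *: T)).
Qed.

Lemma bop_norm0_eq0 T : bop_norm T = 0 -> T = 0.
Proof.
move=> T0; apply: bop_eq => x; apply/eqP; rewrite -normr_le0.
by apply: le_trans (bop_normP T x) _; rewrite T0 mul0r.
Qed.

HB.instance Definition _ :=
  Lmodule_isNormed.Build K bop bop_normD bop_normZ bop_norm0_eq0.

Lemma bop_norm_bound T x : `|T x| <= `|T| * `|x|. Proof. exact: bop_normP. Qed.

Lemma bop_adj_subproof T : exists T' : H -> H, adjoints T T' /\ T' \in bop_pred.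
Proof.
have [T' h] := bop_adj_exists T; exists T'; split=> //.
apply/asboolP; exists T, (bop_norm T); split=> //; first exact: adjoints_sym.
exact: (adjoints_bound _ h (bop_normP T)).
Qed.

Definition bop_star T : bop :=
  let h := cid (bop_adj_subproof T) in @Bop (projT1 h) (projT2 h).2.

Lemma bop_adj T x y : inner (T x) y = inner x (bop_star T y).
Proof. exact: ((projT2 (cid (bop_adj_subproof T))).1 x y). Qed.

Lemma bop_star_eq T (T' : bop) : adjoints T T' -> bop_star T = T'.
Proof. by move=> h; apply: bop_eq; apply: adjoints_unique h; exact: bop_adj. Qed.

Lemma bop_starK : involutive bop_star.
Proof. by move=> T; apply: bop_star_eq; apply: adjoints_sym; exact: bop_adj. Qed.

Lemma bop_starD S T : bop_star (S + T) = bop_star S + bop_star T.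
Proof.
apply: bop_star_eq => x y; rewrite -[(S + T) x]/(S x + T x) innerDl !bop_adj.
by rewrite -[(_ + _ : bop) y]/(bop_star S y + bop_star T y) innerDr.
Qed.

Lemma bop_starZ (k : K) T : bop_star (k *: T) = (k^*)%R *: bop_star T.
Proof.
apply: bop_star_eq => x y; rewrite -[(k *: T) x]/(k *: T x) innerZl bop_adj.
by rewrite -[(_ *: _ : bop) y]/((k^*)%R *: bop_star T y) innerZr conjCE conjcK.
Qed.

Lemma bop_star_norm T : `|bop_star T| <= `|T|.
Proof.
apply: bop_norm_le => // x.
exact: (adjoints_bound (bop_norm_ge0 T) (bop_adj T) (bop_normP T)).
Qed.

Lemma bop_mul_subproof S T : (fun x => S (T x)) \in bop_pred.
Proof.
apply/asboolP; exists (fun y => bop_star T (bop_star S y)), (`|S| * `|T|); split.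
- exact: mulr_ge0.
- by move=> x y; rewrite !bop_adj.
- by move=> x; apply: le_trans (bop_norm_bound _ _) _; rewrite -mulrA ler_wpM2l ?bop_norm_bound.
Qed.

Definition bop_mul S T : bop := Bop (bop_mul_subproof S T).

Lemma bop_mulA : associative bop_mul. Proof. by move=> S T U; exact: bop_eq. Qed.
Lemma bop_mulDl : left_distributive bop_mul +%R.
Proof. by move=> S T U; exact: bop_eq. Qed.
Lemma bop_mulDr : right_distributive bop_mul +%R.
Proof. by move=> S T U; apply: bop_eq => x /=; exact: (linD (bop_linear S)). Qed.
Lemma bop_mulZl (k : K) S T : bop_mul (k *: S) T = k *: bop_mul S T.
Proof. exact: bop_eq. Qed.
Lemma bop_mulZr (k : K) S T : bop_mul S (k *: T) = k *: bop_mul S T.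
Proof. by apply: bop_eq => x /=; exact: (linZ (bop_linear S)). Qed.
Lemma bop_starM S T : bop_star (bop_mul S T) = bop_mul (bop_star T) (bop_star S).
Proof. by apply: bop_star_eq => x y /=; rewrite !bop_adj. Qed.

HB.instance Definition _ := isStarAlgebra.Build R bop bop_mulA bop_mulDl bop_mulDr
  bop_mulZl bop_mulZr bop_starK bop_starD bop_starZ bop_starM.

Lemma bopM S T x : (S ** T) x = S (T x). Proof. by []. Qed.

Lemma bop_norm_mul S T : `|S ** T| <= `|S| * `|T|.
Proof.
apply: bop_norm_le => [|x]; first exact: mulr_ge0.
by apply: le_trans (bop_norm_bound S (T x)) _; rewrite -mulrA ler_wpM2l ?bop_norm_bound.
Qed.

Lemma bop_norm_starM T : `|star T ** T| = `|T| ^+ 2.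
Proof.
apply: le_anti; apply/andP; split.
  apply: le_trans (bop_norm_mul _ _) _; rewrite expr2 ler_wpM2r //; exact: bop_star_norm.
rewrite -[leRHS]sqrtCK lerXn2r ?nnegrE ?sqrtC_ge0 //.
apply: bop_norm_le => [|x]; first by rewrite sqrtC_ge0.
apply: sqr_le => //.
rewrite exprMn sqrtCK -inner_norm bop_adj -[bop_star T (T x)]/((star T ** T) x).
rewrite -(ger0_norm (_ : 0 <= inner x ((star T ** T) x))); last first.
  by rewrite bopM -bop_adj inner_ge0.
apply: le_trans (inner_CS _ _) _; rewrite mulrC expr2 mulrA ler_wpM2r //.
exact: bop_norm_bound.
Qed.

Lemma bop_cauchy_cvg (F : set_system bop) : ProperFilter F -> cauchy F -> cvg F.
Proof.
move=> FF /cauchyP Fc.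
(* Used twice, for the operators and for their adjoints, since the limit needs an adjoint in order
   to belong to [bop]. *)
have point (p : bop -> H -> H) : (forall S T x, `|p S x - p T x| <= `|S - T| * `|x|) ->
    exists l : H -> H, forall e : K, 0 < e -> exists2 T : bop, (\forall S \near F, `|T - S| < e) &
      forall S, `|T - S| < e -> forall x, `|p S x - l x| <= (e + e) * `|x|.
  move=> pL.
  have [l Fl] : exists l : H -> H, forall x, (fun T => p T x) @ F --> l x.
    suff h x : exists l : H, (fun T => p T x) @ F --> l.
      by exists (fun x => projT1 (cid (h x))) => x; exact: projT2 (cid (h x)).
    suff : cauchy ((fun T => p T x) @ F) by move/cauchy_cvg/cvg_ex.
    apply/cauchyP => e e0.
    have d0 : 0 < e / (`|x| + 1) by rewrite divr_gt0 // ltr_wpDl.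
    have [T FT] := Fc _ d0; exists (p T x).
    suff : F ((fun T => p T x) @^-1` ball (p T x) e) by [].
    move: FT; rewrite -!ball_normE; apply: filterS => S /= TS.
    apply: le_lt_trans (pL _ _ _) _.
    move: TS; rewrite ltr_pdivlMr ?ltr_wpDl // => h; apply: le_lt_trans h.
    by rewrite ler_wpM2l // lerDl.
  exists l => e e0; have [T] := Fc e e0; rewrite -ball_normE => FT; exists T => // S TS x.
  apply/ler_addgt0Pr => d d0.
  have := Fl x; move/cvgrPdist_lt => /(_ _ d0) Fd.
  have [S' [/= TS' S'l]] := filter_ex (filterI FT Fd).
  rewrite -(subrKA (p S' x)); apply: le_trans (ler_normD _ _) _.
  rewrite lerD //; last by rewrite distrC ltW.
  apply: le_trans (pL _ _ _) _; rewrite ler_wpM2r // -(subrKA T).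
  by apply: le_trans (ler_normD _ _) _; rewrite lerD // ltW // distrC.
have [l lP] : exists l : H -> H, forall e : K, 0 < e -> exists2 T : bop, (\forall S \near F, `|T - S| < e) &
      forall S, `|T - S| < e -> forall x, `|S x - l x| <= (e + e) * `|x|.
  by apply: (point (fun T => T)) => S T x; exact: (bop_norm_bound (S - T)).
have [l' lP'] : exists l : H -> H, forall e : K, 0 < e -> exists2 T : bop, (\forall S \near F, `|T - S| < e) &
      forall S, `|T - S| < e -> forall x, `|star S x - l x| <= (e + e) * `|x|.
  apply: (point (fun T => star T)) => S T x.
  apply: le_trans (bop_norm_bound (star S - star T) x) _; rewrite ler_wpM2r // -starB.
  exact: bop_star_norm.
have adj : adjoints l l'.
  move=> x y; apply/eqP; rewrite -subr_eq0; apply/eqP.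
  apply: (@eps_eq0 _ _ (2 * `|x| * `|y| + 2 * `|x| * `|y|)) => [|e e0 _].
    by rewrite addr_ge0 // !mulr_ge0.
  have [T FT Tl] := lP e e0; have [T' FT' Tl'] := lP' e e0.
  have [S [/Tl Sl /Tl' Sl']] := filter_ex (filterI FT FT').
  have -> : inner (l x) y - inner x (l' y) = inner (l x - S x) y + inner x (star S y - l' y).
    by rewrite innerDl innerNl innerDr innerNr bop_adj; ring.
  rewrite mulrDr; apply: le_trans (ler_normD _ _) _; apply: lerD; apply: le_trans (inner_CS _ _) _.
    rewrite distrC; apply: le_trans (ler_wpM2r _ (Sl x)) _ => //.
    by rewrite le_eqVlt; apply/orP; left; apply/eqP; ring.
  apply: le_trans (ler_wpM2l _ (Sl' y)) _ => //.
  by rewrite le_eqVlt; apply/orP; left; apply/eqP; ring.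
have lb : exists2 M : K, 0 <= M & forall x, `|l x| <= M * `|x|.
  have [T FT Tl] := lP 1 ltr01; exists (`|T| + (1 + 1)) => [|x]; first by rewrite !addr_ge0.
  have {}Tl := Tl T; rewrite subrr normr0 ltr01 in Tl; have {}Tl := Tl isT x.
  rewrite mulrDl -(subrK (T x) (l x)) addrC; apply: le_trans (ler_normD _ _) _.
  by rewrite lerD ?bop_norm_bound // distrC.
have [M M0 lM] := lb.
apply/cvg_ex; exists (bop_of M0 adj lM); apply/cvgrPdist_le => e e0.
have e2 : 0 < e / 2 by rewrite divr_gt0.
have [T FT Tl] := lP _ e2.
apply: filterS FT => S TS; apply: bop_norm_le => [|x]; first exact: ltW.
by rewrite -[_ x]/(l x - S x) distrC (splitr e); exact: Tl.
Qed.

HB.instance Definition _ := Uniform_isComplete.Build bop bop_cauchy_cvg.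
HB.instance Definition _ := isCstarAlgebra.Build R bop bop_norm_mul bop_norm_starM.

Lemma rank1_subproof (x y : H) : (fun z => inner z y *: x) \in bop_pred.
Proof.
apply/asboolP; exists (fun z => inner z x *: y), (`|x| * `|y|); split.
- exact: mulr_ge0.
- by move=> z w; rewrite innerZl innerZr -innerC mulrC.
- move=> z; rewrite normrZ mulrC -mulrA ler_wpM2l // mulrC; exact: inner_CS.
Qed.

Definition rank1 x y : bop := Bop (rank1_subproof x y).

Lemma rank1_norm x y : `|rank1 x y| <= `|x| * `|y|.
Proof.
apply: bop_norm_le => [|z]; first exact: mulr_ge0.
by rewrite normrZ mulrC -mulrA ler_wpM2l // mulrC; exact: inner_CS.
Qed.

Lemma mul_rank1 T x y : T ** rank1 x y = rank1 (T x) y.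
Proof. by apply: bop_eq => z; exact: (linZ (bop_linear T)). Qed.

Lemma rank1_mul T x y : rank1 x y ** T = rank1 x (star T y).
Proof. by apply: bop_eq => z /=; rewrite bop_adj. Qed.

Lemma rank1Bl x x' y : rank1 x y - rank1 x' y = rank1 (x - x') y.
Proof. by apply: bop_eq => z; rewrite /= scalerBr. Qed.

Lemma rank1Br x y y' : rank1 x y - rank1 x y' = rank1 x (y - y').
Proof. by apply: bop_eq => z; rewrite /= innerDr innerNr scalerBl. Qed.

End BoundedOperators.

Lemma blin_cvg (R : realType) (V W : normedModType R[i]) (f : V -> W) : blin f -> continuous f.
Proof.
move=> [lf [M M0 fM]] x; apply/cvgrPdist_lt => e e0.
have d0 : 0 < e / (M + 1) by rewrite divr_gt0 // ltr_wpDl.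
have := @nbhsx_ballx _ V x _ d0; rewrite -ball_normE; apply: filterS => y /= xy.
rewrite -(linB lf); apply: le_lt_trans (fM _) _.
move: xy; rewrite ltr_pdivlMr ?ltr_wpDl // => h; apply: le_lt_trans h.
by rewrite mulrC ler_wpM2l // lerDl.
Qed.

(** * The strictly continuous part of a unitary representation *)

Section StrictPart.
Variables (R : realType) (G : topGroupType) (D : cstarAlgType R) (u : G -> D).
Local Notation K := R[i].
Hypotheses (uM : forall s t, u (s * t)%g = u s ** u t)
  (u1l : forall x, u 1%g ** x = x)
  (uV : forall s, star (u s) = u s^-1%g).

Lemma unitary_le1 s : `|u s| <= 1.
Proof.
have u11 : `|u 1%g| <= 1.
  have := norm_starM (u 1%g); rewrite uV invg1 u1l expr2.
  have [->|n0] := eqVneq `|u 1%g| 0; first by [].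
  by rewrite -{1}[`|u 1%g|]mulr1 => /(mulfI n0) <-.
have : `|u s| ^+ 2 <= 1 ^+ 2 by rewrite -norm_starM uV -uM mulVg expr1n.
by apply: sqr_le.
Qed.

(** [u] will be only strongly continuous, while [unitary_hom] asks for norm continuity of both
    actions. The elements for which this holds form a C*-algebra stable under multiplication by [u],
    which can serve as target in the universal property of [CG]; for operators it contains those of
    rank one. *)
Definition strict_set (x : D) :=
  continuous (fun s => u s ** x : D) /\ continuous (fun s => x ** u s : D).

Lemma strict_csubm : csubm strict_set.
Proof.
split.
- split=> s; first by under eq_fun do rewrite amul0r; exact: cvg_cst.
  by under eq_fun do rewrite amul0l; exact: cvg_cst.
- move=> k x y [xl xr] [yl yr]; split=> s.
    under eq_fun do rewrite amulDr amulZr.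
    by apply: cvgD; [apply: cvgZr; exact: xl|exact: yl].
  under eq_fun do rewrite amulDl amulZl.
  by apply: cvgD; [apply: cvgZr; exact: xr|exact: yr].
- move=> x h; split=> s; apply/cvgrPdist_lt => e e0; have e3 : 0 < e / 3 by rewrite divr_gt0.
    have [y [yc _] xy] := h _ e3; move/cvgrPdist_lt : (yc s) => /(_ _ e3).
    apply: filterS => t ty.
    have b r : `|u r ** (x - y)| < e / 3.
      apply: le_lt_trans (norm_amul _ _) _; apply: le_lt_trans xy.
      by rewrite ler_piMl // unitary_le1.
    have -> : u s ** x - u t ** x = u s ** (x - y) + (u s ** y - u t ** y) - u t ** (x - y) by alg.
    rewrite [ltRHS](_ : e = e / 3 + e / 3 + e / 3); last by field.
    apply: le_lt_trans (ler_normB _ _) _; rewrite ltrD //.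
    by apply: le_lt_trans (ler_normD _ _) _; rewrite ltrD.
  have [y [_ yc] xy] := h _ e3; move/cvgrPdist_lt : (yc s) => /(_ _ e3).
  apply: filterS => t ty.
  have b r : `|(x - y) ** u r| < e / 3.
    apply: le_lt_trans (norm_amul _ _) _; apply: le_lt_trans xy.
    by rewrite ler_piMr // unitary_le1.
  have -> : x ** u s - x ** u t = (x - y) ** u s + (y ** u s - y ** u t) - (x - y) ** u t by alg.
  rewrite [ltRHS](_ : e = e / 3 + e / 3 + e / 3); last by field.
  apply: le_lt_trans (ler_normB _ _) _; rewrite ltrD //.
  by apply: le_lt_trans (ler_normD _ _) _; rewrite ltrD.
Qed.

Lemma strict_mul x y : strict_set x -> strict_set y -> strict_set (x ** y).
Proof.
move=> [xl _] [_ yr]; split=> s.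
  under eq_fun do rewrite amulA.
  exact: (cvg_comp _ _ (xl s) (blin_cvg (blin_mulr y) (x := u s ** x))).
under eq_fun do rewrite -amulA.
exact: (cvg_comp _ _ (yr s) (blin_cvg (blin_mull x) (x := y ** u s))).
Qed.

Lemma strict_star x : strict_set x -> strict_set (star x).
Proof.
move=> [xl xr]; split=> s; apply/cvgrPdist_lt => e e0.
  have h : (fun t => x ** u t^-1%g) @ s --> x ** u s^-1%g.
    exact: (cvg_comp _ _ (@invg_continuous G s) (xr s^-1%g)).
  move/cvgrPdist_lt : h => /(_ e e0); apply: filterS => t.
  by rewrite -norm_star starB !starM !uV !invgK.
have h : (fun t => u t^-1%g ** x) @ s --> u s^-1%g ** x.
  exact: (cvg_comp _ _ (@invg_continuous G s) (xl s^-1%g)).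
move/cvgrPdist_lt : h => /(_ e e0); apply: filterS => t.
by rewrite -norm_star starB !starM !uV !invgK.
Qed.

Definition strict_sub := CstarSub strict_csubm strict_mul strict_star.

Lemma strict_lmul s x : strict_set x -> strict_set (u s ** x).
Proof.
move=> [xl xr]; split=> t.
  under eq_fun do rewrite amulA -uM.
  exact: (cvg_comp _ _ (@mulgr_cvg G s t) (xl (t * s)%g)).
under eq_fun do rewrite -amulA.
exact: (cvg_comp _ _ (xr t) (blin_cvg (blin_mull (u s)) (x := x ** u t))).
Qed.

Lemma strict_rmul s x : strict_set x -> strict_set (x ** u s).
Proof.
move=> [xl xr]; split=> t.
  under eq_fun do rewrite amulA.
  exact: (cvg_comp _ _ (xl t) (blin_cvg (blin_mulr (u s)) (x := u t ** x))).
under eq_fun do rewrite -amulA -uM.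
exact: (cvg_comp _ _ (@mulgl_cvg G s t) (xr (s * t)%g)).
Qed.

Let B := csub_alg strict_sub.

Program Definition strict_mult (s : G) : mult B :=
  @Mult R B (fun x => csub_mk (S := strict_sub) (strict_lmul s (csub_valS x : strict_set _)))
    (fun x => csub_mk (S := strict_sub) (strict_rmul s (csub_valS x : strict_set _))) _.
Next Obligation. by move=> s x y; apply: csub_val_inj; exact: amulA. Qed.

Lemma strict_unitary : unitary_hom strict_mult.
Proof.
split.
- by move=> s t; apply: lmult_inj => x; apply: csub_val_inj; rewrite /= uM amulA.
- have h s x : csub_val (lmult (star (strict_mult s)) x) = u s^-1%g ** csub_val x :> D.
    by rewrite /= starM uV starK.
  move=> s; split; apply: lmult_inj => x; apply: csub_val_inj.
    by rewrite -[lmult _ x]/(lmult (star (strict_mult s)) (lmult (strict_mult s) x)) h /= amulA -uM mulVg u1l.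
  rewrite -[lmult _ x]/(lmult (strict_mult s) (lmult (star (strict_mult s)) x)).
  by rewrite -[LHS]/(u s ** csub_val (lmult (star (strict_mult s)) x)) h amulA -uM mulgV u1l.
- move=> b; have [bl br] := csub_valS b; split=> s; apply/cvgrPdist_lt => e e0.
    by move/cvgrPdist_lt : (bl s) => /(_ e e0).
  by move/cvgrPdist_lt : (br s) => /(_ e e0).
Qed.

Lemma strict_part : exists (B0 : cstarAlgType R) (v : G -> mult B0) (i : B0 -> D),
  [/\ unitary_hom v, star_hom i, forall b, `|i b| = `|b|,
      forall s b, i (lmult (v s) b) = u s ** i b & forall x, strict_set x -> exists b, i b = x].
Proof.
exists B, strict_mult, (@csub_val R D strict_sub); split=> //.
- exact: strict_unitary.
- by move=> x xs; exists (csub_mk (S := strict_sub) xs).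
Qed.

End StrictPart.

(** * The regular representation *)

Section GroupRepresentation.
Variables (R : realType) (G : topGroupType) (V : semi_inner R) (lam : G -> V -> V).
Local Notation K := R[i].
Hypotheses (lam_lin : forall s, linear (lam s))
  (lamM : forall s t v, lam (s * t)%g v = lam s (lam t v))
  (lam1 : forall v, lam 1%g v = v)
  (lam_ip : forall s v w, si_ip (lam s v) (lam s w) = si_ip v w)
  (lam_cont : forall v (e : K), 0 < e -> \forall s \near (1%g : G), si_norm (lam s v - v) <= e).

Lemma group_representation : exists (H : hilbert R) (j : V -> H) (u : G -> bop H),
  [/\ forall v w, inner (j v) (j w) = si_ip v w, forall s v, u s (j v) = j (lam s v),
      forall s t, u (s * t)%g = u s ** u t, forall s, star (u s) = u s^-1%g
    & forall x, u 1%g x = x /\ continuous (fun s => u s x : H)].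
Proof.
have [H [j [jl ji jd]]] := hilbert_completion V.
have jn v : `|j v| = si_norm v.
  by apply/eqP; rewrite -(@eqrXn2 _ 2) ?si_norm_ge0 // -inner_norm ji si_norm2.
have jd' x (e : K) : 0 < e -> exists l, `|x - comb j l| < e.
  by move=> e0; have [v xv] := jd x e e0; exists [:: (1, v)]; rewrite comb1.
have /choice[U UP] : forall s, exists U : H -> H, [/\ linear U, forall v, U (j v) = j (lam s v)
    & forall x, `|U x| <= 1 * `|x|].
  move=> s; apply: (blin_ext jd') => // l; rewrite mul1r.
  have -> : comb (fun v => j (lam s v)) l = j (lam s (comb id l)).
    by rewrite (lin_comb (lam_lin s)) (lin_comb jl).
  have -> : comb j l = j (comb id l) by rewrite (lin_comb jl).
  by rewrite !jn /si_norm lam_ip.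
have Ub s : blin (U s) by case: (UP s) => l _ b; split=> //; exists 1.
have Uj s v : U s (j v) = j (lam s v) by case: (UP s).
have lamV s v w : si_ip w (lam s v) = si_ip (lam s^-1%g w) v.
  by rewrite -(lam_ip s (lam s^-1%g w)) -lamM mulgV lam1.
have adj s : adjoints (U s) (U s^-1%g).
  move=> x y; move: x; apply: (gen_ind jd') => [|v].
    apply: (@csubm_eq _ _ (K^o)); last exact: blin_inner.
    exact: (blin_comp (blin_inner y) (Ub s)).
  rewrite Uj innerC [RHS]innerC; congr (_ ^*)%R; move: y; apply: (gen_ind jd') => [|w].
    apply: (@csubm_eq _ _ (K^o)); first exact: blin_inner.
    exact: (blin_comp (blin_inner _) (Ub _)).
  by rewrite Uj !ji lamV.
pose u s := bop_of ler01 (adj s) (let: And3 _ _ b := UP s in b).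
have uU s x : u s x = U s x by [].
have UM s t x : U (s * t)%g x = U s (U t x).
  move: x; apply: (gen_ind jd') => [|v]; last by rewrite !Uj lamM.
  by apply: csubm_eq => //; exact: blin_comp.
have U1 x : U 1%g x = x.
  move: x; apply: (gen_ind jd') => [|v]; last by rewrite Uj lam1.
  by apply: csubm_eq => //; exact: blin_id.
exists H, j, u; split=> //.
- by move=> s t; apply: bop_eq => x; exact: UM.
- by move=> s; apply: bop_star_eq; exact: adj.
move=> x; split; first exact: U1.
move=> s0; apply/cvgrPdist_lt => e e0.
have e4 : 0 < e / 4 by rewrite divr_gt0.
have [v xv] := jd x _ e4.
have := lam_cont v e4 => h.
have h' : \forall s \near s0, si_norm (lam (s0^-1 * s)%g v - v) <= e / 4 by exact: (nbhs_translate s0 h).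
apply: filterS h' => s sv; rewrite !uU.
have Un t y : `|U t y| <= `|y| by rewrite -[leRHS]mul1r; case: (UP t).
have -> : U s0 x - U s x = U s0 ((x - j v) - (j (lam (s0^-1 * s)%g v) - j v) - U (s0^-1 * s)%g (x - j v)).
  have bl := blin_lin (Ub s0); have bl' := blin_lin (Ub (s0^-1 * s)%g).
  rewrite (linB bl') Uj !(linB bl) -UM mulVKg; lmod.
apply: le_lt_trans (Un _ _) _; rewrite [ltRHS](_ : e = e / 4 + e / 4 + e / 4 + e / 4); last by field.
rewrite ltr_pwDr //; apply: le_trans (ler_normB _ _) _; rewrite lerD //; last first.
  by apply: le_trans (Un _ _) _; exact: ltW.
apply: le_trans (ler_normB _ _) _; rewrite lerD //; first exact: ltW.
by rewrite -(linB jl) jn.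
Qed.

End GroupRepresentation.

Section CompactlySupported.
Variables (R : realType) (G : topGroupType).
Hypotheses (hG : hausdorff_space G) (lG : locally_compact [set: G]).
Local Notation K := R[i].
Local Notation Re := complex.Re.
Local Notation Im := complex.Im.

Lemma Re_cvg (f : G -> K) : continuous (f : G -> K^o) -> continuous (fun s => Re (f s)).
Proof.
move=> fc s; apply/cvgrPdist_lt => e e0.
have e1 : 0 < e%:C :> K by rewrite ltcR.
move/cvgrPdist_lt : (fc s) => /(_ _ e1); apply: filterS => t /=.
rewrite normcE_real ltcR -raddfB; apply: le_lt_trans; exact: Re_le_normc.
Qed.

Lemma Im_cvg (f : G -> K) : continuous (f : G -> K^o) -> continuous (fun s => Im (f s)).
Proof.
move=> fc s; apply/cvgrPdist_lt => e e0.
have e1 : 0 < e%:C :> K by rewrite ltcR.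
move/cvgrPdist_lt : (fc s) => /(_ _ e1); apply: filterS => t /=.
rewrite normcE_real ltcR -raddfB; apply: le_lt_trans; exact: Im_le_normc.
Qed.

Lemma uniform_continuityC (f : G -> K) : continuous (f : G -> K^o) -> compact_support f ->
  forall e : K, 0 < e -> exists2 V, nbhs (1%g : G) V &
    forall s u, V (u^-1 * s)%g -> `|f s - f u| <= e.
Proof.
move=> fc fC e /gt0_realc[-> e0]; have e2 : 0 < Re e / 2 by rewrite divr_gt0.
have sR : compact_support (fun s => Re (f s)).
  by apply: compact_support_le fC _ => s; apply: contraNN => /eqP ->.
have sI : compact_support (fun s => Im (f s)).
  by apply: compact_support_le fC _ => s; apply: contraNN => /eqP ->.
have [V V1 hV] := uniform_continuity (Re_cvg fc) sR e2.
have [W W1 hW] := uniform_continuity (Im_cvg fc) sI e2.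
exists (V `&` W); first exact: filterI.
move=> s u [Vs Ws]; rewrite normcE_real lecR; apply: le_trans (normc_le_ReIm _) _.
rewrite (splitr (Re e)); have := hV _ _ Vs; have := hW _ _ Ws.
by case: (f s) => a b; case: (f u) => c d /= h1 h2; rewrite lerD.
Qed.

Definition cc_pred : {pred G -> K} := fun f =>
  `[< continuous (f : G -> K^o) /\ compact_support f >].

Lemma cc_submod : submod_closed cc_pred.
Proof.
split.
  apply/asboolP; split; first by move=> s; exact: cvg_cst.
  by exists set0; [exact: compact0|move=> s; rewrite eqxx].
move=> a f g /asboolP[fc fv] /asboolP[gc gv]; apply/asboolP; split.
  move=> s; apply: (@cvgD K K^o); last exact: gc.
  by apply: (@cvgZr K K^o); exact: fc.
apply: (compact_supportD _ gv); apply: compact_support_le fv _ => s.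
by apply: contraNN => /eqP fs; rewrite -[(a *: f) s]/(a * f s) fs mulr0.
Qed.

HB.instance Definition _ := GRing.isSubmodClosed.Build K (G -> K) cc_pred cc_submod.

Record cc := CC { cc_fun :> G -> K ; cc_funP : cc_fun \in cc_pred }.

HB.instance Definition _ := [isSub for cc_fun].
HB.instance Definition _ := [Choice of cc by <:].
HB.instance Definition _ := [SubChoice_isSubLmodule of cc by <:].

Implicit Types f g h : cc.

Lemma cc_eq f g : (forall s, f s = g s) -> f = g.
Proof. by move=> fg; apply: val_inj; apply/funext. Qed.

Lemma cc_cvg f : continuous (f : G -> K^o).
Proof. by have /asboolP[] := cc_funP f. Qed.

Lemma cc_support f : compact_support f.
Proof. by have /asboolP[] := cc_funP f. Qed.

Lemma cc_translate_subproof t f : (fun s => f (t^-1 * s)%g) \in cc_pred.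
Proof.
apply/asboolP; split; last exact: compact_support_translate (cc_support f).
exact: (@continuous_translate G K^o f t (@cc_cvg f)).
Qed.

Definition cc_translate t f : cc := CC (cc_translate_subproof t f).

(** Uniform continuity of [s |-> f s^-1]: inversion exchanges the two uniform structures, and left
    translation needs this one. *)
Lemma right_uniform_continuity f (e : K) : 0 < e -> exists2 V, nbhs (1%g : G) V &
  forall s t, V s -> `|f (s^-1 * t)%g - f t| <= e.
Proof.
move=> e0; have [||V V1 hV] := @uniform_continuityC (fun s => f s^-1%g) _ _ e e0.
- move=> s; exact: (cvg_comp _ _ (@invg_continuous G s) (@cc_cvg f s^-1%g)).
- have [C cC fC] := cc_support f; exists ((fun s => s^-1)%g @` C).
    by apply: continuous_compact => //; apply: continuous_subspaceT; exact: invg_continuous.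
  by move=> s /fC Cs; exists s^-1%g => //; rewrite invgK.
exists V => // s t Vs; have := hV (t^-1 * s)%g t^-1%g.
by rewrite invgK mulVKg invgM invgK; exact.
Qed.

(** * The L2 semi-inner product of an invariant integral *)

Section Integral.
Variable I : (G -> R) -> R.
Hypotheses (I_ge0 : forall f : G -> R, ccp f -> 0 <= I f)
  (ID : forall f g : G -> R, ccp f -> ccp g -> I (fun s => f s + g s) = I f + I g)
  (IZ : forall c (f : G -> R), 0 <= c -> ccp f -> I (fun s => c * f s) = c * I f)
  (IT : forall t (f : G -> R), ccp f -> I (fun s => f (t^-1 * s)%g) = I f).

Definition rcc (f : G -> R) := continuous f /\ compact_support f.

Let pp (f : G -> R) s := Num.max (f s) 0.

Lemma ccp_pos_part (f : G -> R) : rcc f -> ccp (pp f).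
Proof.
move=> [fc fC]; split.
- by move=> s; exact: (@continuous_max _ _ f (fun=> 0) s (fc s) (cvg_cst _)).
- by move=> s; rewrite /pp le_max lexx orbT.
- by apply: compact_support_le fC _ => s; apply: contraNN => /eqP; rewrite /pp => ->; rewrite maxxx.
Qed.

Lemma rcc_lin (a : R) (f g : G -> R) : rcc f -> rcc g -> rcc (fun s => a * f s + g s).
Proof.
move=> [fc fC] [gc gC]; split.
  by move=> s; apply: cvgD; [apply: cvgM; [exact: cvg_cst|exact: fc]|exact: gc].
apply: compact_supportD => //; apply: compact_support_le fC _ => s.
by apply: contraNN => /eqP ->; rewrite mulr0.
Qed.

Lemma rcc0 : rcc (fun=> 0).
Proof. by have [c _ s] := @ccp0 R G. Qed.

Lemma rccN (f : G -> R) : rcc f -> rcc (fun s => - f s).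
Proof.
by move=> fP; have := rcc_lin (-1) fP rcc0; congr rcc; apply/funext => s; rewrite mulN1r addr0.
Qed.

Lemma ccp_rcc (f : G -> R) : ccp f -> rcc f. Proof. by case. Qed.

Lemma I_mono (f g : G -> R) : ccp f -> ccp g -> (forall s, f s <= g s) -> I f <= I g.
Proof.
move=> fP gP fg; have dP : ccp (fun s => g s - f s).
  have [c s] := rcc_lin (-1) (ccp_rcc fP) (ccp_rcc gP).
  have E : (fun s => -1 * f s + g s) = (fun s => g s - f s).
    by apply/funext => t; rewrite mulN1r addrC.
  by rewrite E in c s; split=> // t; rewrite subr_ge0.
have -> : I g = I f + I (fun s => g s - f s).
  by rewrite -ID //; congr I; apply/funext => s; rewrite addrC subrK.
by rewrite lerDl I_ge0.
Qed.

Definition Jr (f : G -> R) : R := I (pp f) - I (pp (fun s => - f s)).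

(** The positive part plus [b] equals the negative part plus [a] pointwise, and [I] is additive on
    nonnegative functions. Linearity of [Jr] is read off convenient decompositions. *)
Lemma Jr_eq (f a b : G -> R) : rcc f -> ccp a -> ccp b -> (forall s, f s = a s - b s) ->
  Jr f = I a - I b.
Proof.
move=> fP aP bP fab; have p1 := ccp_pos_part fP; have p2 := ccp_pos_part (rccN fP).
apply/eqP; rewrite subr_eq addrAC eq_sym subr_eq -!ID //; apply/eqP; congr I.
apply/funext => s; rewrite /pp fab; have [h|h] := leP (a s) (b s).
  rewrite (max_idPr (_ : a s - b s <= 0)) ?subr_le0 //.
  by rewrite (max_idPl (_ : 0 <= - (a s - b s))) ?oppr_ge0 ?subr_le0 //; ring.
rewrite (max_idPl (_ : 0 <= a s - b s)) ?subr_ge0 ?ltW //.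
by rewrite (max_idPr (_ : - (a s - b s) <= 0)) ?oppr_le0 ?subr_ge0 ?ltW //; ring.
Qed.

Lemma I0 : I (fun=> 0) = 0.
Proof. by have := IZ (lexx 0) (@ccp0 R G); rewrite !mul0r. Qed.

Lemma Jr_ccp (f : G -> R) : ccp f -> Jr f = I f.
Proof.
move=> fP; rewrite (Jr_eq (ccp_rcc fP) fP (@ccp0 R G)) ?I0 ?subr0 // => s.
by rewrite subr0.
Qed.

Lemma Jr_lin (c : R) (f g : G -> R) : rcc f -> rcc g ->
  Jr (fun s => c * f s + g s) = c * Jr f + Jr g.
Proof.
move=> fP gP; have p1 := ccp_pos_part fP; have p2 := ccp_pos_part (rccN fP).
have p3 := ccp_pos_part gP; have p4 := ccp_pos_part (rccN gP).
have ppE (x : R) : x = Num.max x 0 - Num.max (- x) 0.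
  have [h|h] := leP x 0.
    by rewrite (max_idPl _) ?oppr_ge0 // sub0r opprK.
  by rewrite (max_idPr _) ?subr0 // oppr_le0 ltW.
have [c0|c0] := leP 0 c.
  rewrite (@Jr_eq _ (fun s => c * pp f s + pp g s) (fun s => c * pp (fun s => - f s) s + pp (fun s => - g s) s)).
  - rewrite !ID ?IZ //; try exact: ccpZ.
    by rewrite /Jr; ring.
  - exact: rcc_lin.
  - by apply: ccpD => //; exact: ccpZ.
  - by apply: ccpD => //; exact: ccpZ.
  - by move=> s; rewrite {1}(ppE (f s)) {1}(ppE (g s)) /pp; ring.
have c1 : 0 <= - c by rewrite oppr_ge0 ltW.
rewrite (@Jr_eq _ (fun s => - c * pp (fun s => - f s) s + pp g s) (fun s => - c * pp f s + pp (fun s => - g s) s)).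
- rewrite !ID ?IZ //; try exact: ccpZ.
  by rewrite /Jr; ring.
- exact: rcc_lin.
- by apply: ccpD => //; exact: ccpZ.
- by apply: ccpD => //; exact: ccpZ.
- by move=> s; rewrite {1}(ppE (f s)) {1}(ppE (g s)) /pp; ring.
Qed.

Lemma JrN (f : G -> R) : rcc f -> Jr (fun s => - f s) = - Jr f.
Proof.
move=> fP; have := Jr_lin (-1) fP rcc0; rewrite (Jr_ccp (@ccp0 R G)).
rewrite I0 addr0 mulN1r => <-; congr Jr; apply/funext => s; by rewrite addr0 mulN1r.
Qed.

Lemma Jr_translate t (f : G -> R) : rcc f -> Jr (fun s => f (t^-1 * s)%g) = Jr f.
Proof.
move=> fP; rewrite /Jr -(IT t (ccp_pos_part fP)) -(IT t (ccp_pos_part (rccN fP))).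
by [].
Qed.

Lemma Jr_bound (f g : G -> R) : rcc f -> ccp g -> (forall s, `|f s| <= g s) -> `|Jr f| <= I g.
Proof.
move=> fP gP fg; have p1 := ccp_pos_part fP; have p2 := ccp_pos_part (rccN fP).
have g0 s : 0 <= g s by case: gP.
have h1 : I (pp f) <= I g.
  by apply: I_mono => // s; rewrite ge_max g0 andbT; apply: le_trans (fg s); exact: ler_norm.
have h2 : I (pp (fun s => - f s)) <= I g.
  apply: I_mono => // s; rewrite ge_max g0 andbT; apply: le_trans (fg s).
  by rewrite -normrN; exact: ler_norm.
rewrite /Jr ler_norml; have := I_ge0 p1; have := I_ge0 p2; lra.
Qed.

Definition JC (f : G -> K) : K := Jr (fun s => Re (f s)) +i* Jr (fun s => Im (f s)).

Lemma rcc_Re (f : G -> K) : f \in cc_pred -> rcc (fun s => Re (f s)).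
Proof.
move=> /asboolP[fc fC]; split; first exact: Re_cvg.
by apply: compact_support_le fC _ => s; apply: contraNN => /eqP ->.
Qed.

Lemma rcc_Im (f : G -> K) : f \in cc_pred -> rcc (fun s => Im (f s)).
Proof.
move=> /asboolP[fc fC]; split; first exact: Im_cvg.
by apply: compact_support_le fC _ => s; apply: contraNN => /eqP ->.
Qed.

Lemma JC_lin (k : K) (f g : G -> K) : f \in cc_pred -> g \in cc_pred ->
  JC (fun s => k * f s + g s) = k * JC f + JC g.
Proof.
move=> fP gP; have fR := rcc_Re fP; have fI := rcc_Im fP; have gR := rcc_Re gP; have gI := rcc_Im gP.
case: k => a b; apply/eqP; rewrite eq_complex /=; apply/andP; split; apply/eqP.
  have -> : (fun s => Re ((a +i* b) * f s + g s)) =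
      fun s => a * Re (f s) + (- b * Im (f s) + Re (g s)).
    by apply/funext => s; case: (f s) => x y; case: (g s) => z w /=; ring.
  rewrite !Jr_lin //; last exact: rcc_lin.
  by ring.
have -> : (fun s => Im ((a +i* b) * f s + g s)) =
    fun s => a * Im (f s) + (b * Re (f s) + Im (g s)).
  by apply/funext => s; case: (f s) => x y; case: (g s) => z w /=; ring.
rewrite !Jr_lin //; last exact: rcc_lin.
by ring.
Qed.

Lemma JC_conj (f : G -> K) : f \in cc_pred -> JC (fun s => conjc (f s)) = conjc (JC f).
Proof.
move=> fP; apply/eqP; rewrite eq_complex /= -JrN; last exact: rcc_Im.
by apply/andP; split; apply/eqP; congr Jr; apply/funext => s; case: (f s).
Qed.

Lemma JC_real (f : G -> R) : ccp f -> JC (fun s => (f s)%:C) = (I f)%:C.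
Proof.
move=> fP; apply/eqP; rewrite eq_complex /= -(Jr_ccp fP) eqxx /=.
by have := JrN rcc0; rewrite oppr0 => /eqP; rewrite -addr_eq0 -mulr2n mulrn_eq0.
Qed.

Lemma JC_translate t (f : G -> K) : f \in cc_pred -> JC (fun s => f (t^-1 * s)%g) = JC f.
Proof.
move=> fP; rewrite /JC (Jr_translate t (rcc_Re fP)).
by rewrite (Jr_translate t (rcc_Im fP)).
Qed.

Lemma cc_mul (f : G -> K) g : continuous (f : G -> K^o) -> (fun s => f s * g s) \in cc_pred.
Proof.
move=> fc; apply/asboolP; split.
  by move=> s; apply: (@cvgM K); [exact: fc|exact: cc_cvg].
by apply: compact_support_le (cc_support g) _ => s; apply: contraNN => /eqP ->; rewrite mulr0.
Qed.

Lemma cc_conj_subproof f : (fun s => conjc (f s)) \in cc_pred.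
Proof.
apply/asboolP; split.
  move=> s; apply/cvgrPdist_lt => e e0; move/cvgrPdist_lt : (@cc_cvg f s) => /(_ e e0).
  by apply: filterS => t /=; rewrite -conjCE -[conjc (f t)]conjCE -rmorphB norm_conjC.
by apply: compact_support_le (cc_support f) _ => s; apply: contraNN => /eqP ->; rewrite conjc0.
Qed.

Definition cc_conj f : cc := CC (cc_conj_subproof f).

Definition cc_ip f g : K := JC (fun s => f s * cc_conj g s).

Definition cc_sq f s : R := Re (f s) ^+ 2 + Im (f s) ^+ 2.

Lemma cc_sq_ccp f : ccp (cc_sq f).
Proof.
split.
- move=> s; rewrite /cc_sq; apply: cvgD; under eq_fun do rewrite expr2.
    by rewrite expr2; apply: cvgM; exact: (Re_cvg (@cc_cvg f)).
  by rewrite expr2; apply: cvgM; exact: (Im_cvg (@cc_cvg f)).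
- by move=> s; rewrite addr_ge0 // sqr_ge0.
- apply: compact_support_le (cc_support f) _ => s; apply: contraNN => /eqP fs.
  by rewrite /cc_sq fs /= expr0n /= addr0.
Qed.

Lemma cc_ip_self f : cc_ip f f = (I (cc_sq f))%:C.
Proof.
rewrite -(JC_real (cc_sq_ccp f)); congr JC; apply/funext => s; rewrite /cc_sq /=.
by case: (f s) => a b; apply/eqP; rewrite eq_complex /=; apply/andP; split; apply/eqP; ring.
Qed.

Lemma cc_ip_lin (k : K) f g h : cc_ip (k *: f + g) h = k * cc_ip f h + cc_ip g h.
Proof.
rewrite -JC_lin; try exact: (cc_mul _ (@cc_cvg _)).
by congr JC; apply/funext => s; rewrite mulrDl -mulrA.
Qed.

Lemma cc_ip_conj f g : cc_ip g f = conjc (cc_ip f g).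
Proof.
rewrite -JC_conj; last exact: (cc_mul _ (@cc_cvg _)).
congr JC; apply/funext => s; rewrite -[cc_conj f s]/(conjc (f s)) -[cc_conj g s]/(conjc (g s)).
by case: (f s) => a b; case: (g s) => c d; apply/eqP; rewrite eq_complex /=; apply/andP; split; apply/eqP; ring.
Qed.

Lemma cc_ip_ge0 f : 0 <= cc_ip f f.
Proof. by rewrite cc_ip_self -[0]/(0%:C) lecR I_ge0 //; exact: cc_sq_ccp. Qed.

Definition cc_semi_inner := SemiInner cc_ip_lin cc_ip_conj cc_ip_ge0.

Lemma cc_translate_ip t f g : cc_ip (cc_translate t f) (cc_translate t g) = cc_ip f g.
Proof. by rewrite /cc_ip -(JC_translate t (cc_mul (cc_conj g) (@cc_cvg f))). Qed.

Lemma cc_translate_cvg f (e : K) : 0 < e ->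
  \forall s \near (1%g : G), @si_norm R cc_semi_inner (cc_translate s f - f : cc) <= e.
Proof.
move=> /gt0_realc[-> e0]; set r := Re e in e0 *.
have [C cC fC] := cc_support f; have [W W1 cW] := compact_nbhs lG (1%g : G).
(* For all [s] in [W] the difference of [f] and its translate vanishes outside [C] and [W C]. On
   this fixed compact set [k >= 1], so uniform smallness bounds the integral by a multiple of
   [I k]. *)
have cWC : compact ((fun p : G * G => (p.1 * p.2)%g) @` (W `*` C)).
  apply: continuous_compact; last exact: compact_setX.
  by apply: continuous_subspaceT; exact: mulg_continuous.
have [k kP k1] := bump_compact R hG lG (compactU cC cWC).
have [_ k0 _] := kP.
have Ik : 0 <= I k by exact: I_ge0.
pose d := r / (I k + 1 + r).
have den : 0 < I k + 1 + r by lra.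
have d0 : 0 < d by rewrite divr_gt0.
have dI : d ^+ 2 * (2 * I k) <= 2 * r ^+ 2.
  rewrite /d expr_div_n mulrAC ler_pdivrMr ?exprn_gt0 //.
  have r2 : 0 <= r ^+ 2 by rewrite sqr_ge0.
  rewrite [leRHS](_ : _ = r ^+ 2 * (2 * (I k + 1 + r) ^+ 2)); last by ring.
  by rewrite ler_wpM2l //; nra.
have [V V1 hV] := @right_uniform_continuity f (d%:C) (ltac:(by rewrite ltcR)).
apply: filterS (filterI V1 W1) => s [Vs Ws].
apply: sqr_le; [exact: si_norm_ge0|by rewrite lecR ltW|].
rewrite si_norm2 [si_ip _ _]cc_ip_self -rmorphXn lecR.
have key : I (cc_sq (cc_translate s f - f)) <= I (fun t => d ^+ 2 * k t).
  apply: I_mono; [exact: cc_sq_ccp|by apply: ccpZ => //; exact: sqr_ge0|move=> t].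
  have dd := hV s t Vs.
  have E : (cc_translate s f - f) t = f (s^-1 * t)%g - f t by [].
  have sq : cc_sq (cc_translate s f - f) t <= d ^+ 2.
    move: dd; rewrite /cc_sq E; case: (f (s^-1 * t)%g - f t) => a b /=.
    rewrite normcE_real lecR /= => h.
    have : Num.sqrt (a ^+ 2 + b ^+ 2) ^+ 2 <= d ^+ 2 by rewrite lerXn2r ?nnegrE ?sqrtr_ge0 // ltW.
    by rewrite sqr_sqrtr // addr_ge0 // sqr_ge0.
  have [z|nz] := eqVneq (cc_sq (cc_translate s f - f) t) 0.
    by rewrite z mulr_ge0 ?sqr_ge0.
  apply: le_trans sq _; rewrite ler_pMr ?exprn_gt0 //; apply: k1.
  have [ft|ft] := eqVneq (f t) 0; last by left; exact: fC.
  right; have fst' : f (s^-1 * t)%g != 0.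
    by apply: contraNN nz => /eqP fs; rewrite /cc_sq E ft fs subrr /= expr0n /= addr0.
  by exists (s, (s^-1 * t)%g); [split=> //=; exact: fC|rewrite /= mulVKg].
by apply: le_trans key _; rewrite IZ ?sqr_ge0 //; lra.
Qed.

End Integral.

(* A convolution of [h] with an approximate unit is a matrix coefficient of the
   regular representation. *)
Lemma approximate_coefficient h (e : K) : 0 < e ->
  exists (H : hilbert R) (u : G -> bop H) (x y : H),
    [/\ forall s t, u (s * t)%g = u s ** u t, forall s, star (u s) = u s^-1%g,
      forall x, u 1%g x = x /\ continuous (fun s => u s x : H)
    & forall s, `|h s - inner (u s x) y| <= e].
Proof.
move=> e0; have e2 : 0 < e / 2 by rewrite divr_gt0.
have [V V1 hV] := uniform_continuityC (@cc_cvg h) (cc_support h) e2.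
have [g [gc g01 g1 [C cC gC]]] := bump_function R hG lG V1.
have gP : ccp g.
  by split=> //; [move=> s; case/andP: (g01 s)|exists C => // s /gC[]].
(* Normalizing at the bump [g] itself gives [I g = 1], so that integrating against [g] is an average
   over [V]. *)
have [I [Ige0 ID IZ IT Ig]] := haar_functional hG lG gP (s0 := 1%g) ltac:(by rewrite g1).
have gcc : (fun s => (g s)%:C) \in cc_pred.
  apply/asboolP; split; first exact: realC_continuous.
  have [_ _ sg] := gP; apply: compact_support_le sg _ => s.
  by apply: contraNN => /eqP ->.
pose V' := cc_semi_inner Ige0 ID IZ.
pose lam : G -> V' -> V' := cc_translate.
have [||||H [j [u [ji uj uM uV u1]]]] := @group_representation R G V' lam _ _ _ _ (fun v e e0 => cc_translate_cvg Ige0 ID IZ v e0).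
- by move=> s k f1 f2; exact: cc_eq.
- by move=> s t v; apply: cc_eq => r; rewrite /= invgM mulgA.
- by move=> v; apply: cc_eq => r; rewrite /= invg1 mul1g.
- by move=> s v w; exact: (cc_translate_ip IT).
exists H, u, (j (CC gcc)), (j (cc_conj h)); split=> // s.
rewrite uj ji.
(* By invariance the coefficient at [s] is the integral of [F], an average of [h] over [s V]. *)
pose F t := (g t)%:C * h (s * t)%g.
have hs : (fun t => h (s * t)%g) \in cc_pred.
  by have := cc_translate_subproof s^-1%g h; rewrite invgK.
have FP : F \in cc_pred.
  by apply: (cc_mul (CC hs)); exact: realC_continuous.
have -> : si_ip (lam s (CC gcc)) (cc_conj h : V') = JC I F.
  rewrite -(JC_translate IT s FP); apply: (congr1 (JC I)); apply/funext => t.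
  by rewrite /F /= conjcK mulVKg.
have -> : h s - JC I F = - JC I (fun t => - h s * (g t)%:C + F t).
  by rewrite (JC_lin ID IZ) // (JC_real ID IZ) // Ig; ring.
rewrite normrN; set D := fun t => _.
have DP : D \in cc_pred by have [_ h2] := cc_submod; exact: (h2 (- h s) _ _ gcc FP).
have Db t : Normc.normc (D t) <= Re (e / 2) * g t.
  have g0 : 0 <= g t by case/andP: (g01 t).
  have -> : D t = (g t)%:C * (h (s * t)%g - h s) by rewrite /D /F; ring.
  have [gt|gt] := eqVneq (g t) 0.
    by rewrite gt mul0r mulr0 -lecR -normcE_real normr0.
  rewrite -lecR -normcE_real normrM ger0_norm; last by rewrite lecR.
  rewrite rmorphM mulrC ler_wpM2r ?lecR //.
  have [eE _] := gt0_realc e2; rewrite -lecR -normcE_real -eE; apply: hV; rewrite mulKg.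
  by case: (gC t gt).
have [eE er0] := gt0_realc e2.
have BP : ccp (fun t => Re (e / 2) * g t) by apply: ccpZ => //; exact: ltW.
have IB : I (fun t => Re (e / 2) * g t) = Re (e / 2) by rewrite IZ ?Ig ?mulr1 // ltW.
rewrite normcE_real [leRHS](_ : e = (Re (e / 2) + Re (e / 2))%:C); last first.
  by move: (Re (e / 2)) eE => r er; rewrite [LHS]splitr er -rmorphD.
rewrite lecR; apply: le_trans (normc_le_ReIm _) _.
apply: lerD; rewrite -[leRHS]IB; apply: (Jr_bound Ige0 ID) => //.
- exact: rcc_Re.
- by move=> t; apply: le_trans (Re_le_normc _) (Db t).
- exact: rcc_Im.
- by move=> t; apply: le_trans (Im_le_normc _) (Db t).
Qed.

End CompactlySupported.

(** * Coefficient functions of the group algebra *)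

Section CoefficientDensity.
Variables (R : realType) (tens : forall A B : cstarAlgType R, min_tensor A B).
Variables (G : topGroupType) (CG : group_cstar R G).
Hypotheses (hG : hausdorff_space G) (lG : locally_compact [set: G]).
Local Notation K := R[i].

Lemma c0_near_cc (h : c0 R G) (e : K) : 0 < e ->
  exists f : cc R G, forall s, `|h s - f s| <= e.
Proof.
move=> e0; have [C cC Ce] := c0_vanish h e0.
have [k kP k1] := bump_compact R hG lG cC; have [kc k0 kC] := kP.
pose m s := Num.min (k s) 1.
have mc : continuous m by move=> s; exact: (@continuous_min _ _ k (fun=> 1) s (kc s) (cvg_cst _)).
have m01 s : 0 <= m s <= 1 by rewrite /m le_min k0 ler01 ge_min lexx orbT.
have fP : (fun s => h s * (m s)%:C) \in @cc_pred R G.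
  apply/asboolP; split.
    by move=> s; apply: (@cvgM K); [exact: c0_continuous|exact: realC_continuous].
  apply: compact_support_le kC _ => s; apply: contraNN => /eqP ks.
  by rewrite /m ks (min_idPl ler01) mulr0.
exists (CC fP) => s; rewrite -[CC fP s]/(h s * (m s)%:C).
have [Cs|nCs] := pselect (C s).
  by rewrite /m (min_idPr (k1 s Cs)) mulr1 subrr normr0 ltW.
have /andP[m0 m1] := m01 s.
have -> : h s - h s * (m s)%:C = h s * (1 - m s)%:C by rewrite rmorphB /=; ring.
rewrite normrM; apply: le_trans (ltW (Ce s nCs)); rewrite ler_piMr //.
have -> : 1 = (1 : R)%:C :> K by [].
by rewrite ger0_norm lecR ?subr_ge0 // lerBlDr lerDl.
Qed.

(** A group element is a multiplier of [CG], so a functional reaches it only between factors [c']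
    and [c1 ** c2] from approximate units. Two right factors are kept because [mu_ideal] puts [c1]
    into the argument of [wG] and leaves [c2] in the vector. *)
Lemma coefficient_density (h : c0 R G) (e : K) : 0 < e ->
  exists (om : CG -> K^o) (c' c1 c2 : CG), blin om /\
    forall s, `|h s - om (c' ** lmult (gc_unit CG s) (c1 ** c2))| <= e.
Proof.
move=> e0; have e3 : 0 < e / 3 by rewrite divr_gt0.
have [f hf] := c0_near_cc h e3.
have [H [u [x [y [uM uV u1 fu]]]]] := approximate_coefficient hG lG f e3.
have u1l (T : bop H) : u 1%g ** T = T by apply: bop_eq => z; rewrite bopM; case: (u1 (T z)).
have xc z s0 : (fun s => u s z : H) @ s0 --> u s0 z by case: (u1 z) => _; exact.
have r1 (z w : H) : strict_set u (rank1 z w).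
  split=> s; apply/cvgrPdist_lt => d d0.
    have d1 : 0 < d / (`|w| + 1) by rewrite divr_gt0 // ltr_wpDl.
    move/cvgrPdist_lt : (xc z s) => /(_ _ d1); apply: filterS => t zt.
    rewrite !mul_rank1 rank1Bl; apply: le_lt_trans (rank1_norm _ _) _.
    move: zt; rewrite ltr_pdivlMr ?ltr_wpDl // => zt; apply: le_lt_trans zt.
    by rewrite ler_wpM2l // lerDl.
  have d1 : 0 < d / (`|z| + 1) by rewrite divr_gt0 // ltr_wpDl.
  have wc : (fun s => u s^-1%g w : H) @ s --> u s^-1%g w.
    exact: (cvg_comp _ _ (@invg_continuous G s) (xc w s^-1%g)).
  move/cvgrPdist_lt : wc => /(_ _ d1); apply: filterS => t wt.
  rewrite !rank1_mul rank1Br !uV; apply: le_lt_trans (rank1_norm _ _) _.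
  move: wt; rewrite ltr_pdivlMr ?ltr_wpDl // => wt; apply: le_lt_trans wt.
  by rewrite mulrC ler_wpM2l // lerDl.
have [B0 [v [i [vu hi ni iv ix]]]] := strict_part uM u1l uV.
have [phi [[hphi nphi phiv] _]] := gc_univ CG vu.
have [b1 b1i] := ix _ (r1 x y); have [b2 b2i] := ix _ (r1 x x).
have [il im _] := hi.
pose n := inner x x.
(* With [b1], [b2] the rank-one operators of [x, y] and [x, x], the product [b1 (u s) b2] sends [x]
   to [n <u s x, y> x]; pairing with [x] produces a second [n]. If [n = 0] then [x = 0] and both
   sides of [Omv] vanish. *)
pose Om (T : B0) : K^o := inner (i T x) x / n ^+ 2.
have bOm : blin Om.
  split=> [k T T'|].
    by rewrite /Om il -[(_ + _ : bop H) x]/(k *: i T x + i T' x) inner_lin mulrDl -mulrA.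
  exists (`|x| * `|x| / `|n ^+ 2|) => [|T]; first by rewrite !mulr_ge0 ?invr_ge0.
  rewrite /Om normrM normfV mulrAC ler_wpM2r ?invr_ge0 //.
  apply: le_trans (inner_CS _ _) _; rewrite mulrAC ler_wpM2r //.
  by rewrite mulrC -ni; exact: bop_norm_bound.
have Omv s : Om (b1 ** lmult (v s) b2) = inner (u s x) y.
  rewrite /Om im iv b1i b2i.
  rewrite mul_rank1 mul_rank1 -[rank1 _ x x]/(inner x x *: _) -[rank1 x y _]/(inner _ y *: x).
  rewrite !innerZl -/n; have [n0|n0] := eqVneq n 0; last by field.
  have x0 : x = 0 by apply/eqP; rewrite -normr_eq0 -sqrf_eq0 -inner_norm -/n n0.
  by rewrite n0 mul0r mul0r x0 (lin0 (bop_linear _)) inner0l.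
have [_ [N N0 OmN]] := bOm.
(* Replacing [b1], [b2] by [b1'], [b2'] costs [d |b2| + (|b1| + 1) (2 d)]; the [2 d] arises because
   [b2] is approximated twice, by [c2] and then [c1]. *)
have [d [d0 d1 dN]] := @exists_small R (N * (`|b2| + 2 * `|b1| + 2)) (e / 3) ltac:(by rewrite mulr_ge0 // !addr_ge0 // mulr_ge0) e3.
have [c' [c'1 _]] := nondegenerate_near_unit tens hphi nphi (star b1) d0.
have [c2 [c21 _]] := nondegenerate_near_unit tens hphi nphi b2 d0.
have [c1 [c11 _]] := nondegenerate_near_unit tens hphi nphi (lmult (phi c2) b2) d0.
pose om (c : CG) : K^o := Om (b1 ** lmult (phi c) b2).
exists om, (star c'), c1, c2; split.
  apply: (blin_comp bOm); apply: (blin_comp (blin_mull b1)).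
  exact: (hom_lmult_blinl tens hphi b2).
move=> s; pose b2' := lmult (phi c1) (lmult (phi c2) b2).
pose b1' := rmult (phi (star c')) b1.
have b1E : `|b1 - b1'| < d.
  have e1 : star (phi (star c')) = phi c' by rewrite -(hom_star hphi) starK.
  have -> : b1 - b1' = star (star b1 - lmult (phi c') (star b1)).
    by rewrite starB [star (star b1)]starK /b1' (rmult_star (phi (star c')) b1) e1.
  by rewrite norm_star.
have b2E : `|b2 - b2'| <= 2 * d.
  rewrite -(subrKA (lmult (phi c2) b2)) mulr_natl mulr2n.
  by apply: le_trans (ler_normD _ _) _; rewrite lerD // ltW.
have [vE _ _] := mext_unitaryP hphi nphi (gc_mul1 CG s) (gc_mul1' CG s).
have omE : om (star c' ** lmult (gc_unit CG s) (c1 ** c2)) = Om (b1' ** lmult (v s) b2').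
  rewrite /om (homM hphi) -[lmult (_ ** _) _]/(lmult (phi (star c')) (lmult (phi _) b2)).
  rewrite -vE phiv mult_centralizer (homM hphi); congr Om.
rewrite omE -(subrKA (f s)) -[f s - _](subrKA (inner (u s x) y)) addrA.
rewrite [leRHS](_ : e = e / 3 + e / 3 + e / 3); last by field.
apply: le_trans (ler_normD _ _) _; apply: lerD.
  by apply: le_trans (ler_normD _ _) _; rewrite lerD.
apply: le_trans dN; rewrite -Omv -(linB (blin_lin bOm)); apply: le_trans (OmN _) _.
rewrite mulrCA ler_wpM2l //.
have vn z : `|lmult (v s) z| = `|z| by apply: unitary_norm; case: vu => _ vv _; case: (vv s).
have -> : b1 ** lmult (v s) b2 - b1' ** lmult (v s) b2' =
    (b1 - b1') ** lmult (v s) b2 + b1' ** (lmult (v s) b2 - lmult (v s) b2') by alg.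
apply: le_trans (ler_normD _ _) _.
rewrite [leRHS](_ : _ = d * `|b2| + (`|b1| + 1) * (2 * d)); last by ring.
apply: lerD; apply: le_trans (norm_amul _ _) _.
  by rewrite vn ler_wpM2r // ltW.
rewrite -lmultB vn ler_pM //.
rewrite -(subrKC b1 b1'); apply: le_trans (ler_normD _ _) _; rewrite lerD2l distrC.
by apply: le_trans (ltW b1E) _.
Qed.

End CoefficientDensity.

(** * The extension of [pi (x) id] to [mtilde] *)

Section OneTens.
Variables (R : realType) (tens : forall A B : cstarAlgType R, min_tensor A B).
Variables (G : topGroupType) (CG : group_cstar R G).
Local Notation K := R[i].
Local Notation one A c := (one_tens tens (CG := CG) A c).
Local Notation hid pi := (htens (tens := tens) pi (@to_mult R CG)).

Lemma lmult_star_tmk (A C : cstarAlgType R) (M : mult (tens A C)) (m : mult A) (n : mult C) :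
  (forall a c, lmult M (tmk (tens A C) a c) = tmk (tens A C) (lmult m a) (lmult n c)) ->
  forall a c, lmult (star M) (tmk (tens A C) a c) = tmk (tens A C) (lmult (star m) a) (lmult (star n) c).
Proof.
move=> h a c; apply: amul_injl => z; move: z; apply: (tensor_ind (T := tens A C)) => [|b d].
  by apply: csubm_eq; exact: blin_mulr.
rewrite -(starK b) -(starK d) -star_tmk -mult_adj h star_tmk !tmkM.
by rewrite !mult_adj star_tmk tmkM.
Qed.

Lemma one_tens_tmk (A : cstarAlgType R) (c d : CG) (a : A) :
  lmult (one A c) (tmk (tens A CG) a d) = tmk (tens A CG) a (c ** d).
Proof. by have [-> _] := mtens_right tens A c (to_mult_hom CG). Qed.

Lemma one_tens_hom (A : cstarAlgType R) : star_hom (one_tens tens (CG := CG) A).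
Proof.
split.
- move=> k c d; apply: (lmult_inj_dense (tmk_dense (tens A CG))) => _ [a [e ->]].
  rewrite -[RHS]/(k *: lmult (one A c) _ + lmult (one A d) _) !one_tens_tmk amulDl amulZl.
  exact: (tmk_linr (tens A CG) a).
- move=> c d; apply: (lmult_inj_dense (tmk_dense (tens A CG))) => _ [a [e ->]].
  by rewrite -[RHS]/(lmult (one A c) (lmult (one A d) _)) !one_tens_tmk amulA.
- move=> c; apply: (lmult_inj_dense (tmk_dense (tens A CG))) => _ [a [e ->]].
  rewrite (lmult_star_tmk (m := mult1 A) (n := to_mult c)) => [|b d]; last first.
    by rewrite one_tens_tmk.
  rewrite one_tens_tmk star_mult1; congr tmk.
  by have [_ _ <-] := to_mult_hom CG.
Qed.

Lemma one_tens_nondegenerate (A : cstarAlgType R) : nondegenerate (one_tens tens (CG := CG) A).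
Proof.
apply/seteqP; split=> // x _; have : closed_span [set x | exists a b, x = tmk (tens A CG) a b] x.
  by rewrite tmk_dense.
apply: csubm_min; first exact: csubm_closed_span.
move=> _ [a [c ->]]; have [_ _ cl] := csubm_closed_span [set x | exists c z, x = lmult (one A c) z].
apply: cl => e e0; have a1 : 0 < `|a| + 1 by rewrite ltr_wpDl.
have [|u [uc _]] := near_unit tens [:: c] (e := e / (`|a| + 1)); first by rewrite divr_gt0.
exists (tmk (tens A CG) a (u ** c)).
  by apply: closed_span_incl; exists u, (tmk (tens A CG) a c); rewrite one_tens_tmk.
rewrite -(linB (tmk_linr (tens A CG) a)); apply: le_lt_trans (tmk_norm tens _ _ _) _.
have := uc c (or_introl erefl); rewrite ltr_pdivlMr // => h; apply: le_lt_trans h.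
by rewrite mulrC ler_wpM2l // lerDl.
Qed.

Lemma norm_le_mul (A : cstarAlgType R) (x : A) (r : K) : 0 <= r ->
  (forall z, `|x ** z| <= r * `|z|) -> `|x| <= r.
Proof.
move=> r0 /(_ (star x)); rewrite norm_star2 norm_star expr2.
have [->|n0] := eqVneq `|x| 0; first by [].
by rewrite ler_pM2r // lt_neqAle eq_sym n0 normr_ge0.
Qed.

Section HtensId.
Variables (A B : cstarAlgType R) (pi : A -> mult B).
Hypothesis hpi : star_hom pi.

Let hh := htens_hom tens hpi (to_mult_hom CG).

Lemma htens_one_tensl c (x : tens A CG) : hid pi (lmult (one A c) x) = one B c ** hid pi x.
Proof.
apply: lmult_inj => z; rewrite -[RHS]/(lmult (one B c) (lmult (hid pi x) z)); move: x.
have b1 (D : cstarAlgType R) : blin (lmult (one D c)) by exact: (hom_lmult_blin tens (one_tens_hom D)).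
apply: (tensor_ind (T := tens A CG)) => [|a d].
  apply: csubm_eq.
    by apply: (blin_comp (hom_lmult_blinl tens hh z)); exact: b1.
  by apply: (blin_comp (b1 B)); exact: (hom_lmult_blinl tens hh z).
rewrite one_tens_tmk; move: z; apply: (tensor_ind (T := tens B CG)) => [|b e].
  apply: csubm_eq; first exact: (hom_lmult_blin tens hh).
  by apply: (blin_comp (b1 B)); exact: (hom_lmult_blin tens hh).
by rewrite !htens_tmk //= ?one_tens_tmk ?amulA //; exact: to_mult_hom.
Qed.

Lemma htens_one_tensr c (x : tens A CG) : hid pi (rmult (one A c) x) = hid pi x ** one B c.
Proof.
rewrite rmult_star (hom_star hh) -(hom_star (one_tens_hom A)) htens_one_tensl.
rewrite starM -(hom_star hh) starK -(hom_star (one_tens_hom B)) starK //.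
Qed.

(** For degenerate [pi] there is no extension by [mext]; [X] is prescribed on the vectors
    [(1 (x) c) z] instead. To bound a finite sum of values, insert an approximate unit [u] of [CG]:
    since [m (1 (x) u c)] is [m (1 (x) u)] times [1 (x) c], a single operator of norm at most [2 M]
    factors out. *)
Lemma htens_bar_exists (m : mult (tens A CG)) (M : K) : mtilde m -> 0 <= M ->
  (forall z, `|lmult m z| <= M * `|z|) -> (forall z, `|lmult (star m) z| <= M * `|z|) ->
  exists X, forall c x, to_mult x = m ** one A c -> X ** one B c = hid pi x.
Proof.
move=> mt M0 mM msM.
have /choice[x xE] : forall c, exists x, to_mult x = m ** one A c.
  by move=> c; case: (mt c).
(* The adjoint of [X] rests on the other condition in [mtilde], taken at [star c]. *)
have /choice[y yE] : forall c, exists y, to_mult y = star m ** one A c.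
  move=> c; have [_ [y yE]] := mt (star c); exists (star y).
  have [_ _ ->] := to_mult_hom (tens A CG).
  by rewrite yE starM -(hom_star (one_tens_hom A)) starK.
pose g (p : CG * tens B CG) := lmult (one B p.1) p.2.
have gd z (e : K) : 0 < e -> exists l, `|z - comb g l| < e.
  exact: (nondegenerate_near (one_tens_nondegenerate B)).
have gen (n : mult (tens A CG)) (w : CG -> tens A CG) :
    (forall c, to_mult (w c) = n ** one A c) -> (forall z, `|lmult n z| <= M * `|z|) ->
    forall l, `|comb (fun p : CG * tens B CG => lmult (hid pi (w p.1)) p.2) l| <= 2 * M * `|comb g l|.
  move=> wE nM l.
  have wlin : linear w.
    move=> k c d; apply: to_mult_inj; rewrite wE; have [tl _ _] := to_mult_hom (tens A CG).
    rewrite tl !wE (hom_lin (one_tens_hom A)) amulDr amulZr //.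
  have wb c : `|w c| <= M * `|c|.
    apply: norm_le_mul => [|z]; first exact: mulr_ge0.
    have -> : w c ** z = lmult n (lmult (one A c) z).
      by have := congr1 (fun f => lmult f z) (wE c).
    apply: le_trans (nM _) _; rewrite -mulrA ler_wpM2l //.
    exact: (hom_contract tens (one_tens_hom A)).
  pose S := \sum_(p <- l) `|p.1| * (M * `|p.2.2|).
  have S0 : 0 <= S by apply: sumr_ge0 => p _; rewrite !mulr_ge0.
  apply: (@eps_le _ _ _ S) => // e e0 _.
  have [u [ul u1]] := near_unit tens [seq p.2.1 | p <- l] e0.
  have u2 := near_unit_norm u1.
  have E p : lmult (hid pi (w (u ** p.1))) p.2 = lmult (hid pi (w u)) (g p).
    have -> : w (u ** p.1) = rmult (one A p.1) (w u).
      apply: to_mult_inj; rewrite -to_mult_mul !wE (homM (one_tens_hom A)).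
      by rewrite amulA.
    by rewrite htens_one_tensr.
  have -> : comb (fun p : CG * tens B CG => lmult (hid pi (w p.1)) p.2) l =
      lmult (hid pi (w u)) (comb g l) +
      \sum_(p <- l) p.1 *: lmult (hid pi (w (p.2.1 - u ** p.2.1))) p.2.2.
    rewrite (lin_comb (blin_lin (hom_lmult_blin tens hh (w u)))) /comb -big_split /=.
    apply: eq_bigr => p _; rewrite -scalerDr -E (linB wlin) (linB (hom_lin hh)).
    by congr (_ *: _); rewrite -[lmult (_ - _) _]/(_ + (-1) *: _) scaleN1r addrC subrK.
  apply: le_trans (ler_normD _ _) _; apply: lerD.
    apply: le_trans (hom_contract tens hh _ _) _; rewrite ler_wpM2r //.
    by apply: le_trans (wb u) _; rewrite mulrC ler_wpM2r.
  apply: le_trans (ler_norm_sum _ _ _) _; rewrite /S mulr_sumr.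
  apply: ler_sum_In => p pl; rewrite normrZ mulrCA ler_wpM2l //.
  apply: le_trans (hom_contract tens hh _ _) _; rewrite mulrA ler_wpM2r //.
  apply: le_trans (wb _) _; rewrite mulrC ler_wpM2r // ltW // ul //.
  exact: (List.in_map (fun p => p.2.1)).
have [|||p q|X [XE _ _]] := @mult_of_gen R _ _ g gd (fun p => lmult (hid pi (x p.1)) p.2)
    (fun p => lmult (hid pi (y p.1)) p.2) (2 * M).
- exact: mulr_ge0.
- exact: gen.
- exact: gen.
- rewrite /g mult_adj -(hom_star hh) mult_adj -(hom_star (one_tens_hom B)).
  congr (_ ** _); rewrite -[LHS]/(lmult (hid pi _ ** one B _) _) -[RHS]/(lmult (one B _ ** hid pi _) _).
  rewrite -htens_one_tensr -htens_one_tensl; congr (lmult (hid pi _) _).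
  apply: to_mult_inj; rewrite -to_mult_mul -mul_to_mult xE.
  have [_ _ ->] := to_mult_hom (tens A CG).
  by rewrite yE (@starM _ (mult (tens A CG)) (star m) (one A p.1)) (@starK _ (mult (tens A CG)) m) amulA -(hom_star (one_tens_hom A)).
exists X => c x' x'E; have -> : x' = x c by apply: to_mult_inj; rewrite x'E xE.
by apply: lmult_inj => z; exact: (XE (c, z)).
Qed.

End HtensId.
End OneTens.

(** * Degenerate covariant homomorphisms *)

Lemma near_unit_nondegenerate (R : realType) (A B : cstarAlgType R) (phi : A -> mult B) :
  (forall b (e : R[i]), 0 < e -> exists u, `|b - lmult (phi u) b| < e) -> nondegenerate phi.
Proof.
move=> h; apply/seteqP; split=> // b _; apply/closureP => e e0.
have [u bu] := h b e e0; exists (lmult (phi u) b) => //.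
exists [:: (1, lmult (phi u) b)]; rewrite big_seq1 scale1r; split=> // p.
by rewrite inE => /eqP ->; exists u, b.
Qed.

Section HtensNondegenerate.
Variables (R : realType) (tens : forall A B : cstarAlgType R, min_tensor A B).
Variables (A B C : cstarAlgType R) (mu : A -> mult B).
Hypotheses (hmu : star_hom mu) (nmu : nondegenerate mu).
Local Notation K := R[i].

Lemma htens_nondegenerate : nondegenerate (htens (tens := tens) mu (@to_mult R C)).
Proof.
apply/seteqP; split=> // x _.
have : closed_span [set x | exists a b, x = tmk (tens B C) a b] x by rewrite tmk_dense.
apply: csubm_min; first exact: csubm_closed_span.
move=> _ [b [c ->]].
set S := [set x | exists _ _, _]; have [_ _ cl] := csubm_closed_span S; apply: cl => e e0.
have e2 : 0 < e / 2 by rewrite divr_gt0.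
have [d [d0 _ dc]] := @exists_small R (`|c|) (e / 2 / 2) (normr_ge0 _) ltac:(by rewrite divr_gt0).
have [f [bf _]] := nondegenerate_near_unit tens hmu nmu b d0.
pose b' := lmult (mu f) b.
have [d' [d'0 _ db]] := @exists_small R (`|b'|) (e / 2) (normr_ge0 _) e2.
have [u [uc _]] := near_unit tens [:: c] d'0.
exists (tmk (tens B C) b' (u ** c)).
  apply: closed_span_incl; exists (tmk (tens A C) f u), (tmk (tens B C) b c).
  by rewrite htens_tmk //; exact: to_mult_hom.
have -> : tmk (tens B C) b c - tmk (tens B C) b' (u ** c) =
    tmk (tens B C) (b - b') c + tmk (tens B C) b' (c - u ** c).
  rewrite (linB (tmk_linl (tens B C) c)) (linB (tmk_linr (tens B C) b')).
  by rewrite addrA subrK.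
rewrite (splitr e); apply: le_lt_trans (ler_normD _ _) _; apply: ltr_leD.
  apply: le_lt_trans (tmk_norm tens _ _ _) _; apply: (@le_lt_trans _ _ (d * `|c|)).
    by rewrite ler_wpM2r // ltW.
  by apply: le_lt_trans dc _; rewrite ltr_pdivrMr // ltr_pMr // ltr1n.
apply: le_trans (tmk_norm tens _ _ _) _; apply: le_trans db.
by rewrite mulrC ler_wpM2r // ltW // uc //; left.
Qed.

End HtensNondegenerate.

Section DegenerateCovariant.
Variables (R : realType) (tens : forall A B : cstarAlgType R, min_tensor A B).
Variables (G : topGroupType) (CG : group_cstar R G).
Hypotheses (hG : hausdorff_space G) (lG : locally_compact [set: G]).
Variables (A : cstarAlgType R) (delta : A -> mult (tens A CG)).
Hypothesis hdelta : coaction delta.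
Local Notation K := R[i].
Local Notation one A c := (one_tens tens (CG := CG) A c).
Local Notation hid pi := (htens (tens := tens) pi (@to_mult R CG)).
Local Notation w := (wG tens CG).

Section HtensBar.
Variables (B : cstarAlgType R) (pi : A -> mult B).
Hypothesis hpi : star_hom pi.

Definition is_htens_bar a X := forall c x, to_mult x = delta a ** one A c -> X ** one B c = hid pi x.

Lemma htens_barP a : is_htens_bar a (htens_bar pi (delta a)).
Proof.
apply: (@the_spec (mult (tens B CG)) 0 (is_htens_bar a)).
have hd := coact_hom hdelta.
apply: (htens_bar_exists hpi (M := `|a|)) => //; first exact: coact_mtilde.
  by move=> z; exact: (hom_contract tens hd).
by move=> z; rewrite -(hom_star hd) -(norm_star a); exact: (hom_contract tens hd).
Qed.

Lemma htens_bar_eq a X : is_htens_bar a X -> htens_bar pi (delta a) = X.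
Proof.
move=> h; apply: (lmult_inj_dense (one_tens_nondegenerate tens CG B)) => _ [c [z ->]].
have [[x xE] _] := coact_mtilde hdelta a c.
rewrite -[LHS]/(lmult (htens_bar pi (delta a) ** one B c) z).
by rewrite (htens_barP xE) -(h c x xE).
Qed.

End HtensBar.

Variables (B : cstarAlgType R) (pi : A -> mult B) (mu : c0 R G -> mult B).
Hypothesis hpm : degenerate_covariant delta pi mu.

Let hpi := cov_pi_hom hpm.
Let hmu := cov_mu_hom hpm.
Let nmu := cov_mu_nondeg hpm.
Let hM := htens_hom tens hmu (to_mult_hom CG).
Let hP := htens_hom tens hpi (to_mult_hom CG).

Definition cov_unitary := mext (hid mu) w.
Local Notation W := cov_unitary.

Lemma cov_unitaryP : [/\ forall y z, lmult W (lmult (hid mu y) z) = lmult (hid mu (lmult w y)) z,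
  star W ** W = mult1 (tens B CG) & W ** star W = mult1 (tens B CG)].
Proof.
have [w1 w2] := wG_unitary tens CG hG lG.
have := (mext_unitaryP hM (htens_nondegenerate tens CG hmu nmu) w1 w2).
exact.
Qed.

Lemma cov_W a : htens_bar pi (delta a) ** W = W ** mtens tens (pi a) (mult1 CG).
Proof.
have [_ W1 _] := cov_unitaryP.
by rewrite (cov_eq hpm) -/W -amulA W1 mulm1.
Qed.

Lemma mtens_star a : star (mtens tens (pi a) (mult1 CG)) = mtens tens (pi (star a)) (mult1 CG).
Proof.
apply: (lmult_inj_dense (tmk_dense (tens B CG))) => _ [b [c ->]].
rewrite (lmult_star_tmk (m := pi a) (n := mult1 CG)) => [|b' c'].
  by have [-> _] := mtens_left tens CG (star a) hpi; rewrite (hom_star hpi) star_mult1.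
by have [-> _] := mtens_left tens CG a hpi.
Qed.

Lemma htens_bar_star a : star (htens_bar pi (delta a)) = htens_bar pi (delta (star a)).
Proof.
rewrite !(cov_eq hpm) -/W -mtens_star starM (@starK _ (mult (tens B CG)) W) starM.
by rewrite amulA.
Qed.

Definition range_ideal : set B := closed_span [set x | exists a b, x = lmult (pi a) b].
Local Notation J := range_ideal.

Lemma ideal_csubm : csubm J. Proof. exact: csubm_closed_span. Qed.

Lemma ideal_gen a b : J (lmult (pi a) b).
Proof. by apply: closed_span_incl; exists a, b. Qed.

Lemma ideal_ind (P : set B) : csubm P -> (forall a b, P (lmult (pi a) b)) -> forall b, J b -> P b.
Proof. by move=> cP h; apply: csubm_min => // _ [a [b ->]]; exact: h. Qed.

Let JC : set (tens B CG) := closed_span [set x | exists j c, J j /\ x = tmk (tens B CG) j c].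

Let JC_tmk j c : J j -> JC (tmk (tens B CG) j c).
Proof. by move=> Jj; apply: closed_span_incl; exists j, c. Qed.

Lemma hid_range y z : JC (lmult (hid pi y) z).
Proof.
have cJ : csubm JC by exact: csubm_closed_span.
move: y; apply: (tensor_ind (T := tens A CG)) => [|a d].
  exact: (csubm_preim (hom_lmult_blinl tens hP z)).
move: z; apply: (tensor_ind (T := tens B CG)) => [|b e].
  exact: (csubm_preim (hom_lmult_blin tens hP _)).
rewrite htens_tmk //; last exact: to_mult_hom.
by apply: JC_tmk; exact: ideal_gen.
Qed.

Lemma W_blin : blin (lmult W).
Proof.
apply: (@blin_lmult _ _ W 1) => // x; rewrite mul1r; have [_ W1 _] := cov_unitaryP.
by rewrite (unitary_norm x W1).
Qed.

Lemma one_blin (D : cstarAlgType R) c : blin (lmult (one D c)).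
Proof. exact: (hom_lmult_blin tens (one_tens_hom tens CG D)). Qed.

Lemma W_ideal j c c' : J j -> JC (lmult (one B c') (lmult W (tmk (tens B CG) j c))).
Proof.
move: j; apply: ideal_ind => [|a b].
  apply: (csubm_preim _ (csubm_closed_span _)); apply: (blin_comp (one_blin B c')).
  by apply: (blin_comp W_blin); exact: (blin_tmkl tens).
have -> : lmult W (tmk (tens B CG) (lmult (pi a) b) c) =
    lmult (htens_bar pi (delta a)) (lmult W (tmk (tens B CG) b c)).
  rewrite -[RHS]/(lmult (htens_bar pi (delta a) ** W) _) cov_W.
  rewrite -[RHS]/(lmult W (lmult (mtens tens (pi a) (mult1 CG)) _)).
  by have [-> _] := mtens_left tens CG a hpi.
set z := lmult W _.
(* [htens_bar] is characterized by multiplication with [1 (x) c] on the right. Passing to adjoints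
   gives its product with [1 (x) c'] on the left, which is a value of [hid pi]. *)
have [[x xE] _] := coact_mtilde hdelta (star a) (star c').
have := htens_barP hpi xE => /(congr1 (@star R (mult (tens B CG)))).
rewrite starM -(hom_star (one_tens_hom tens CG B)) starK htens_bar_star starK => E.
rewrite -[lmult (one B c') _]/(lmult (one B c' ** htens_bar pi (delta a)) z) E.
by rewrite -(hom_star hP); exact: hid_range.
Qed.

Lemma slice_ideal (psi : CG -> K^o) z : blin psi -> JC z -> J (slice psi z).
Proof.
move=> bp; apply: (csubm_min (P := fun z => J (slice psi z))); first exact: (csubm_preim (slice_blin _ bp) ideal_csubm).
move=> _ [j [c [Jj ->]]]; rewrite slice_tmk //.
have [J0 JD _] := ideal_csubm; rewrite -[_ *: j]addr0; exact: JD.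
Qed.

(** Moves the slice inside [mu], to the tensor product with [C_0(G)], where [ev_slice] computes it
    pointwise; [c'] and [c2] become part of the functional. *)
Lemma slice_hid_mu (om : CG -> K^o) c' c2 y b : blin om ->
  slice om (lmult (one B c') (lmult (hid mu y) (tmk (tens B CG) b c2))) =
  lmult (mu (slice (fun z => om (c' ** z ** c2)) y)) b.
Proof.
move=> bo.
have bo' : blin (fun z => om (c' ** z ** c2) : K^o).
  apply: (blin_comp bo); apply: (blin_comp (blin_mulr c2)); exact: blin_mull.
move: y; apply: (tensor_ind (T := tens (c0 R G) CG)) => [|f d].
  apply: csubm_eq.
    apply: (blin_comp (slice_blin _ bo)); apply: (blin_comp (one_blin B c')).
    exact: (hom_lmult_blinl tens hM).
  by apply: (blin_comp (hom_lmult_blinl tens hmu b)); exact: (slice_blin _ bo').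
rewrite htens_tmk //; last exact: to_mult_hom.
rewrite one_tens_tmk !slice_tmk // (linZ (hom_lin hmu)) /=.
by rewrite amulA.
Qed.

(* Slicing [(1 (x) c') W (j (x) c)] with a functional [om] gives an element of [J]
   by covariance, and [mu f j] with [f] a coefficient function of [om] up to the
   approximate unit [g]. *)
Lemma mu_ideal h j : J j -> J (lmult (mu h) j).
Proof.
move=> Jj; have [_ _ Jc] := ideal_csubm; apply: Jc => e e0.
have e4 : 0 < e / 4 by rewrite divr_gt0.
have [d [d0 _ de]] := @exists_small R (2 * `|j|) (e / 4) ltac:(by rewrite mulr_ge0) e4.
have [om [c' [c1 [c2 [bo hom]]]]] := coefficient_density tens CG hG lG h d0.
pose E b := slice om (lmult (one B c') (lmult W (tmk (tens B CG) b (c1 ** c2)))).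
have bE : blin E.
  apply: (blin_comp (slice_blin _ bo)); apply: (blin_comp (one_blin B c')).
  by apply: (blin_comp W_blin); exact: (blin_tmkl tens).
have [_ [N N0 EN]] := bE.
have [d' [d'0 _ de']] := @exists_small R (`|h| + N) (e / 4) ltac:(by rewrite addr_ge0) e4.
(* [W] is described only on the range of [hid mu]; inserting [mu g] in front of [j] brings the
   vector there and contributes the factor [g] to [gF]. *)
have [g [jg g1]] := nondegenerate_near_unit tens hmu nmu j d'0.
exists (E j); first by apply: slice_ideal => //; exact: W_ideal.
pose gF := slice (fun z => om (c' ** z ** c2)) (lmult w (tmk (tens (c0 R G) CG) g c1)).
have Eg : E (lmult (mu g) j) = lmult (mu gF) j.
  have [WE _ _] := cov_unitaryP.
  rewrite /E -slice_hid_mu // -WE htens_tmk //; exact: to_mult_hom.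
have bo' : blin (fun z => om (c' ** z ** c2) : K^o).
  apply: (blin_comp bo); apply: (blin_comp (blin_mulr c2)); exact: blin_mull.
have gFE s : gF s = g s * om (c' ** lmult (gc_unit CG s) (c1 ** c2)).
  rewrite /gF ev_slice // ev_wG // ev_tmk lmultZ amulZr amulZl lmultMx amulA.
  exact: (linZ (blin_lin bo)).
have hg : `|g ** h - gF| <= 2 * d.
  apply: c0_norm_ptwise => s; rewrite -[_ s]/(g s * h s - gF s) gFE -mulrBr normrM.
  apply: ler_pM => //; apply: le_trans (c0_normcP g s) _; exact: (near_unit_norm g1).
have -> : lmult (mu h) j - E j = lmult (mu h) (j - lmult (mu g) j) +
    lmult (mu (g ** h - gF)) j - E (j - lmult (mu g) j).
  (* Commutativity of [C_0(G)] brings [mu g] next to [j], where it is absorbed. *)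
  have comm : g ** h = h ** g by apply: c0_eq => s; exact: mulrC.
  rewrite (linB (blin_lin bE)) Eg lmultB (linB (hom_lin hmu)) comm (homM hmu).
  rewrite -[lmult (_ - _) j]/(lmult (mu h) (lmult (mu g) j) + (-1) *: lmult (mu gF) j).
  by lmod.
rewrite [ltRHS](_ : e = e / 4 + e / 4 + e / 4 + e / 4); last by field.
rewrite ltr_pwDr //.
have jg' := ltW jg.
have t1 : `|lmult (mu h) (j - lmult (mu g) j)| + `|E (j - lmult (mu g) j)| <= e / 4.
  apply: le_trans de'; rewrite mulrDr; apply: lerD.
    apply: le_trans (hom_contract tens hmu _ _) _; by rewrite mulrC ler_wpM2r.
  by apply: le_trans (EN _) _; rewrite mulrC ler_wpM2r.
have t2 : `|lmult (mu (g ** h - gF)) j| <= e / 4.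
  apply: le_trans de; apply: le_trans (hom_contract tens hmu _ _) _.
  by rewrite mulrA [d * 2]mulrC ler_wpM2r.
apply: le_trans (ler_normB _ _) _; apply: le_trans (lerD (ler_normD _ _) (lexx _)) _.
rewrite addrAC; apply: lerD => //; apply: le_trans t1 _; rewrite lerDl; exact: ltW.
Qed.

End DegenerateCovariant.

(** * The covariant homomorphism on a hereditary subalgebra *)

Section Restriction.
Variables (R : realType) (B D E : cstarAlgType R) (i : D -> B) (phi : E -> mult B).
Hypotheses (hi : star_hom i) (ni : forall d, `|i d| = `|d|) (hphi : star_hom phi).

Lemma isometric_hom_inj : injective i.
Proof.
move=> x y xy; apply/eqP; rewrite -subr_eq0 -normr_eq0 -ni; have [l _ _] := hi.
by rewrite (linB l) xy subrr normr0.
Qed.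

(** The right action on [D] comes from the left one through adjoints: [d phi(e)] is the adjoint of
    [phi (star e) (star d)]. *)
Lemma restrict_hom : (forall e d, exists d', i d' = lmult (phi e) (i d)) ->
  exists psi : E -> mult D, star_hom psi /\ forall e d, i (lmult (psi e) d) = lmult (phi e) (i d).
Proof.
have [il im ist] := hi; have inj := isometric_hom_inj.
move=> h; have /choice[l lE] : forall p : E * D, exists d', i d' = lmult (phi p.1) (i p.2).
  by move=> p; exact: h.
have rE e d : i (star (l (star e, star d))) = rmult (phi e) (i d).
  by rewrite ist lE /= rmult_star -(hom_star hphi) -ist.
have adj e d d' : d ** l (e, d') = star (l (star e, star d)) ** d'.
  by apply: inj; rewrite !im lE rE /= mult_centralizer.
pose psi e := @Mult R D (fun d => l (e, d)) (fun d => star (l (star e, star d))) (adj e).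
have psiE e d : i (lmult (psi e) d) = lmult (phi e) (i d) by exact: (lE (e, d)).
exists psi; split=> //; split.
- move=> k e e'; apply: lmult_inj => d; apply: inj.
  by rewrite -[lmult (_ + _) d]/(k *: lmult (psi e) d + lmult (psi e') d) il !psiE (hom_lin hphi).
- move=> e e'; apply: lmult_inj => d; apply: inj.
  by rewrite -[lmult (_ ** _) d]/(lmult (psi e) (lmult (psi e') d)) !psiE (homM hphi).
- move=> e; apply: lmult_inj => d; apply: inj; rewrite psiE.
  by rewrite lmult_star [rmult _ _]/= ist ist starK -[l _]/(lmult (psi (star e)) (star (star d))) starK psiE.
Qed.

Lemma restrict_rmult (psi : E -> mult D) : star_hom psi ->
  (forall e d, i (lmult (psi e) d) = lmult (phi e) (i d)) ->
  forall e d, i (rmult (psi e) d) = rmult (phi e) (i d).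
Proof.
have [_ _ ist] := hi.
move=> hpsi c e d; rewrite !rmult_star -!hom_star // ist c ist //.
Qed.

End Restriction.

Section Intertwiner.
Variables (R : realType) (tens : forall A B : cstarAlgType R, min_tensor A B).
Variables (G : topGroupType) (CG : group_cstar R G).
Local Notation K := R[i].
Local Notation one A c := (one_tens tens (CG := CG) A c).
Local Notation hid pi := (htens (tens := tens) pi (@to_mult R CG)).
Variables (B D : cstarAlgType R) (i : D -> B).
Hypotheses (hi : star_hom i) (ni : forall d, `|i d| = `|d|).

Let ti : star_hom (fun d => to_mult (i d)) := to_mult_comp_hom hi.
Let jh := htens_hom tens ti (to_mult_hom CG).
Local Notation j := (hid (fun d => to_mult (i d))).

Let ib : blin i.
Proof. by split; [case: hi|exists 1 => // d; rewrite ni mul1r]. Qed.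

(** Slicing [j z] at [b (x) c] gives [i] of the slice of [z (1 (x) c)], times [b]. As [i] is
    injective and slices separate, [z (1 (x) c) = 0] for all [c], and an approximate unit in [CG]
    removes the factor. *)
Lemma intertwiner_inj z : (forall y, lmult (j z) y = 0) -> z = 0.
Proof.
move=> jz.
have sl (psi : CG -> K^o) c b : blin psi ->
    slice psi (lmult (j z) (tmk (tens B CG) b c)) = i (slice (fun d => psi (d ** c)) z) ** b.
  move=> bp; have bp' : blin (fun d => psi (d ** c) : K^o) by apply: (blin_comp bp); exact: blin_mulr.
  move: {jz} z; apply: (tensor_ind (T := tens D CG)) => [|d e].
    apply: csubm_eq.
      by apply: (blin_comp (slice_blin _ bp)); exact: (hom_lmult_blinl tens jh).
    by apply: (blin_comp (blin_mulr b)); apply: (blin_comp ib); exact: (slice_blin _ bp').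
  rewrite htens_tmk //; last exact: to_mult_hom.
  by rewrite !slice_tmk // (linZ (blin_lin ib)) amulZl.
have rz c : rmult (one D c) z = 0.
  apply: slice_sep => psi bp.
  have -> : slice psi (rmult (one D c) z) = slice (fun d => psi (d ** c)) z.
    have bp' : blin (fun d => psi (d ** c) : K^o) by apply: (blin_comp bp); exact: blin_mulr.
    move: {jz sl} z; apply: (tensor_ind (T := tens D CG)) => [|d e].
      apply: csubm_eq; last exact: (slice_blin _ bp').
      apply: (blin_comp (slice_blin _ bp)); exact: (hom_rmult_blin tens (one_tens_hom tens CG D)).
    have -> : rmult (one D c) (tmk (tens D CG) d e) = tmk (tens D CG) d (e ** c).
      rewrite rmult_star -(hom_star (one_tens_hom tens CG D)) star_tmk one_tens_tmk star_tmk.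
      by rewrite starM !starK.
    by rewrite !slice_tmk.
  apply: (isometric_hom_inj hi ni); rewrite (lin0 (blin_lin ib)).
  apply: amul_injr => b; rewrite amul0l -sl // jz (lin0 (blin_lin (slice_blin _ bp))) //.
apply/eqP; rewrite -normr_le0; apply/ler_addgt0Pr => e e0; rewrite add0r.
have [u [zu _]] := nondegenerate_near_unit tens (one_tens_hom tens CG D)
  (one_tens_nondegenerate tens CG D) (star z) e0.
have E : lmult (one D u) (star z) = 0.
  have := rz (star u); rewrite rmult_star -(hom_star (one_tens_hom tens CG D)) starK.
  by move/(congr1 (@star R (tens D CG))); rewrite starK star0.
by move: zu; rewrite E subr0 norm_star => /ltW.
Qed.

Lemma intertwiner_hid (E : cstarAlgType R) (phi : E -> mult B) (psi : E -> mult D) :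
  star_hom phi -> star_hom psi -> (forall e d, i (lmult (psi e) d) = lmult (phi e) (i d)) ->
  forall x z y, lmult (j (lmult (hid psi x) z)) y = lmult (hid phi x) (lmult (j z) y).
Proof.
move=> hphi hpsi c x z y.
have h1 := htens_hom tens hphi (to_mult_hom CG); have h2 := htens_hom tens hpsi (to_mult_hom CG).
move: x; apply: (tensor_ind (T := tens E CG)) => [|e a].
  apply: csubm_eq; last exact: (hom_lmult_blinl tens h1).
  apply: (blin_comp (hom_lmult_blinl tens jh y)); exact: (hom_lmult_blinl tens h2).
move: z; apply: (tensor_ind (T := tens D CG)) => [|d f].
  apply: csubm_eq.
    apply: (blin_comp (hom_lmult_blinl tens jh y)); exact: (hom_lmult_blin tens h2).
  apply: (blin_comp (hom_lmult_blin tens h1 _)); exact: (hom_lmult_blinl tens jh).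
move: y; apply: (tensor_ind (T := tens B CG)) => [|b g].
  apply: csubm_eq; first exact: (hom_lmult_blin tens jh).
  apply: (blin_comp (hom_lmult_blin tens h1 _)); exact: (hom_lmult_blin tens jh).
by rewrite !htens_tmk //=; try exact: to_mult_hom; rewrite c lmultMx amulA.
Qed.

Lemma intertwiner_one c z y :
  lmult (j (lmult (one D c) z)) y = lmult (one B c) (lmult (j z) y).
Proof.
have h1 D' := one_tens_hom tens CG D'.
move: z; apply: (tensor_ind (T := tens D CG)) => [|d f].
  apply: csubm_eq.
    apply: (blin_comp (hom_lmult_blinl tens jh y)); exact: (hom_lmult_blin tens (h1 D)).
  apply: (blin_comp (hom_lmult_blin tens (h1 B) _)); exact: (hom_lmult_blinl tens jh).
rewrite one_tens_tmk; move: y; apply: (tensor_ind (T := tens B CG)) => [|b g].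
  apply: csubm_eq; first exact: (hom_lmult_blin tens jh).
  apply: (blin_comp (hom_lmult_blin tens (h1 B) _)); exact: (hom_lmult_blin tens jh).
by rewrite !htens_tmk //=; try exact: to_mult_hom; rewrite one_tens_tmk amulA.
Qed.

Lemma intertwiner_mtens (E : cstarAlgType R) (phi : E -> mult B) (psi : E -> mult D) :
  star_hom phi -> star_hom psi -> (forall e d, i (lmult (psi e) d) = lmult (phi e) (i d)) ->
  forall e z y, lmult (j (lmult (mtens tens (psi e) (mult1 CG)) z)) y =
    lmult (mtens tens (phi e) (mult1 CG)) (lmult (j z) y).
Proof.
move=> hphi hpsi c e z y.
have [p1 p2] := mtens_left tens CG e hphi; have [q1 q2] := mtens_left tens CG e hpsi.
have bp : blin (lmult (mtens tens (phi e) (mult1 CG))) by exact: (blin_lmult _ p2).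
have bq : blin (lmult (mtens tens (psi e) (mult1 CG))) by exact: (blin_lmult _ q2).
move: z; apply: (tensor_ind (T := tens D CG)) => [|d f].
  apply: csubm_eq; first by apply: (blin_comp (hom_lmult_blinl tens jh y)).
  by apply: (blin_comp bp); exact: (hom_lmult_blinl tens jh).
move: y; apply: (tensor_ind (T := tens B CG)) => [|b g].
  apply: csubm_eq; first exact: (hom_lmult_blin tens jh).
  by apply: (blin_comp bp); exact: (hom_lmult_blin tens jh).
rewrite q1 !htens_tmk //=; try exact: to_mult_hom.
by rewrite p1 c lmultMx.
Qed.

End Intertwiner.

Section IntegratedOnIdeal.
Variables (R : realType) (tens : forall A B : cstarAlgType R, min_tensor A B).
Variables (G : topGroupType) (CG : group_cstar R G).
Hypotheses (hG : hausdorff_space G) (lG : locally_compact [set: G]).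
Variables (A : cstarAlgType R) (delta : A -> mult (tens A CG)).
Hypothesis hdelta : coaction delta.
Variables (B : cstarAlgType R) (pi : A -> mult B) (mu : c0 R G -> mult B).
Hypothesis hpm : degenerate_covariant delta pi mu.
Local Notation K := R[i].
Local Notation one A c := (one_tens tens (CG := CG) A c).
Local Notation hid pi := (htens (tens := tens) pi (@to_mult R CG)).
Local Notation w := (wG tens CG).
Local Notation J := (range_ideal pi).

Let hpi := cov_pi_hom hpm.
Let hmu := cov_mu_hom hpm.
Let nmu := cov_mu_nondeg hpm.

Lemma lmult_rmultC (m n : mult B) b : rmult m (lmult n b) = lmult n (rmult m b).
Proof. by apply: amul_injl => z; rewrite mult_centralizer -!rmultMx mult_centralizer. Qed.

Lemma ideal_rmult (m : mult B) b : blin (rmult m) -> J b -> J (rmult m b).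
Proof.
move=> bm; move: b; apply: ideal_ind => [|a b].
  exact: (csubm_preim bm (ideal_csubm pi)).
by rewrite lmult_rmultC; exact: ideal_gen.
Qed.

Lemma ideal_mulr j b : J j -> J (j ** b).
Proof. by apply: (@ideal_rmult (to_mult b)); exact: blin_mulr. Qed.

Lemma pi_ideal a b : J (lmult (pi a) b). Proof. exact: ideal_gen. Qed.

Lemma hereditary_subproof : exists S : cstar_sub B, forall b, S b <-> J b /\ J (star b).
Proof.
have [J0 JD Jc] := ideal_csubm pi.
have c : csubm (fun b => J b /\ J (star b)).
  split; first by rewrite star0.
    by move=> k x y [x1 x2] [y1 y2]; rewrite starD starZ; split; exact: JD.
  move=> x h; split; apply: Jc => e e0; have [y [y1 y2] xy] := h e e0; first by exists y.
  by exists (star y) => //; rewrite -starB norm_star.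
have m x y : J x /\ J (star x) -> J y /\ J (star y) -> J (x ** y) /\ J (star (x ** y)).
  by move=> [x1 x2] [y1 y2]; rewrite starM; split; exact: ideal_mulr.
have s x : J x /\ J (star x) -> J (star x) /\ J (star (star x)) by rewrite starK => -[].
by exists (CstarSub c m s).
Qed.

Lemma hereditary_exists : exists (D : cstarAlgType R) (i : D -> B),
  [/\ star_hom i, forall d, `|i d| = `|d|, forall d, J (i d) /\ J (star (i d))
    & forall b, J b -> J (star b) -> exists d, i d = b].
Proof.
have [S SE] := hereditary_subproof.
exists (csub_alg S), (@csub_val R B S); split=> //.
- by move=> d; apply/SE; exact: csub_valS.
- move=> b b1 b2; have Sb : S b by apply/SE.
  by exists (csub_mk Sb).
Qed.

Variables (P : cstarAlgType R) (jA : A -> mult P) (jG : c0 R G -> mult P).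
Hypothesis hP : crossed_product delta jA jG.

(* Covariance on [D] is transported from [B] along the injective intertwiner
   [j : D (x) C*(G) -> M(B (x) C*(G))]. *)
Lemma integrated_on_ideal : exists (D : cstarAlgType R) (i : D -> B) (h : P -> mult D),
  [/\ star_hom i, forall d, `|i d| = `|d|, forall b, J b -> J (star b) -> exists d, i d = b,
      star_hom h & forall a f x d, to_mult x = jA a ** jG f ->
        i (lmult (h x) d) = lmult (pi a ** mu f) (i d) /\
        i (rmult (h x) d) = rmult (pi a ** mu f) (i d)].
Proof.
have [D [i [hi ni iJ Ji]]] := hereditary_exists.
have [piD [hpiD piDE]] : exists psi : A -> mult D, star_hom psi /\
    forall e d, i (lmult (psi e) d) = lmult (pi e) (i d).
  apply: (restrict_hom hi ni hpi) => a d; apply: Ji; first exact: pi_ideal.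
  have [i1 i2] := iJ d.
  (* In the adjoint the multiplier acts on the right, and such right actions preserve [J]. *)
  have -> : star (lmult (pi a) (i d)) = rmult (pi (star a)) (star (i d)).
    by rewrite rmult_star starK (hom_star hpi) (@starK _ (mult B) (pi a)).
  by apply: ideal_rmult => //; exact: (hom_rmult_blin tens hpi).
have [muD [hmuD muDE]] : exists psi : c0 R G -> mult D, star_hom psi /\
    forall e d, i (lmult (psi e) d) = lmult (mu e) (i d).
  apply: (restrict_hom hi ni hmu) => f d; have [i1 i2] := iJ d; apply: Ji.
    exact: (mu_ideal hG lG hdelta hpm).
  have -> : star (lmult (mu f) (i d)) = rmult (mu (star f)) (star (i d)).
    by rewrite rmult_star starK (hom_star hmu) (@starK _ (mult B) (mu f)).
  by apply: ideal_rmult => //; exact: (hom_rmult_blin tens hmu).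
have [il im ist] := hi.
have nmuD : nondegenerate muD.
  apply: near_unit_nondegenerate => d e e0.
  have [u [du _]] := nondegenerate_near_unit tens hmu nmu (i d) e0.
  by exists u; rewrite -ni (linB il) muDE.
(* Elements of [D] lie in the closed range of [pi], so approximate units of [A] act as approximate
   units on them. *)
have npiD : nondegenerate piD.
  apply: near_unit_nondegenerate => d e e0; have [i1 _] := iJ d.
  have [u [du _]] := closed_span_near_unit tens hpi i1 e0.
  by exists u; rewrite -ni (linB il) piDE.
have [w1 w2] := wG_unitary tens CG hG lG.
have hMD := htens_hom tens hmuD (to_mult_hom CG).
have nMD := htens_nondegenerate tens CG hmuD nmuD.
pose WD := mext (hid muD) w.
have [WDE WD1 WD2] : [/\ forall y z, lmult WD (lmult (hid muD y) z) = lmult (hid muD (lmult w y)) z,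
    star WD ** WD = mult1 (tens D CG) & WD ** star WD = mult1 (tens D CG)].
  by have := mext_unitaryP hMD nMD w1 w2; exact.
pose j := hid (fun d => to_mult (i d)).
have jh : star_hom j by exact: (htens_hom tens (to_mult_comp_hom hi) (to_mult_hom CG)).
have [WE W1 W2] := cov_unitaryP hG lG hpm.
set W := cov_unitary tens CG mu in WE W1 W2.
have jW z y : lmult (j (lmult WD z)) y = lmult W (lmult (j z) y).
  move: z; apply: (gen_ind (nondegenerate_near nMD)) => [|[x z] /=].
    apply: csubm_eq.
      apply: (blin_comp (hom_lmult_blinl tens jh y)).
      by apply: (@blin_lmult _ _ WD 1) => // z; rewrite mul1r (unitary_norm z WD1).
    by apply: (blin_comp (W_blin hG lG hpm)); exact: (hom_lmult_blinl tens jh).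
  by rewrite WDE !(intertwiner_hid hi hmu hmuD muDE) WE.
have jW' z y : lmult (j (lmult (star WD) z)) y = lmult (star W) (lmult (j z) y).
  have -> : lmult (j z) y = lmult W (lmult (j (lmult (star WD) z)) y).
    by rewrite -jW -[lmult WD _]/(lmult (WD ** star WD) z) WD2.
  by rewrite -[RHS]/(lmult (star W ** W) _) W1.
have covD : nondegenerate_covariant delta piD muD.
  split=> //; apply: (DegenerateCovariant hpiD hmuD nmuD) => a /=.
  apply: (htens_bar_eq hdelta hpiD) => c x xE.
  apply: lmult_inj => z; apply/eqP; rewrite -subr_eq0; apply/eqP.
  apply: (intertwiner_inj hi ni) => y; rewrite -/j (linB (hom_lin jh)).
  rewrite -[lmult (_ - _) y]/(lmult (j _) y + (-1) *: lmult (j _) y) scaleN1r.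
  apply/eqP; rewrite subr_eq0; apply/eqP.
  rewrite -[lmult (_ ** one D c) z]/(lmult WD (lmult (mtens tens (piD a) (mult1 CG))
    (lmult (star WD) (lmult (one D c) z)))).
  rewrite jW (intertwiner_mtens hi hpi hpiD piDE) jW' (intertwiner_one hi).
  rewrite (intertwiner_hid hi hpi hpiD piDE) -(htens_barP hdelta hpi xE).
  by rewrite (cov_eq hpm).
have [hD [[hhD hDE] _]] := cp_univ hP covD.
exists D, i, hD; split=> // a f x d xE.
rewrite (hDE _ _ _ xE) -[lmult _ d]/(lmult (piD a) (lmult (muD f) d)) piDE muDE.
rewrite -[rmult _ d]/(rmult (muD f) (rmult (piD a) d)).
by rewrite (restrict_rmult hi hmu hmuD muDE) (restrict_rmult hi hpi hpiD piDE).
Qed.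

End IntegratedOnIdeal.

(** * Extension from the hereditary subalgebra to the whole algebra *)

Section Integration.
Variables (R : realType) (tens : forall A B : cstarAlgType R, min_tensor A B).
Variables (G : topGroupType) (CG : group_cstar R G).
Hypotheses (hG : hausdorff_space G) (lG : locally_compact [set: G]).
Variables (A : cstarAlgType R) (delta : A -> mult (tens A CG)).
Hypothesis hdelta : coaction delta.
Variables (P : cstarAlgType R) (jA : A -> mult P) (jG : c0 R G -> mult P).
Hypothesis hP : crossed_product delta jA jG.
Variables (B : cstarAlgType R) (pi : A -> mult B) (mu : c0 R G -> mult B).
Hypothesis hpm : degenerate_covariant delta pi mu.
Local Notation K := R[i].
Local Notation J := (range_ideal pi).

Let hpi := cov_pi_hom hpm.
Let hmu := cov_mu_hom hpm.

Let pm (p : A * c0 R G) : mult B := pi p.1 ** mu p.2.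

Lemma lmult_comb (I : Type) (m : I -> mult B) l b :
  lmult (comb m l) b = comb (fun p => lmult (m p) b) l.
Proof. exact: lmult_sumM. Qed.

Lemma rmult_comb (I : Type) (m : I -> mult B) l b :
  rmult (comb m l) b = comb (fun p => rmult (m p) b) l.
Proof.
by rewrite /comb; elim: l => [|p l ih]; rewrite ?big_nil // !big_cons -ih.
Qed.

Lemma pm_ideal p b : J (lmult (pm p) b).
Proof. exact: ideal_gen. Qed.

(** The adjoint of [b pi(a) mu(f)] is [mu (star f) pi (star a) (star b)], so this is a second use of
    the invariance of [J] under [mu]. *)
Lemma pm_rideal p b : J (star (rmult (pm p) b)).
Proof.
rewrite -[rmult _ b]/(rmult (mu p.2) (rmult (pi p.1) b)) !rmult_star !starK -!hom_star //.
by apply: (mu_ideal hG lG hdelta hpm); exact: ideal_gen.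
Qed.

Lemma csubm_star (V : set B) : csubm V -> csubm (fun b => V (star b)).
Proof.
move=> [V0 VD Vc]; split; first by rewrite star0.
  by move=> k x y Vx Vy; rewrite starD starZ; exact: VD.
move=> x h; apply: Vc => e e0; have [y Vy xy] := h e e0.
by exists (star y) => //; rewrite -starB norm_star.
Qed.

Lemma csubm_comb (V : set B) (I : Type) (g : I -> B) l : csubm V ->
  (forall i, V (g i)) -> V (comb g l).
Proof.
move=> [V0 VD _] Vg; rewrite /comb; elim: l => [|p l ih]; first by rewrite big_nil.
by rewrite big_cons; exact: VD.
Qed.

Lemma exists_generators : exists x : A * c0 R G -> P,
  (forall p, to_mult (x p) = jA p.1 ** jG p.2) /\
  forall z (e : K), 0 < e -> exists l, `|z - comb x l| < e.
Proof.
have /choice[x xE] : forall p : A * c0 R G, exists x, to_mult x = jA p.1 ** jG p.2.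
  by move=> p; exact: (cp_mem hP).
exists x; split=> // z e e0.
apply: (closed_span_comb (S := [set x | exists a f, to_mult x = jA a ** jG f])) => //; last exact: (cp_span hP).
by move=> y [a [f yE]]; exists (a, f); apply: to_mult_inj; rewrite yE xE.
Qed.

Section OnIdeal.
Variables (D : cstarAlgType R) (i : D -> B).
Hypotheses (hi : star_hom i) (ni : forall d, `|i d| = `|d|)
  (Ji : forall b, J b -> J (star b) -> exists d, i d = b).

(** Elements of [J] need not lie in [D], but these products do; [mult_vanish] and [pm_bound] pass
    from [D] to [J] through them. *)
Lemma ideal_sq z z' : J z -> J z' -> exists d, i d = z ** star z'.
Proof.
move=> Jz Jz'; apply: Ji; first exact: ideal_mulr.
by rewrite starM starK; exact: ideal_mulr.
Qed.

(* For [z] in [J], [n z ** star (n z)] vanishes because [z ** star (n z)] is in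
   [J ** star J]; for arbitrary [b], [star (n b) ** n b = star (star n (n b)) ** b]
   with [n b] in [J]. *)
Lemma mult_vanish (n : mult B) :
  (forall d, lmult n (i d) = 0) -> (forall d, lmult (star n) (i d) = 0) ->
  (forall b, J (lmult n b)) -> (forall b, J (lmult (star n) b)) -> n = 0.
Proof.
have onJ (m : mult B) : (forall d, lmult m (i d) = 0) -> (forall b, J (lmult m b)) ->
    forall z, J z -> lmult m z = 0.
  move=> m0 mJ z Jz; apply/eqP; rewrite -normr_eq0 -sqrf_eq0 -norm_star2 normr_eq0.
  by have [d dE] := ideal_sq Jz (mJ z); rewrite -lmultMx -dE m0.
move=> n0 sn0 nJ snJ; apply: lmult_inj => b; rewrite [RHS]/=.
apply: star_amul_eq0; rewrite mult_centralizer rmult_star starK.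
by rewrite (onJ (star n)) // star0 amul0l.
Qed.

End OnIdeal.

Section Bound.
Variables (D : cstarAlgType R) (i : D -> B) (h : P -> mult D) (x : A * c0 R G -> P).
Hypotheses (hi : star_hom i) (ni : forall d, `|i d| = `|d|)
  (Ji : forall b, J b -> J (star b) -> exists d, i d = b) (hh : star_hom h)
  (hr : forall p d, i (rmult (h (x p)) d) = rmult (pm p) (i d)).

(* For [z] in [J], [star m ** z ** star z ** m] can be computed in [D], which
   bounds [star z ** m] by [X]; apply this to [z = m b]. *)
Lemma pm_bound l b : `|lmult (comb pm l) b| <= `|comb x l| * `|b|.
Proof.
have [il im ist] := hi; set m := comb pm l; set X := comb x l.
have hrX d : i (rmult (h X) d) = rmult m (i d).
  have lF : linear (fun X => i (rmult (h X) d)).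
    by move=> k Y Z; rewrite (blin_lin (hom_rmult_blinl tens hh d)) il.
  rewrite /m rmult_comb /X (lin_comb lF); apply: eq_bigr => p _.
  by rewrite /= hr.
have mJ z : J z -> `|rmult m (star z)| <= `|X| * `|z|.
  move=> Jz; have [d dE] := ideal_sq Ji Jz Jz.
  have E : star (rmult m (star z)) ** rmult m (star z) = i (rmult (h X) (star (rmult (h X) d))).
    rewrite hrX ist hrX dE -!rmultMx; congr (rmult m _).
    by rewrite rmultMx starM.
  apply: sqr_le => //.
  rewrite -norm_starM E ni; apply: le_trans (hom_rcontract tens hh _ _) _.
  rewrite exprMn expr2 -mulrA ler_wpM2l // norm_star.
  apply: le_trans (hom_rcontract tens hh _ _) _.
  by rewrite ler_wpM2l // -ni dE norm_star2.
set c := lmult m b; have Jc : J c.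
  by rewrite /c /m lmult_comb; apply: (csubm_comb l (ideal_csubm pi)) => p; exact: pm_ideal.
have := norm_starM c; rewrite {2}/c mult_centralizer expr2 => E.
have [->|n0] := eqVneq `|c| 0; first exact: mulr_ge0.
have c0 : 0 < `|c| by rewrite lt_neqAle eq_sym n0 normr_ge0.
rewrite -(ler_pM2r c0) -E; apply: le_trans (norm_amul _ _) _.
by rewrite mulrAC ler_wpM2r // mJ.
Qed.

End Bound.

(** [pm_bound] and its version on the right extend the prescribed left and right actions from the
    generators to [P]. Products and adjoints of generators come with no expression in the
    generators, so the algebraic identities are verified on [D], where the map agrees with [h], and
    reach [B] by [mult_vanish], all values lying in [J]. *)
Theorem integrated_form : exists! h : P -> mult B, integrates jA jG pi mu h.
Proof.
have [x [xE gd]] := exists_generators.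
have [D [i [h [hi ni Ji hh hE]]]] := integrated_on_ideal hG lG hdelta hpm hP.
have hl p d : i (lmult (h (x p)) d) = lmult (pm p) (i d) by case: (hE p.1 p.2 (x p) d (xE p)).
have hr p d : i (rmult (h (x p)) d) = rmult (pm p) (i d) by case: (hE p.1 p.2 (x p) d (xE p)).
have [il im ist] := hi.
have ib : blin i by split=> //; exists 1 => // d; rewrite ni mul1r.
have bnd := pm_bound hi ni Ji hh hr.
have /choice[L LP] : forall b, exists F : P -> B, [/\ linear F,
    forall p, F (x p) = lmult (pm p) b & forall y, `|F y| <= `|b| * `|y|].
  move=> b; apply: (blin_ext gd) => // l.
  by rewrite -lmult_comb mulrC; exact: bnd.
have /choice[Q QP] : forall b, exists F : P -> B, [/\ linear F,
    forall p, F (x p) = rmult (pm p) b & forall y, `|F y| <= `|b| * `|y|].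
  move=> b; apply: (blin_ext gd) => // l.
  by rewrite -rmult_comb mulrC; exact: (rmult_bound _ (bnd l)).
have Lb b : blin (L b) by case: (LP b) => l _ Lb; split=> //; exists `|b|.
have Qb b : blin (Q b) by case: (QP b) => l _ Qb; split=> //; exists `|b|.
have Lx b p : L b (x p) = lmult (pm p) b by case: (LP b).
have Qx b p : Q b (x p) = rmult (pm p) b by case: (QP b).
have cent y b b' : b ** L b' y = Q b y ** b'.
  move: y; apply: (gen_ind gd) => [|p]; last by rewrite Lx Qx mult_centralizer.
  apply: csubm_eq; first by apply: (blin_comp (blin_mull b)).
  by apply: (blin_comp (blin_mulr b')).
pose g y := @Mult R B (fun b => L b y) (fun b => Q b y) (cent y).
have gl y b : lmult (g y) b = L b y by [].
have gx p : g (x p) = pm p by apply: lmult_inj => b; rewrite gl Lx.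
have glin : linear g.
  by move=> k y z; apply: lmult_inj => b; rewrite gl (blin_lin (Lb b)).
have gD y d : lmult (g y) (i d) = i (lmult (h y) d).
  rewrite gl; move: y; apply: (gen_ind gd) => [|p]; last by rewrite Lx hl.
  by apply: csubm_eq => //; apply: (blin_comp ib); exact: (hom_lmult_blinl tens hh).
have gDr y d : rmult (g y) (i d) = i (rmult (h y) d).
  rewrite [LHS]/=; move: y; apply: (gen_ind gd) => [|p]; last by rewrite Qx hr.
  by apply: csubm_eq => //; apply: (blin_comp ib); exact: (hom_rmult_blinl tens hh).
have gsD y d : lmult (star (g y)) (i d) = i (lmult (star (h y)) d).
  by rewrite !lmult_star -ist gDr ist.
have cJ := ideal_csubm pi; have [J0 JD _] := cJ.
have gJ y b : J (lmult (g y) b).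
  rewrite gl; move: y; apply: (gen_ind gd) => [|p]; first exact: csubm_preim.
  by rewrite Lx; exact: pm_ideal.
have gsJ y b : J (lmult (star (g y)) b).
  rewrite lmult_star [rmult _ _]/=; move: y; apply: (gen_ind gd) => [|p].
    exact: (csubm_preim (Qb _) (csubm_star cJ)).
  by rewrite Qx; exact: pm_rideal.
have JB b b' : J b -> J b' -> J (b - b').
  by move=> Jb Jb'; rewrite addrC -scaleN1r; exact: JD.
have lB (m n : mult B) b : lmult (m - n) b = lmult m b - lmult n b.
  by rewrite -[lmult (m - n) b]/(lmult m b + (-1) *: lmult n b) scaleN1r.
have gstar y : g (star y) = star (g y).
  apply/eqP; rewrite -subr_eq0; apply/eqP.
  apply: (mult_vanish Ji) => [d|d|b|b]; rewrite ?starB ?(@starK _ (mult B) (g y)) lB.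
  - by rewrite gD gsD (hom_star hh) subrr.
  - by rewrite gD gsD (hom_star hh) (@starK _ (mult D) (h y)) subrr.
  - exact: JB.
  - exact: JB.
have gmul y z : g (y ** z) = g y ** g z.
  apply/eqP; rewrite -subr_eq0; apply/eqP.
  have E u v b : lmult (g u ** g v) b = lmult (g u) (lmult (g v) b) by [].
  apply: (mult_vanish Ji) => [d|d|b|b]; rewrite ?starB ?(@starM _ (mult B) (g y)) -?gstar ?starM lB E.
  - by rewrite !gD (homM hh) subrr.
  - by rewrite !gD (homM hh) subrr.
  - exact: JB.
  - exact: JB.
exists g; split.
  split=> // a f y yE; have -> : y = x (a, f) by apply: to_mult_inj; rewrite yE xE.
  by rewrite gx.
move=> g' [hg' g'E]; apply/funext => y; apply: lmult_inj => b; rewrite gl.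
move: y; apply: (gen_ind gd) => [|p].
  by apply: csubm_eq => //; exact: (hom_lmult_blinl tens hg').
by rewrite Lx (g'E p.1 p.2 _ (xE p)).
Qed.

End Integration.

Theorem corollary3p9 (R : realType)
    (tens : forall A B : cstarAlgType R, min_tensor A B)
    (G : topGroupType) (hG : hausdorff_space G)
    (lG : locally_compact [set: G])
    (CG : group_cstar R G)
    (A : cstarAlgType R) (delta : A -> mult (tens A CG))
    (hdelta : coaction delta)
    (P : cstarAlgType R) (jA : A -> mult P) (jG : c0 R G -> mult P)
    (hP : crossed_product delta jA jG)
    (B : cstarAlgType R) (pi : A -> mult B) (mu : c0 R G -> mult B)
    (hpimu : degenerate_covariant delta pi mu) :
  exists! h : P -> mult B,
    star_hom h /\
    forall (a : A) (f : c0 R G) (x : P),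
      to_mult x = jA a ** jG f -> h x = pi a ** mu f.
Proof. exact: (integrated_form hG lG hdelta hP hpimu). Qed.
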